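(* Let $\widetilde\Sigma\looparrowright\mathbb{E}(\widetilde\kappa,\widetilde\tau)$ be a minimal immersed surface and $\Sigma\looparrowright\mathbb{E}(\kappa,\tau)$ its sister $H$-immersion with phase angle $\theta\in[0,\pi)$. Let $\widetilde\gamma:[0,\ell]\to\widetilde\Sigma$ parametrize a horizontal geodesic of $\mathbb{E}(\widetilde\kappa,\widetilde\tau)$ with unit speed, and let $\gamma:[0,\ell]\to\Sigma$ be the conjugate (i.e. corresponding) curve in $\Sigma$. We can write the normal of $\widetilde\Sigma$ along $\widetilde\gamma$ as \[\widetilde N_{\widetilde\gamma(t)}=\cos(\vartheta(t))\,(\widetilde\xi_{\widetilde\gamma(t)}\times\widetilde\gamma'(t))+\sin(\vartheta(t))\,\widetilde\xi_{\widetilde\gamma(t)}\] for some $\vartheta\in\mathcal C^\infty([0,\ell])$. Then: (a) The curve $\gamma$ satisfies $\langle\gamma',\xi\rangle=\sin(\theta)\cos(\vartheta)$. (b) The projection $\alpha=\pi\circ\gamma$ is a regular curve precisely at points where $\cos^2(\theta)+\nu^2\sin^2(\theta)\neq0$, in which case $\alpha$ has geodesic curvature \[\kappa_g=\frac{\left(2\tau(\cos^2(\theta)+\nu^2\sin^2(\theta))-\vartheta'\cos(\theta)\right)\sin(\theta)\cos(\vartheta)}{(\cos^2(\theta)+\nu^2\sin^2(\theta))^{3/2}}\] as a curve of $\mathbb{M}^2(\kappa)$ with respect to $\pi_*\frac{\xi\times\gamma'}{\|\xi\times\gamma'\|}$ as unit normal to $\alpha$. (c) Let $P=\pi^{-1}(\alpha)$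 be the (flat) vertical cylinder over $\alpha$. At regular points of $\alpha$, the curve $\gamma$ has geodesic curvature \[\kappa_g^P=\frac{\vartheta'\sin(\vartheta)\sin(\theta)}{(\cos^2(\theta)+\nu^2\sin^2(\theta))^{1/2}}\] as a curve of $P$ with respect to $\frac{\gamma'\times(\xi\times\gamma')}{\|\xi\times\gamma'\|}$ as unit normal. Moreover, the cosine of the angle of the intersection $\Sigma\cap P$ along $\gamma$, i.e. $\left\langle N,\frac{\xi\times\gamma'}{\|\xi\times\gamma'\|}\right\rangle$, equals $\frac{\cos(\theta)\cos(\vartheta)}{(\cos^2(\theta)+\nu^2\sin^2(\theta))^{1/2}}$.
   Context: $\mathbb{E}(\kappa,\tau)$ is the unique simply connected oriented Riemannian 3-manifold admitting a Riemannian submersion $\pi:\mathbb{E}(\kappa,\tau)\to\mathbb{M}^2(\kappa)$ onto the complete simply connected surface of constant curvature $\kappa$ whose fibers are the integral curves of a complete unit Killing field $\xi$ satisfying $\overline\nabla_X\xi=\tau\,X\times\xi$ (constant bundle curvature $\tau$). Vertical means tangent to $\xi$; horizontal means orthogonal to $\xi$. For an isometric immersion of an oriented surface $\Sigma$ into $\mathbb{E}(\kappa,\tau)$ with unit normal $N$, the fundamental data are: the shape operator $Av=-\overline\nabla_vN$; the angle function $\nu=\langle N,\xi\rangle$; the tangent part $T=\xi-\nu N$; and the $\frac\pi2$-rotation $J$ given by $Ju=N\times u$. The mean curvature is $H=\frac12\mathrm{trace}(A)$. Let $\mathrm{Rot}_\theta=\cos(\theta)\,\mathrm{id}+\sin(\theta)J$.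 Let $\kappa,\tau,H,\widetilde\kappa,\widetilde\tau,\widetilde H$ be real with $\kappa-4\tau^2=\widetilde\kappa-4\widetilde\tau^2$ and $\tau+iH=e^{i\theta}(\widetilde\tau+i\widetilde H)$. An $\widetilde H$-immersion into $\mathbb{E}(\widetilde\kappa,\widetilde\tau)$ and an $H$-immersion into $\mathbb{E}(\kappa,\tau)$ of the same simply connected Riemannian surface are sister immersions with phase angle $\theta$ if their fundamental data satisfy $(A,T,J,\nu)=(\mathrm{Rot}_\theta\circ(\widetilde A-\widetilde H\,\mathrm{id})+H\,\mathrm{id},\ \mathrm{Rot}_\theta(\widetilde T),\ \widetilde J,\ \widetilde\nu)$ (Daniel's correspondence). Tildes denote objects in $\mathbb{E}(\widetilde\kappa,\widetilde\tau)$. Here $\widetilde H=0$, so $\kappa=\widetilde\kappa-4\widetilde\tau^2\sin^2\theta$, $\tau=\widetilde\tau\cos\theta$, $H=\widetilde\tau\sin\theta$. Corresponding curves are those given by the same curve of the common abstract surface. In the claim, $\nu$ is evaluated along the curve.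
   Formalization: In (c) the geodesic curvature of γ in P, with respect to the same unit normal, is stated with the opposite sign: −ϑ′ sin(ϑ) sin(θ)/(cos²θ+ν² sin²θ)^{1/2}; the printed sign contradicts (a), since it must equal the derivative of ⟨γ′,ξ⟩ divided by that root. *)

(* Defs.v *)
From HB Require Import structures.
From mathcomp Require Import all_boot all_order all_algebra.
From mathcomp Require Import all_classical all_reals all_analysis.

Set Implicit Arguments.
Unset Strict Implicit.
Unset Printing Implicit Defensive.

Import Order.TTheory GRing.Theory Num.Theory.
Import numFieldNormedType.Exports.

Local Open Scope classical_set_scope.
Local Open Scope ring_scope.

(* Vectors are row vectors and linear maps act on the right: the endomorphism
   encoded by a matrix A is v |-> v *m A, so "B after A" is A *m B. *)

Definition bilin (R : realType) (n : nat) (G : 'M[R]_n) (u v : 'rV[R]_n) : R :=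
  (u *m G *m v^T) 0 0.

(** * Smoothness on open subsets of normed spaces *)

Section Smooth.
Context {R : realType} {V W : normedModType R}.

Fixpoint contDiff (k : nat) (f : V -> W) (U : set V) : Prop :=
  match k with
  | 0%N => forall x, U x -> {for x, continuous f}
  | k'.+1 => (forall x, U x -> differentiable f x) /\
             (forall v : V, contDiff k' (fun x => 'D_v f x) U)
  end.

Definition smooth_on (U : set V) (f : V -> W) : Prop :=
  forall k, contDiff k f U.

End Smooth.

(** * Smooth manifolds *)

Record chart (R : realType) (T : topologicalType) (n : nat) := Chart {
  dom : set T;
  cod : set 'rV[R]_n;
  fwd : T -> 'rV[R]_n;
  bwd : 'rV[R]_n -> T;
  dom_open : open dom;
  cod_open : open cod;
  fwd_cod : forall p, dom p -> cod (fwd p);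
  bwd_dom : forall x, cod x -> dom (bwd x);
  fwdK : forall p, dom p -> bwd (fwd p) = p;
  bwdK : forall x, cod x -> fwd (bwd x) = x;
  fwd_continuous : forall p, dom p -> {for p, continuous fwd};
  bwd_continuous : forall x, cod x -> {for x, continuous bwd}
}.

(* Every point p comes with a preferred chart [chart_at p] of the atlas; the
   tangent space at p is identified with R^n through that chart.  Hence a
   tangent vector at p is just a row vector, and all the notions below that are
   stated "in the preferred chart" do not depend on this choice. *)
Record manifold (R : realType) (n : nat) := Manifold {
  carrier :> topologicalType;
  carrier_hausdorff : hausdorff_space carrier;
  carrier_second_countable : @second_countable carrier;
  atlas : set (chart R carrier n);
  chart_at : carrier -> chart R carrier n;
  chart_at_atlas : forall p, atlas (chart_at p);
  chart_at_dom : forall p, dom (chart_at p) p;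
  transition_smooth : forall k k', atlas k -> atlas k' ->
    smooth_on (cod k `&` bwd k @^-1` dom k') (fwd k' \o bwd k)
}.

(* An oriented manifold is one whose atlas is oriented. *)
Definition oriented (R : realType) (n : nat) (M : manifold R n) : Prop :=
  forall k k' : chart R M n, atlas k -> atlas k' ->
  forall x, cod k x -> dom k' (bwd k x) ->
  0 < \det (jacobian (fwd k' \o bwd k) x).

Definition path_conn (R : realType) (T : topologicalType) : Prop :=
  forall p q : T, exists c : R -> T,
    [/\ {within `[0, 1], continuous c}, c 0 = p & c 1 = q].

Definition simply_conn (R : realType) (T : topologicalType) : Prop :=
  path_conn R T /\
  forall c : R -> T, {within `[0, 1], continuous c} -> c 0 = c 1 ->
  exists h : R * R -> T,
    [/\ {within `[0, 1] `*` `[0, 1], continuous h},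
        forall t, 0 <= t <= 1 -> h (0, t) = c t,
        forall t, 0 <= t <= 1 -> h (1, t) = c 0 &
        forall s, 0 <= s <= 1 -> h (s, 0) = c 0 /\ h (s, 1) = c 0].

(** ** Maps from an open subset of a normed space into a manifold *)

Section MapsInto.
Context {R : realType} {V : normedModType R} {n : nat} {M : manifold R n}.

Definition smooth_into (U : set V) (F : V -> M) : Prop :=
  (forall x, U x -> {for x, continuous F}) /\
  forall k : chart R M n, atlas k ->
    smooth_on (U `&` F @^-1` dom k) (fwd k \o F).

Definition push (F : V -> M) (x v : V) : 'rV[R]_n :=
  'D_v (fwd (chart_at (F x)) \o F) x.

End MapsInto.

Section TangentVectors.
Context {R : realType} {n : nat} {M : manifold R n}.

(* The components in the chart k of the tangent vector v at q. *)
Definition in_chart (k : chart R M n) (q : M) (v : 'rV[R]_n) : 'rV[R]_n :=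
  'D_v (fwd k \o bwd (chart_at q)) (fwd (chart_at q) q).

Definition smooth_along {V : normedModType R} (U : set V) (F : V -> M)
    (W : V -> 'rV[R]_n) : Prop :=
  forall k : chart R M n, atlas k ->
    smooth_on (U `&` F @^-1` dom k) (fun x => in_chart k (F x) (W x)).

Definition smooth_vector_field (X : M -> 'rV[R]_n) : Prop :=
  forall k : chart R M n, atlas k -> smooth_along (cod k) (bwd k) (X \o bwd k).

Definition velocity (c : R -> M) (t : R) : 'rV[R]_n := push c t 1.

End TangentVectors.

Section MapsBetween.
Context {R : realType} {m n : nat} {S : manifold R m} {M : manifold R n}.

Definition smooth_map (f : S -> M) : Prop :=
  forall k : chart R S m, atlas k -> smooth_into (cod k) (f \o bwd k).

Definition tmap (f : S -> M) (p : S) (v : 'rV[R]_m) : 'rV[R]_n :=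
  push (f \o bwd (chart_at p)) (fwd (chart_at p) p) v.

End MapsBetween.

(** * Riemannian geometry in coordinates

   [G] is the matrix of a metric on an open subset of R^n. *)

Section Coordinates.
Context {R : realType} {n : nat}.
Implicit Types (G : 'rV[R]_n -> 'M[R]_n) (x u v w : 'rV[R]_n).

(* Gamma(u, v)^k = 1/2 g^{kl} (D_u g(v, e_l) + D_v g(u, e_l) - D_{e_l} g(u, v)) *)
Definition christoffel G x u v : 'rV[R]_n :=
  (\row_l (2^-1 * (bilin ('D_u G x) v (delta_mx 0 l)
                 + bilin ('D_v G x) u (delta_mx 0 l)
                 - bilin ('D_(delta_mx 0 l) G x) u v))) *m invmx (G x).

(* R(u, v) w = D_u D_v w - D_v D_u w for constant vectors u, v, w *)
Definition curvature G x u v w : 'rV[R]_n :=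
  'D_u (fun y => christoffel G y v w) x - 'D_v (fun y => christoffel G y u w) x
  + christoffel G x u (christoffel G x v w)
  - christoffel G x v (christoffel G x u w).

(* The covariant derivative of c' along c. *)
Definition acceleration G (c : R -> 'rV[R]_n) (t : R) : 'rV[R]_n :=
  'D_1 (fun s => 'D_1 c s) t + christoffel G (c t) ('D_1 c t) ('D_1 c t).

End Coordinates.

Definition gauss_curvature (R : realType) (G : 'rV[R]_2 -> 'M[R]_2)
    (x : 'rV[R]_2) : R :=
  let e1 := delta_mx 0 0 in let e2 := delta_mx 0 1 in
  bilin (G x) (curvature G x e1 e2 e2) e1 / \det (G x).

(* kappa is the geodesic curvature at time t of the curve c (of arbitrary
   regular parametrization) with respect to the unit normal nu: it is the
   nu-component of the covariant derivative of the unit tangent with respect to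
   arc length, so it is positive when c bends towards nu. *)
Definition geodesic_curvature_is (R : realType) (G : 'rV[R]_2 -> 'M[R]_2)
    (c : R -> 'rV[R]_2) (t : R) (nu : 'rV[R]_2) (kappa : R) : Prop :=
  [/\ 'D_1 c t != 0,
      bilin (G (c t)) nu nu = 1,
      bilin (G (c t)) nu ('D_1 c t) = 0 &
      kappa = bilin (G (c t)) (acceleration G c t) nu
              / bilin (G (c t)) ('D_1 c t) ('D_1 c t)].

(** * Riemannian manifolds *)

(* The matrix, in the basis of coordinate vectors, of the pullback by F of the
   field g of bilinear forms on tangent spaces. *)
Definition pullback (R : realType) (m n : nat) (M : manifold R n)
    (g : M -> 'M[R]_n) (F : 'rV[R]_m -> M) (x : 'rV[R]_m) : 'M[R]_m :=
  \matrix_(i, j) bilin (g (F x)) (push F x (delta_mx 0 i))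
                                 (push F x (delta_mx 0 j)).

Record riemannian (R : realType) (n : nat) := Riemannian {
  rman :> manifold R n;
  metric : rman -> 'M[R]_n;
  metric_sym : forall p, (metric p)^T = metric p;
  metric_pos : forall p v, v != 0 -> 0 < bilin (metric p) v v;
  metric_smooth : forall k : chart R rman n, atlas k ->
    smooth_on (cod k) (pullback metric (bwd k))
}.

Section Riemannian.
Context {R : realType} {n : nat} {M : riemannian R n}.

Definition inner (p : M) (u v : 'rV[R]_n) : R := bilin (metric p) u v.

Definition chart_metric (p : M) : 'rV[R]_n -> 'M[R]_n :=
  pullback (@metric R n M) (bwd (chart_at p)).

(* The Levi-Civita covariant derivative, in the direction v, of the field W of
   tangent vectors of M along the map F. *)
Definition cov_along {V : normedModType R} (F : V -> M) (W : V -> 'rV[R]_n)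
    (x v : V) : 'rV[R]_n :=
  let k := chart_at (F x) in
  'D_v (fun y => in_chart k (F y) (W y)) x
  + christoffel (chart_metric (F x)) (fwd k (F x)) (push F x v) (W x).

Definition cov (X : M -> 'rV[R]_n) (p : M) (v : 'rV[R]_n) : 'rV[R]_n :=
  cov_along (bwd (chart_at p)) (X \o bwd (chart_at p)) (fwd (chart_at p) p) v.

Definition geodesic_at (c : R -> M) (t : R) : Prop :=
  acceleration (chart_metric (c t)) (fwd (chart_at (c t)) \o c) t = 0.

Definition geodesically_complete : Prop :=
  forall (p : M) (v : 'rV[R]_n), exists c : R -> M,
    [/\ smooth_into setT c, c 0 = p, velocity c 0 = v &
        forall t, geodesic_at c t].

End Riemannian.

(* The complete simply connected surface of constant curvature kappa. *)
Definition is_space_form (R : realType) (M : riemannian R 2) (kappa : R) :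
    Prop :=
  [/\ simply_conn R M, geodesically_complete (M := M) &
      forall p : M,
        gauss_curvature (chart_metric p) (fwd (chart_at p) p) = kappa].

Definition curve_curvature_is (R : realType) (M : riemannian R 2) (c : R -> M)
    (t : R) (nu : 'rV[R]_2) (kappa : R) : Prop :=
  geodesic_curvature_is (chart_metric (c t)) (fwd (chart_at (c t)) \o c) t
    nu kappa.

(** * Riemannian 3-manifolds: volume form and cross product *)

Section CrossProduct.
Context {R : realType} {E : riemannian R 3}.

(* Meaningful on oriented manifolds: preferred charts are then positive. *)
Definition volume (p : E) (u v w : 'rV[R]_3) : R :=
  Num.sqrt (\det (metric p)) * \det (\matrix_(i < 3) [:: u; v; w]`_i).

(* The vector u x v such that <u x v, w> = volume(u, v, w) for all w. *)
Definition cross (p : E) (u v : 'rV[R]_3) : 'rV[R]_3 :=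
  (\row_l volume p u v (delta_mx 0 l)) *m invmx (metric p).

Definition vnorm (p : E) (u : 'rV[R]_3) : R := Num.sqrt (inner p u u).

End CrossProduct.

Definition riemannian_submersion (R : realType) (m n : nat)
    (E : riemannian R m) (M : riemannian R n) (f : E -> M) : Prop :=
  [/\ smooth_map f,
      forall q, exists p, f p = q,
      forall p w, exists v, tmap f p v = w &
      forall p u v,
        (forall w, tmap f p w = 0 -> inner p u w = 0 /\ inner p v w = 0) ->
        inner (f p) (tmap f p u) (tmap f p v) = inner p u v].

(** * The homogeneous spaces E(kappa, tau)

   They are given by their characterization; [flow] is the flow of the complete
   field xi. *)
Record Ekt (R : realType) (kappa tau : R) := MkEkt {
  Ekt_space :> riemannian R 3;
  Ekt_base : riemannian R 2;
  Ekt_proj : Ekt_space -> Ekt_base;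
  xi : Ekt_space -> 'rV[R]_3;
  flow : R -> Ekt_space -> Ekt_space;
  Ekt_oriented : oriented Ekt_space;
  Ekt_simply_conn : simply_conn R Ekt_space;
  Ekt_base_form : is_space_form Ekt_base kappa;
  proj_submersion : riemannian_submersion Ekt_proj;
  xi_smooth : smooth_vector_field xi;
  xi_unit : forall p, inner p (xi p) (xi p) = 1;
  xi_killing : forall p u v,
    inner p (cov xi p u) v + inner p u (cov xi p v) = 0;
  flow_smooth : forall k : chart R Ekt_space 3, atlas k ->
    smooth_into (setT `*` cod k)
      (fun sx : R * 'rV[R]_3 => flow sx.1 (bwd k sx.2));
  flow0 : forall p, flow 0 p = p;
  flow_xi : forall p s, velocity (flow^~ p) s = xi (flow s p);
  fibers : forall p, Ekt_proj @^-1` [set Ekt_proj p] = range (flow^~ p);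
  bundle_curvature : forall p v, cov xi p v = tau *: cross p v (xi p)
}.

(** * Isometric immersions of surfaces in E(kappa, tau) *)

Section Immersions.
Context {R : realType} {kappa tau : R} {S : riemannian R 2} {E : Ekt kappa tau}.

Definition isometric_immersion (f : S -> E) : Prop :=
  smooth_map f /\
  forall p u v, inner (f p) (tmap f p u) (tmap f p v) = inner p u v.

(* N is the smooth unit normal compatible with the orientations of S and E. *)
Definition unit_normal (f : S -> E) (N : S -> 'rV[R]_3) : Prop :=
  [/\ forall k : chart R S 2, atlas k ->
        smooth_along (cod k) (f \o bwd k) (N \o bwd k),
      forall p, inner (f p) (N p) (N p) = 1,
      forall p v, inner (f p) (tmap f p v) (N p) = 0 &
      forall p u v, 0 < \det (\matrix_(i < 2) [:: u; v]`_i) ->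
        0 < volume (f p) (tmap f p u) (tmap f p v) (N p)].

Definition cov_normal (f : S -> E) (N : S -> 'rV[R]_3) (p : S) (v : 'rV[R]_2) :
    'rV[R]_3 :=
  cov_along (f \o bwd (chart_at p)) (N \o bwd (chart_at p))
    (fwd (chart_at p) p) v.

End Immersions.

(* Shape operator, tangent part of xi, rotation and angle function, as objects
   on the abstract surface. *)
Record fund_data (R : realType) (S : riemannian R 2) := Data {
  dA : S -> 'M[R]_2;
  dT : S -> 'rV[R]_2;
  dJ : S -> 'M[R]_2;
  dnu : S -> R
}.

Definition fundamental_data (R : realType) (kappa tau : R) (S : riemannian R 2)
    (E : Ekt kappa tau) (f : S -> E) (N : S -> 'rV[R]_3) (d : fund_data S) :
    Prop :=
  forall p : S,
    [/\ forall v, tmap f p (v *m dA d p) = - cov_normal f N p v,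
        dnu d p = inner (f p) (N p) (xi (f p)),
        tmap f p (dT d p) = xi (f p) - dnu d p *: N p &
        forall u, tmap f p (u *m dJ d p) = cross (f p) (N p) (tmap f p u)].

Definition mean_curvature (R : realType) (S : riemannian R 2) (d : fund_data S)
    (p : S) : R := 2^-1 * \tr (dA d p).

(* An H-immersion of the oriented Riemannian surface S, with its unit normal and
   its fundamental data. *)
Definition H_immersion (R : realType) (kappa tau : R) (S : riemannian R 2)
    (E : Ekt kappa tau) (f : S -> E) (N : S -> 'rV[R]_3) (d : fund_data S)
    (H : R) : Prop :=
  [/\ isometric_immersion f, unit_normal f N, fundamental_data f N d &
      forall p, mean_curvature d p = H].

Definition rot (R : realType) (theta : R) (J : 'M[R]_2) : 'M[R]_2 :=
  (cos theta)%:M + sin theta *: J.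

(* tau + i H = e^{i theta} (taut + i Ht), in real and imaginary parts. *)
Definition sister_parameters (R : realType)
    (kappa tau H kappat taut Ht theta : R) : Prop :=
  [/\ kappa - 4 * tau ^+ 2 = kappat - 4 * taut ^+ 2,
      tau = cos theta * taut - sin theta * Ht &
      H = sin theta * taut + cos theta * Ht].

Definition sister_data (R : realType) (S : riemannian R 2) (d dt : fund_data S)
    (H Ht theta : R) : Prop :=
  forall p : S,
    [/\ dA d p = (dA dt p - Ht%:M) *m rot theta (dJ dt p) + H%:M,
        dT d p = dT dt p *m rot theta (dJ dt p),
        dJ d p = dJ dt p &
        dnu d p = dnu dt p].

(** * Curves on [0, l] *)

(* Smooth up to the end points, i.e. the restriction to [0, l] of a map that is
   smooth on a neighbourhood of [0, l]; derivatives at the end points are those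
   of such an extension. *)
Definition smooth_segment (R : realType) (l : R) (f : R -> R) : Prop :=
  exists2 U : set R, open U /\ `[0, l] `<=` U & smooth_on U f.

Definition smooth_curve_segment (R : realType) (n : nat) (M : manifold R n)
    (l : R) (c : R -> M) : Prop :=
  exists2 U : set R, open U /\ `[0, l] `<=` U & smooth_into U c.

(* The vertical cylinder over the projection of c, swept by the vertical lines
   through the points of c: the coordinates are (t, s), the curve c being
   s = 0. *)
Definition vertical_cylinder (R : realType) (kappa tau : R) (E : Ekt kappa tau)
    (c : R -> E) (y : 'rV[R]_2) : E := flow (y 0 1) (c (y 0 0)).

Definition pt2 (R : realType) (t s : R) : 'rV[R]_2 := \row_j [:: t; s]`_j.

Arguments Ekt_proj {R kappa tau} E _ : rename.
Arguments xi {R kappa tau E} _ : rename.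
Arguments flow {R kappa tau E} _ _ : rename.

(* Main.v *)
Require Import Defs.
From HB Require Import structures.
From mathcomp Require Import all_boot all_order all_algebra.
From mathcomp Require Import all_classical all_reals all_analysis.
From mathcomp Require Import ring lra.
Import Order.TTheory GRing.Theory Num.Theory.
Import numFieldNormedType.Exports.
Local Open Scope classical_set_scope.
Local Open Scope ring_scope.

(** The geometry is carried by a few scalar identities along the curve. Write g for
    the horizontal geodesic, gamma for the conjugate curve, vt for the angle of the
    normal of the minimal surface, and W = xi x g'.

    On the minimal surface, W and xi form an orthonormal basis of the normal plane of
    g, so that the normal is cos vt W + sin vt xi and the rotated velocity is
    - cos vt xi + sin vt W. Since nabla_v xi = taut v x xi, differentiating the scalar
    products of the normal with g', xi and W along the geodesic shows that the normal
    turns at speed vt' + taut: the shape operator sends g' to (vt' + taut) times the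
    rotated velocity ([cov_normal_velocity], [cov_normal_xi], [cov_normal_cross]).
    Rotating by the phase theta gives the tangent part of xi and the second fundamental
    form of the sister surface in the direction of gamma', namely
    <gamma', xi> = sin theta cos vt, <N x gamma', xi> = - cos theta cos vt and
    - vt' sin theta ([sister_velocity_xi], [sister_rotated_xi], [sister_shape]). The
    curve is a geodesic of the common surface, a property of its metric alone, so that
    gamma accelerates by - vt' sin theta N ([isometric_acceleration],
    [geodesic_acceleration_normal]).

    All the claims follow. The function D of the theorem is 1 - <gamma', xi>^2, i.e.
    the squared norm of xi x gamma' and the squared speed of the projection. The
    acceleration of the projection is the horizontal part of that of gamma, corrected by
    - 2 tau <gamma', xi> gamma' x xi because the horizontal planes are not integrable
    ([proj_acceleration]); this gives the curvature in (b). The cylinder is swept by the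
    isometric flow of xi, so that its metric depends on one parameter only and is flat
    ([cylinder_flat]), and the geodesic curvature in (c) is the component of the
    acceleration of gamma along the normal inside the cylinder
    ([cylinder_geodesic_curvature]). Finally the angle vt exists because the two
    components of the normal describe a smooth curve of the unit circle, whose angular
    speed is integrated ([angle_lift]).

    Two technical points recur. Hypotheses hold only for times in [0, l], so that at the
    end points they are differentiated from one side ([derive_eq_segment]). And the
    tangent spaces are read in preferred charts that vary with the point: the smooth
    calculus below serves to pass to a fixed chart, after which only three rules are
    used, the product rule [derive_inner], torsion-freeness [cov_push_sym] and the
    naturality of accelerations [pullback_euler_lagrange]. *)

Set Implicit Arguments.
Unset Strict Implicit.
Unset Printing Implicit Defensive.

(** * Rules for directional derivatives *)

Section DerivativeRules.
Context {R : realType} {V : normedModType R}.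

Lemma near_differentiable (W : normedModType R) (f g : V -> W) (x : V) :
  (\forall y \near x, f y = g y) -> differentiable f x -> differentiable g x.
Proof.
move=> fg df; have [dfc _] := (diff_locallyP x f).1 df.
have /diff_locallyx := df => dfx.
have gE : g \o shift x = cst (g x) + 'd f x +o_ 0 id.
  apply/eqaddoP => _/posnumP[e].
  have fo : f \o shift x = cst (f x) + 'd f x +o_ 0 id by apply: diff_locally.
  move/eqaddoP: fo => /(_ e%:num ltac:(done)) fo.
  have fx : f x = g x by exact: nbhs_singleton fg.
  have fg0 : \forall h \near (0:V), f (h + x) = g (h + x).
    by move: fg; rewrite (near_shift 0 x) subr0.
  apply: filterS2 fo fg0 => h + E.
  by rewrite /= !fctE /= /cst /= /shift /= fx E.
have E := @diff_unique _ _ _ g ('d f x) x dfc gE.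
by apply/diff_locallyP; rewrite E; split; [exact: dfc|exact: gE].
Qed.

Lemma diff_deriveD (W : normedModType R) (f : V -> W) x (u v : V) : differentiable f x ->
  'D_(u + v) f x = 'D_u f x + 'D_v f x.
Proof. by move=> df; rewrite !deriveE// linearD. Qed.

Lemma diff_deriveZ (W : normedModType R) (f : V -> W) x (a : R) (v : V) : differentiable f x ->
  'D_(a *: v) f x = a *: 'D_v f x.
Proof. by move=> df; rewrite !deriveE// linearZ. Qed.

Lemma diff_derive_sum (W : normedModType R) (f : V -> W) x (I : finType) (a : I -> R) (v : I -> V) :
  differentiable f x ->
  'D_(\sum_i a i *: v i) f x = \sum_i a i *: 'D_(v i) f x.
Proof.
move=> df; rewrite deriveE// linear_sum; apply: eq_bigr => i _.
by rewrite linearZ deriveE.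
Qed.

Lemma derive_comp (V' W : normedModType R) (f : V' -> W) (g : V -> V') x v :
  differentiable g x -> differentiable f (g x) ->
  'D_v (f \o g) x = 'D_('D_v g x) f (g x).
Proof.
move=> dg df; rewrite !deriveE//; last exact: differentiable_comp.
by rewrite diff_comp.
Qed.

Lemma differentiable_mxP m n (f : V -> 'M[R]_(m, n)) x :
  differentiable f x <-> forall i j, differentiable (fun y => f y i j) x.
Proof.
split=> [df i j|df].
  apply: (@differentiable_comp _ _ _ _ f (fun N : 'M[R]_(m, n) => N i j : R)) => //.
  exact: differentiable_coord.
have -> : f = (fun y => \sum_(ij : 'I_m * 'I_n) f y ij.1 ij.2 *: delta_mx ij.1 ij.2).
  apply/funext => y; rewrite [LHS]matrix_sum_delta pair_bigA /=.
  by apply: eq_bigr.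
rewrite (_ : (fun _ => _) = \sum_(ij : 'I_m * 'I_n)
  (fun y => f y ij.1 ij.2 *: (delta_mx ij.1 ij.2 : 'M[R]_(m, n)))); last first.
  by apply/funext => y; rewrite fct_sumE.
apply: (big_ind (fun F : V -> 'M[R]_(m, n) => differentiable F x)).
- exact: (@differentiable_cst _ _ _ 0 x).
- by move=> F G dF dG; apply: differentiableD.
- by move=> [i j] _ /=; exact: (differentiableZl (delta_mx i j : 'M[R]_(m, n)) (df i j)).
Qed.

Lemma derive_entry m n (f : V -> 'M[R]_(m, n)) x v i j : differentiable f x ->
  'D_v (fun y => f y i j) x = ('D_v f x) i j.
Proof.
by move=> df; rewrite (derive_mx (diff_derivable df)) mxE.
Qed.

End DerivativeRules.

(** * Maps of class C^k *)

Section ContDiff.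
Context {R : realType} {V W : normedModType R}.
Implicit Types (U : set V) (f g : V -> W).

Lemma contDiff_subset k f U U' : U' `<=` U -> contDiff k f U -> contDiff k f U'.
Proof.
elim: k f => [|k IH] f sU /= H; first by move=> x /sU; exact: H.
by split=> [x /sU|v]; [exact: H.1|exact: IH (H.2 v)].
Qed.

(** The condition bears on the points of U one at a time; only the closure
    properties below, which differentiate identities, need U to be open. *)
Lemma contDiff_pointwise k f U :
  (forall x, U x -> contDiff k f [set x]) -> contDiff k f U.
Proof.
elim: k f => [|k IH] f /= H; first by move=> x Ux; exact: H Ux _ erefl.
split=> [x Ux|v]; first exact: (H x Ux).1.
by apply: IH => x Ux; exact: (H x Ux).2.
Qed.

Lemma contDiff_ext k f g U : open U -> (forall x, U x -> f x = g x) ->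
  contDiff k f U -> contDiff k g U.
Proof.
move=> oU; have nU x : U x -> \forall y \near x, U y.
  by move=> Ux; apply: open_nbhs_nbhs.
elim: k f g => [|k IH] f g fg /= H.
  move=> x Ux; have fx := H x Ux.
  rewrite /prop_for /continuous_at -(fg x Ux).
  apply: cvg_trans fx; apply: near_eq_cvg.
  by apply: filterS (nU x Ux) => y Uy; rewrite fg.
have nfg x : U x -> \forall y \near x, f y = g y.
  by move=> Ux; apply: filterS (nU x Ux) => y Uy; rewrite fg.
split=> [x Ux|v]; first exact: near_differentiable (nfg x Ux) (H.1 x Ux).
apply: IH (H.2 v) => x Ux; apply: near_eq_derive; exact: nfg.
Qed.

Lemma contDiff_cst k (w : W) U : contDiff k (fun=> w) U.
Proof.
elim: k w => [|k IH] w /=; first by move=> x _; exact: cvg_cst.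
split=> [x _|v]; first exact: differentiable_cst.
have -> : (fun x : V => 'D_v (fun=> w) x) = (fun=> 0).
  by apply/funext => x; rewrite (derive_cst w).
exact: IH.
Qed.

Lemma contDiff_weaken k f U : contDiff k.+1 f U -> contDiff k f U.
Proof.
elim: k f => [|k IH] f [Hd Hv]; first by move=> x /Hd /differentiable_continuous.
by split=> // v; apply: IH; exact: Hv.
Qed.

Lemma contDiffD k f g U : open U ->
  contDiff k f U -> contDiff k g U -> contDiff k (fun x => f x + g x) U.
Proof.
move=> oU; elim: k f g => [|k IH] f g /= Hf Hg.
  by move=> x Ux; apply: cvgD; [exact: Hf|exact: Hg].
split=> [x Ux|v]; first by apply: differentiableD; [exact: Hf.1|exact: Hg.1].
apply: contDiff_ext (IH _ _ (Hf.2 v) (Hg.2 v)) => // x Ux.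
by rewrite deriveD //; apply: diff_derivable; [exact: Hf.1|exact: Hg.1].
Qed.

Lemma contDiffZ k (a : R) f U : open U ->
  contDiff k f U -> contDiff k (fun x => a *: f x) U.
Proof.
move=> oU; elim: k f => [|k IH] f /= Hf.
  by move=> x Ux; exact: cvgZl_tmp (Hf x Ux).
split=> [x Ux|v]; first by apply: differentiableZ; exact: Hf.1.
apply: contDiff_ext (IH _ (Hf.2 v)) => // x Ux.
by rewrite deriveZ //; apply: diff_derivable; exact: Hf.1.
Qed.

Lemma contDiff_sum k (I : Type) (r : seq I) (P : pred I) (F : I -> V -> W) U : open U ->
  (forall i, P i -> contDiff k (F i) U) ->
  contDiff k (fun x => \sum_(i <- r | P i) F i x) U.
Proof.
move=> oU H; elim: r => [|i r IH].
  by under eq_fun do rewrite big_nil; exact: contDiff_cst.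
under eq_fun do rewrite big_cons.
case Pi : (P i) => //; apply: contDiffD => //; exact: H.
Qed.

End ContDiff.

Section ContDiffReal.
Context {R : realType} {V : normedModType R}.
Implicit Types (U : set V) (f g : V -> R).

Lemma contDiffM k f g U : open U ->
  contDiff k f U -> contDiff k g U -> contDiff k (fun x => f x * g x) U.
Proof.
move=> oU; elim: k f g => [|k IH] f g.
  by move=> Hf Hg x Ux; apply: cvgM; [exact: Hf|exact: Hg].
move=> Hf Hg; have fk := contDiff_weaken Hf; have gk := contDiff_weaken Hg.
case: Hf Hg => fd fv [gd gv].
split=> [x Ux|v]; first by apply: differentiableM; [exact: fd|exact: gd].
apply: contDiff_ext (contDiffD oU (IH _ _ fk (gv v)) (IH _ _ gk (fv v))) => // x Ux.
by rewrite (deriveM (f := f) (g := g))//; apply: diff_derivable; [exact: fd|exact: gd].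
Qed.

Lemma contDiff_mxP k m n (f : V -> 'M[R]_(m, n)) U : open U ->
  contDiff k f U <-> forall i j, contDiff k (fun y => f y i j) U.
Proof.
move=> oU; elim: k f => [|k IH] f; split.
- move=> H i j x Ux; have := H x Ux.
  move=> h; apply: (continuous_comp (g := fun N : 'M[R]_(m, n) => N i j) h).
  exact: coord_continuous.
- move=> H x Ux; apply/cvgrPdist_le => /= e e0; near=> y.
  rewrite /Num.Def.normr/= mx_normrE (bigmax_le _ (ltW e0))//= => i _.
  rewrite !mxE/=; move: i; near: y; apply: filter_forall => -[i j] /=.
  exact: ((cvgrPdist_le _ _).1 (H i j x Ux)).
- move=> [Hd Hv] i j; split=> [x Ux|v]; first exact: (differentiable_mxP _ _).1 (Hd x Ux) i j.
  apply: contDiff_ext (((IH _).1 (Hv v)) i j) => // x Ux.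
  by rewrite derive_entry//; exact: Hd.
- move=> H; have Hd x : U x -> differentiable f x.
    by move=> Ux; apply/differentiable_mxP => i j; exact: (H i j).1.
  split=> // v; apply/IH => i j; apply: contDiff_ext ((H i j).2 v) => // x Ux.
  by rewrite derive_entry//; exact: Hd.
Unshelve. all: by end_near. Qed.

End ContDiffReal.

Section ContDiffComp.
Context {R : realType} {V : normedModType R}.
Implicit Types (U : set V).

Lemma differentiable_combination (V' : normedModType R) (I : finType)
    (e : I -> V') (c : I -> V -> R) x : (forall i, differentiable (c i) x) ->
  differentiable (fun y => \sum_i c i y *: e i) x.
Proof.
move=> dc; rewrite (_ : (fun _ => _) = \sum_i (fun y => c i y *: e i)); last first.
  by apply/funext => y; rewrite fct_sumE.
apply: (big_ind (fun F : V -> V' => differentiable F x)).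
- exact: (@differentiable_cst _ _ _ 0 x).
- by move=> F G dF dG; apply: differentiableD.
- by move=> i _; exact: differentiableZl.
Qed.

Lemma derive_combination (V' : normedModType R) (I : finType)
    (e : I -> V') (c : I -> V -> R) x v : (forall i, differentiable (c i) x) ->
  'D_v (fun y => \sum_i c i y *: e i) x = \sum_i 'D_v (c i) x *: e i.
Proof.
move=> dc; have H (r : seq I) :
    differentiable (fun y => \sum_(i <- r) c i y *: e i) x /\
    'D_v (fun y => \sum_(i <- r) c i y *: e i) x = \sum_(i <- r) 'D_v (c i) x *: e i.
  elim: r => [|i r [IHd IH]].
    under [X in differentiable X _]eq_fun do rewrite big_nil.
    under [X in derive X _ _]eq_fun do rewrite big_nil.
    by rewrite big_nil (derive_cst (0 : V')); split=> //; exact: differentiable_cst.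
  under [X in differentiable X _]eq_fun do rewrite big_cons.
  under [X in derive X _ _]eq_fun do rewrite big_cons.
  have di : differentiable (fun y => c i y *: e i) x by exact: differentiableZl.
  split; first exact: (differentiableD di IHd).
  rewrite big_cons -IH (@deriveD _ _ _ (fun y => c i y *: e i)
    (fun y => \sum_(j <- r) c j y *: e j)); [|exact: diff_derivable..].
  by congr (_ + _); rewrite !deriveE// diffZl.
exact: (H _).2.
Qed.

(** The derivative of f along a direction that moves with the point is not one of
    the derivatives on which the induction hypothesis bears. Writing the inner map
    in a fixed finite family of vectors expresses the derivative of the composite
    through derivatives of f along fixed directions. *)
Lemma contDiff_comp k (V' : normedModType R) (I : finType) (e : I -> V')
    (c : I -> V -> R) (f : V' -> R) U (U' : set V') : open U ->
  (forall x, U x -> U' (\sum_i c i x *: e i)) ->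
  (forall i, contDiff k (c i) U) -> contDiff k f U' ->
  contDiff k (fun x => f (\sum_i c i x *: e i)) U.
Proof.
move=> oU UU'; elim: k f c UU' => [|k IH] f c UU'.
  move=> Hc Hf x Ux.
  apply: (@continuous_comp _ _ _ (fun x => \sum_i c i x *: e i) f); last exact: Hf (UU' _ Ux).
  apply: (@contDiff_sum _ _ _ 0 _ _ _ (fun i x => c i x *: e i) _ oU _ x Ux).
  by move=> i _ y Uy; apply: cvgZr_tmp; exact: Hc.
move=> Hc Hf.
have fk := contDiff_weaken Hf; have ck i := contDiff_weaken (Hc i).
have dc i x : U x -> differentiable (c i) x by move=> Ux; exact: (Hc i).1.
have df x : U x -> differentiable f (\sum_i c i x *: e i).
  by move=> Ux; apply: Hf.1; exact: UU'.
have dcomb x : U x -> differentiable (fun y => \sum_i c i y *: e i) x.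
  by move=> Ux; apply: differentiable_combination => i; exact: dc.
split=> [x Ux|v].
  exact: (@differentiable_comp _ _ _ _ (fun y => \sum_i c i y *: e i) f x (dcomb x Ux) (df x Ux)).
apply: (@contDiff_ext _ _ _ k (fun x => \sum_i 'D_v (c i) x *
    'D_(e i) f (\sum_j c j x *: e j))) => //.
  move=> x Ux.
  rewrite [RHS](derive_comp v (dcomb x Ux) (df x Ux)).
  rewrite derive_combination; last by move=> i; exact: dc.
  by rewrite diff_derive_sum//; exact: df.
apply: contDiff_sum => // i _; apply: contDiffM => //; first exact: (Hc i).2.
by apply: (IH (fun y => 'D_(e i) f y) c) => //; exact: Hf.2.
Qed.

Lemma contDiffV k (f : V -> R) U : open U -> (forall x, U x -> f x != 0) ->
  contDiff k f U -> contDiff k (fun x => (f x)^-1) U.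
Proof.
move=> oU f0; elim: k => [|k IH] Hf.
  by move=> x Ux; apply: cvgV; [exact: f0|exact: Hf].
have {}IH := IH (contDiff_weaken Hf).
have df x : U x -> differentiable f x by move=> Ux; exact: Hf.1.
split=> [x Ux|v]; first by apply: differentiableV; [exact: df|exact: f0].
apply: (@contDiff_ext _ _ _ k (fun x => -1 *: (((f x)^-1 * (f x)^-1) * 'D_v f x))) => //.
  move=> x Ux; rewrite deriveV ?f0//; last by apply: diff_derivable; exact: df.
  by rewrite expr2 invfM scaleN1r scaleNr.
by apply: contDiffZ => //; apply: contDiffM => //; [exact: contDiffM|exact: Hf.2].
Qed.

Lemma differentiable_sqrt (f : V -> R) x : 0 < f x -> differentiable f x ->
  differentiable (fun y => Num.sqrt (f y)) x.
Proof.
move=> f0 df; apply: (@differentiable_comp _ _ _ _ f Num.sqrt) => //.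
by apply/derivable1_diffP; have [] := is_derive1_sqrt f0.
Qed.

Lemma derive_comp_real (f : V -> R) (h : R -> R) x v : differentiable f x ->
  differentiable h (f x) -> 'D_v (fun y => h (f y)) x = 'D_v f x * 'D_1 h (f x).
Proof.
move=> df dh; rewrite [LHS](@derive_comp _ _ _ _ h f)//.
by rewrite -{1}['D_v f x]mulr1 -[_ * _]/(_ *: _) diff_deriveZ.
Qed.

Lemma contDiff_sqrt k (f : V -> R) U : open U -> (forall x, U x -> 0 < f x) ->
  contDiff k f U -> contDiff k (fun x => Num.sqrt (f x)) U.
Proof.
move=> oU f0; elim: k => [|k IH] Hf.
  move=> x Ux; apply: (@continuous_comp _ _ _ f Num.sqrt); first exact: Hf.
  exact: sqrt_continuous.
have {}IH := IH (contDiff_weaken Hf).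
have df x : U x -> differentiable f x by move=> Ux; exact: Hf.1.
split=> [x Ux|v]; first by apply: differentiable_sqrt; [exact: f0|exact: df].
apply: (@contDiff_ext _ _ _ k (fun x => 'D_v f x * (2 *: Num.sqrt (f x))^-1)) => //.
  move=> x Ux; have [dds vs] := is_derive1_sqrt (f0 x Ux).
  by rewrite derive_comp_real; [rewrite vs|exact: df|exact/derivable1_diffP].
apply: contDiffM => //; first exact: Hf.2.
apply: contDiffV => //; last exact: contDiffZ.
by move=> x Ux; rewrite mulf_neq0// gt_eqF// sqrtr_gt0 f0.
Qed.

End ContDiffComp.

(** * Symmetry of second derivatives *)

Section Lines.
Context {R : realType} {V W : normedModType R}.

Lemma growth_line (f : V -> W) x u (s : R) :
  (fun h : R => h^-1 *: (((fun r : R => f (r *: u + x)) \o shift s) (h *: 1) - f (s *: u + x))) =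
  (fun h : R => h^-1 *: ((f \o shift (s *: u + x)) (h *: u) - f (s *: u + x))).
Proof.
apply/funext => h /=; congr (_ *: (f _ - _)).
by rewrite /shift /= [h%:A](mulr1) scalerDl addrA.
Qed.

Lemma derive_line (f : V -> W) x u (s : R) :
  'D_1 (fun r : R => f (r *: u + x)) s = 'D_u f (s *: u + x).
Proof. by rewrite /derive growth_line. Qed.

Lemma derivable_line (f : V -> W) x u (s : R) : differentiable f (s *: u + x) ->
  derivable (fun r : R => f (r *: u + x)) s 1.
Proof. by move=> df; rewrite /derivable growth_line; exact: diff_derivable. Qed.

Lemma is_derive_line (f : V -> W) x u (s : R) : differentiable f (s *: u + x) ->
  is_derive s 1 (fun r : R => f (r *: u + x)) ('D_u f (s *: u + x)).
Proof.
by move=> df; rewrite -derive_line; apply: DeriveDef => //; exact: derivable_line.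
Qed.

End Lines.

Section Schwarz.
Context {R : realType} {V : normedModType R}.

Lemma MVT_open_closed (f df : R -> R) (h : R) : 0 < h ->
  (forall s, 0 <= s <= h -> is_derive s 1 f (df s)) ->
  exists2 c, 0 <= c <= h & f h - f 0 = df c * h.
Proof.
move=> h0 H; have [|c /=|c ch E] := @MVT_segment R f df 0 h (ltW h0).
- by move=> s; rewrite in_itv/= => /andP[/ltW s0 /ltW sh]; apply: H; rewrite s0.
- apply: derivable_within_continuous => s; rewrite in_itv/= => sh.
  by have [] := H s sh.
- by exists c; [move: ch; rewrite in_itv|rewrite E subr0].
Qed.

Let subr_swap (a b c d : R) : a - b - (c - d) = a - c - (b - d).
Proof. by ring. Qed.

Let dist_common (a b p : R) : `|a - b| <= `|a - p| + `|b - p|.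
Proof. by rewrite [`|b - p|]distrC ler_distD. Qed.

(** The mean value theorem, applied twice, expresses the second difference of f
   through the mixed derivative taken in one order. *)
Lemma second_difference (f : V -> R) x u v (h : R) : 0 < h ->
  (forall c d, 0 <= c <= h -> 0 <= d <= h ->
     differentiable f (c *: u + (d *: v + x)) /\
     differentiable (fun y => 'D_u f y) (c *: u + (d *: v + x))) ->
  exists c d, [/\ 0 <= c <= h, 0 <= d <= h &
    f (h *: u + (h *: v + x)) - f (h *: u + x) - (f (h *: v + x) - f x)
    = 'D_v (fun y => 'D_u f y) (c *: u + (d *: v + x)) * h * h].
Proof.
move=> h0 df; have h1 : 0 <= h <= h by rewrite ltW ?lexx.
have h2 : (0 : R) <= 0 <= h by apply/andP; split => //; exact: ltW.
pose p (s : R) := f (s *: u + (h *: v + x)) - f (s *: u + x).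
have [|c ch E] := @MVT_open_closed p
  (fun s => 'D_u f (s *: u + (h *: v + x)) - 'D_u f (s *: u + x)) _ h0.
  move=> s sh; apply: is_deriveB; apply: is_derive_line.
    exact: (df _ _ sh h1).1.
  by have := (df _ _ sh h2).1; rewrite scale0r add0r.
have [|d dh E'] := @MVT_open_closed (fun s => 'D_u f (s *: v + (c *: u + x)))
  (fun s => 'D_v (fun y => 'D_u f y) (s *: v + (c *: u + x))) _ h0.
  move=> s sh; apply: (@is_derive_line _ _ _ (fun y => 'D_u f y)).
  by rewrite addrCA; exact: (df _ _ ch sh).2.
exists c, d; split => //.
move: E; rewrite /p scale0r !add0r => ->.
by congr (_ * _); rewrite [RHS]mulrC; move: E'; rewrite scale0r add0r !(addrCA _ (c *: u)) mulrC.
Qed.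

(** The second difference along u and v is, for small steps, close to both mixed
    derivatives, each of which is continuous. *)
Lemma derive_schwarz_real (f : V -> R) x u v (U : set V) : open U -> U x ->
  contDiff 2 f U -> 'D_u (fun y => 'D_v f y) x = 'D_v (fun y => 'D_u f y) x.
Proof.
move=> oU Ux [fd fv]; apply/eqP; rewrite -subr_eq0 -normr_le0 leNgt; apply/negP => e0.
set A := fun y => 'D_u (fun y => 'D_v f y) y; set B := fun y => 'D_v (fun y => 'D_u f y) y.
set e := `|_| in e0.
have cA : {for x, continuous A} by exact: ((fv v).2 u).
have cB : {for x, continuous B} by exact: ((fv u).2 v).
have e20 : 0 < e / 2 by rewrite divr_gt0.
have nA : \forall y \near x, `|A x - A y| < e / 2 by exact: (cvgrPdist_lt _ _).1 cA _ e20.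
have nB : \forall y \near x, `|B x - B y| < e / 2 by exact: (cvgrPdist_lt _ _).1 cB _ e20.
have nU : \forall y \near x, U y by exact: open_nbhs_nbhs.
have /nbhs_ballP[r /= r0 br] : \forall y \near x,
    [/\ U y, `|A x - A y| < e / 2 & `|B x - B y| < e / 2].
  apply: filter_app nA; apply: filter_app nB; apply: filterS nU => y Uy Ay By.
  by split.
pose h := r / (2 * (1 + `|u| + `|v|)).
have K0 : 0 < 1 + `|u| + `|v| by rewrite -addrA ltr_pwDl// addr_ge0.
have h0 : 0 < h by rewrite divr_gt0// mulr_gt0.
have inb c d : 0 <= c <= h -> 0 <= d <= h ->
    [/\ U (c *: u + (d *: v + x)), `|A x - A (c *: u + (d *: v + x))| < e / 2 &
        `|B x - B (c *: u + (d *: v + x))| < e / 2].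
  move=> /andP[c0 ch] /andP[d0 dh]; apply: br; rewrite -ball_normE /= addrA opprD addrCA subrr addr0.
  rewrite normrN (le_lt_trans (ler_normD _ _))// !normrZ !ger0_norm//.
  apply: (@le_lt_trans _ _ (h * (1 + `|u| + `|v|))).
    apply: (@le_trans _ _ (h * `|u| + h * `|v|)).
      by rewrite lerD// ler_wpM2r.
    by rewrite -mulrDr ler_pM2l// -addrA lerDr.
  rewrite /h invfM mulrA mulfVK ?gt_eqF// ltr_pdivrMr// mulrDr mulr1 ltrDl//.
have [|c [d [ch dh E1]]] := @second_difference f x u v h h0.
  move=> c d ch dh; have [Uy _ _] := inb _ _ ch dh.
  by split; [exact: fd|exact: (fv u).1].
have [|c' [d' [ch' dh' E2]]] := @second_difference f x v u h h0.
  move=> c1 d1 ch1 dh1; have [Uy _ _] := inb _ _ dh1 ch1; rewrite addrCA.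
  by split; [exact: fd|exact: (fv v).1].
have E : B (c *: u + (d *: v + x)) = A (d' *: u + (c' *: v + x)).
  have sw : d' *: u + (c' *: v + x) = c' *: v + (d' *: u + x) by rewrite addrCA.
  have hsw : h *: u + (h *: v + x) = h *: v + (h *: u + x) by rewrite addrCA.
  apply: (@mulIf _ h); first by rewrite gt_eqF.
  apply: (@mulIf _ h); first by rewrite gt_eqF.
  rewrite sw -[LHS]E1 -[RHS]E2 hsw.
  exact: subr_swap.
have [_ _ H1] := inb _ _ ch dh; have [_ H2 _] := inb _ _ dh' ch'.
rewrite E in H1; have H3 := ltrD H2 H1; rewrite -splitr in H3.
by have := le_lt_trans (dist_common (A x) (B x) _) H3; rewrite ltxx.
Qed.

End Schwarz.

(** * Smooth germs *)

(** Smoothness around a point: geometric identities hold only near the point at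
    which they are differentiated, and the open set is never of interest. *)
Definition smooth_near (R : realType) (V W : normedModType R) (f : V -> W) (x : V) :=
  exists2 U : set V, open U /\ U x & smooth_on U f.

Section SmoothNear.
Context {R : realType} {V W : normedModType R}.
Implicit Types (f g : V -> W) (x : V).

Lemma smooth_on_near U f x : open U -> U x -> smooth_on U f -> smooth_near f x.
Proof. by move=> oU Ux fU; exists U. Qed.

Lemma smooth_near_on U f : (forall x, U x -> smooth_near f x) -> smooth_on U f.
Proof.
move=> H k; apply: contDiff_pointwise => x /H[U' [_ U'x] f'].
by apply: contDiff_subset (f' k) => _ ->.
Qed.

Lemma smooth_near_ext f g x : (\forall y \near x, f y = g y) ->
  smooth_near f x -> smooth_near g x.
Proof.
move=> fg [U [oU Ux] fU]; exists (U `&` [set y | f y = g y]^°).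
  by split; [apply: openI => //; exact: open_interior|split].
move=> k; apply: (@contDiff_ext _ _ _ _ f).
- by apply: openI => //; exact: open_interior.
- by move=> y [_ /nbhs_singleton].
- by apply: contDiff_subset (fU k) => y [].
Qed.

Lemma smooth_near_nbhs f x : smooth_near f x -> \forall y \near x, smooth_near f y.
Proof.
move=> [U [oU Ux] fU]; have : \forall y \near x, U y by exact: open_nbhs_nbhs.
by apply: filterS => y Uy; exists U.
Qed.

Lemma smooth_near_diff f x : smooth_near f x -> differentiable f x.
Proof. by move=> [U [_ Ux] fU]; exact: (fU 1%N).1. Qed.

Lemma smooth_near_continuous f x : smooth_near f x -> {for x, continuous f}.
Proof. by move=> /smooth_near_diff; exact: differentiable_continuous. Qed.

Lemma smooth_near_derive f x v : smooth_near f x -> smooth_near (fun y => 'D_v f y) x.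
Proof. by move=> [U ? fU]; exists U => // k; exact: (fU k.+1).2. Qed.

Lemma smooth_near_cst (w : W) x : smooth_near (fun=> w) x.
Proof.
by exists setT; [split=> //; exact: openT|move=> k; exact: contDiff_cst].
Qed.

Lemma smooth_nearD f g x : smooth_near f x -> smooth_near g x ->
  smooth_near (fun y => f y + g y) x.
Proof.
move=> [U [oU Ux] fU] [U' [oU' Ux'] gU]; exists (U `&` U').
  by split=> //; exact: openI.
move=> k; apply: contDiffD; first exact: openI.
  by apply: contDiff_subset (fU k) => ? [].
by apply: contDiff_subset (gU k) => ? [].
Qed.

Lemma smooth_nearZ a f x : smooth_near f x -> smooth_near (fun y => a *: f y) x.
Proof.
by move=> [U [oU Ux] fU]; exists U => // k; apply: contDiffZ.
Qed.

Lemma smooth_nearN f x : smooth_near f x -> smooth_near (fun y => - f y) x.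
Proof.
move=> /(smooth_nearZ (-1)); apply: smooth_near_ext.
by apply: nearW => y; rewrite scaleN1r.
Qed.

Lemma smooth_nearB f g x : smooth_near f x -> smooth_near g x ->
  smooth_near (fun y => f y - g y) x.
Proof. by move=> fx gx; apply: smooth_nearD => //; exact: smooth_nearN. Qed.

Lemma smooth_near_sum (I : Type) (r : seq I) (P : pred I) (F : I -> V -> W) x :
  (forall i, P i -> smooth_near (F i) x) ->
  smooth_near (fun y => \sum_(i <- r | P i) F i y) x.
Proof.
move=> H; elim: r => [|i r IH].
  by under eq_fun do rewrite big_nil; exact: smooth_near_cst.
under eq_fun do rewrite big_cons.
by case Pi : (P i) => //; apply: smooth_nearD => //; exact: H.
Qed.

(** Only finitely many of the open sets are intersected. *)
Lemma smooth_near_uniform (I : finType) (F : I -> V -> W) x :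
  (forall i, smooth_near (F i) x) ->
  exists2 U : set V, open U /\ U x & forall i, smooth_on U (F i).
Proof.
move=> H; suff [U [oU Ux] HU] : exists2 U : set V, open U /\ U x &
    forall i, i \in enum I -> smooth_on U (F i).
  by exists U => // i; apply: HU; rewrite mem_enum.
elim: (enum I) => [|i r [U [oU Ux] HU]].
  by exists setT => //; split=> //; exact: openT.
have [U' [oU' Ux'] HU'] := H i.
exists (U `&` U'); first by split=> //; exact: openI.
move=> j; rewrite inE => /orP[/eqP ->|jr] k.
  by apply: contDiff_subset (HU' k) => ? [].
by apply: contDiff_subset (HU j jr k) => ? [].
Qed.

End SmoothNear.

Section SmoothNearReal.
Context {R : realType} {V : normedModType R}.
Implicit Types (f g : V -> R) (x : V).

Lemma smooth_nearM f g x : smooth_near f x -> smooth_near g x ->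
  smooth_near (fun y => f y * g y) x.
Proof.
move=> [U [oU Ux] fU] [U' [oU' Ux'] gU]; exists (U `&` U').
  by split=> //; exact: openI.
move=> k; apply: contDiffM; first exact: openI.
  by apply: contDiff_subset (fU k) => ? [].
by apply: contDiff_subset (gU k) => ? [].
Qed.

Lemma smooth_near_prod (I : Type) (r : seq I) (P : pred I) (F : I -> V -> R) x :
  (forall i, P i -> smooth_near (F i) x) ->
  smooth_near (fun y => \prod_(i <- r | P i) F i y) x.
Proof.
move=> H; elim: r => [|i r IH].
  by under eq_fun do rewrite big_nil; exact: smooth_near_cst.
under eq_fun do rewrite big_cons.
by case Pi : (P i) => //; apply: smooth_nearM => //; exact: H.
Qed.

Lemma smooth_near_restrict (W : normedModType R) (f : V -> W) x (P : set V) :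
  smooth_near f x -> (\forall y \near x, P y) ->
  exists U, [/\ open U, U x, U `<=` P & smooth_on U f].
Proof.
move=> [U [oU Ux] fU] nP; exists (U `&` P^°); split=> //.
- by apply: openI => //; exact: open_interior.
- by move=> y [_ /nbhs_singleton].
- by move=> k; apply: contDiff_subset (fU k) => ? [].
Qed.

Lemma continuous_near_neq0 f x : {for x, continuous f} -> f x != 0 ->
  \forall y \near x, f y != 0.
Proof.
move=> cf f0; have o : open [set r : R | r != 0].
  rewrite (_ : [set r : R | r != 0] = ~` [set 0]); last first.
    by apply/seteqP; split=> r /= /eqP.
  by rewrite openC; exact: closed_eq.
by apply: (cf [set r | r != 0]); apply: open_nbhs_nbhs; split.
Qed.

Lemma smooth_nearV f x : smooth_near f x -> f x != 0 ->
  smooth_near (fun y => (f y)^-1) x.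
Proof.
move=> fx f0; have nf0 : \forall y \near x, f y != 0.
  exact: continuous_near_neq0 (smooth_near_continuous fx) f0.
have [U [oU Ux UP fU]] := smooth_near_restrict fx nf0.
by exists U => // k; apply: contDiffV.
Qed.

Lemma smooth_near_sqrt f x : smooth_near f x -> 0 < f x ->
  smooth_near (fun y => Num.sqrt (f y)) x.
Proof.
move=> fx f0; have nf0 : \forall y \near x, 0 < f y.
  have cf := smooth_near_continuous fx.
  by apply: (cf [set r | 0 < r]); exact: lt_nbhsr.
have [U [oU Ux UP fU]] := smooth_near_restrict fx nf0.
by exists U => // k; apply: contDiff_sqrt.
Qed.

Lemma smooth_near_mxP m n (f : V -> 'M[R]_(m, n)) x :
  smooth_near f x <-> forall i j, smooth_near (fun y => f y i j) x.
Proof.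
split=> [[U [oU Ux] fU] i j|H].
  by exists U => // k; apply: ((contDiff_mxP _ _ oU).1 (fU k)).
have [|U [oU Ux] HU] := @smooth_near_uniform _ _ _ _ (fun (ij : 'I_m * 'I_n) y => f y ij.1 ij.2) x.
  by move=> ij; exact: H.
by exists U => // k; apply/contDiff_mxP => // i j; exact: (HU (i, j) k).
Qed.

End SmoothNearReal.

Section SmoothNearComp.
Context {R : realType} {V : normedModType R}.
Implicit Types (f g : V -> R) (x : V).

(** The inner map may take values in R, in R^n or in a product of both, which a
    finite family of vectors describes uniformly. *)
Lemma smooth_near_comp_family (V' : normedModType R) (I : finType) (e : I -> V')
    (c : I -> V -> R) m n (f : V' -> 'M[R]_(m, n)) x :
  (forall i, smooth_near (c i) x) -> smooth_near f (\sum_i c i x *: e i) ->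
  smooth_near (fun y => f (\sum_i c i y *: e i)) x.
Proof.
move=> Hc Hf; apply/smooth_near_mxP => a b.
have [U [oU Ux] HU] := smooth_near_uniform Hc.
have [U' [oU' Ux'] HU'] := (smooth_near_mxP _ _).1 Hf a b.
have cont : {for x, continuous (fun y => \sum_i c i y *: e i)}.
  apply: differentiable_continuous; apply: differentiable_combination => i.
  exact: smooth_near_diff.
have n1 : \forall y \near x, U' (\sum_i c i y *: e i).
  by apply: (cont U'); exact: open_nbhs_nbhs.
pose U1 := U `&` [set y | U' (\sum_i c i y *: e i)]^°.
have oU1 : open U1 by apply: openI => //; exact: open_interior.
exists U1; first by split=> //; split.
move=> k; apply: (@contDiff_comp _ _ k V' I e c (fun z => f z a b) U1 U') => //.
  by move=> y [_ /nbhs_singleton].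
by move=> i; apply: contDiff_subset (HU i k) => y [].
Qed.

Lemma smooth_near_comp p m n (g : V -> 'rV[R]_p) (f : 'rV[R]_p -> 'M[R]_(m, n)) x :
  smooth_near g x -> smooth_near f (g x) -> smooth_near (fun y => f (g y)) x.
Proof.
move=> Hg Hf.
have E y : g y = \sum_i g y 0 i *: delta_mx 0 i by rewrite [LHS]row_sum_delta.
under eq_fun do rewrite E.
apply: (smooth_near_comp_family (c := fun i y => g y 0 i)); last by rewrite -E.
by move=> i; exact: (smooth_near_mxP _ _).1 Hg 0 i.
Qed.

Lemma smooth_near_comp_time m n (g : V -> R) (f : R -> 'M[R]_(m, n)) x :
  smooth_near g x -> smooth_near f (g x) -> smooth_near (fun y => f (g y)) x.
Proof.
move=> Hg Hf; have E y : g y = \sum_(i < 1) g y *: 1 by rewrite big_ord1 [RHS]mulr1.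
under eq_fun do rewrite E.
apply: (smooth_near_comp_family (c := fun i y => g y)); last by rewrite -E.
by [].
Qed.

Lemma smooth_near_schwarz m n (f : V -> 'M[R]_(m, n)) x u v : smooth_near f x ->
  'D_u (fun y => 'D_v f y) x = 'D_v (fun y => 'D_u f y) x.
Proof.
move=> Hf; apply/matrixP => i j.
have nE w : \forall y \near x, ('D_w f y) i j = 'D_w (fun z => f z i j) y.
  apply: filterS (smooth_near_nbhs Hf) => y Hy.
  by rewrite derive_entry//; exact: smooth_near_diff.
have D w w' : ('D_w (fun y => 'D_w' f y) x) i j = 'D_w (fun y => 'D_w' (fun z => f z i j) y) x.
  have d := smooth_near_diff (smooth_near_derive w' Hf).
  by rewrite -(derive_entry w i j d); exact: near_eq_derive (nE w').
rewrite [LHS]D [RHS]D.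
have [U [oU Ux] HU] := (smooth_near_mxP _ _).1 Hf i j.
exact: derive_schwarz_real oU Ux (HU 2%N).
Qed.

Lemma smooth_near_mulmx m n p (f : V -> 'M[R]_(m, n)) (g : V -> 'M[R]_(n, p)) x :
  smooth_near f x -> smooth_near g x -> smooth_near (fun y => f y *m g y) x.
Proof.
move=> /smooth_near_mxP Hf /smooth_near_mxP Hg; apply/smooth_near_mxP => i j.
under eq_fun do rewrite mxE.
by apply: smooth_near_sum => k _; exact: smooth_nearM.
Qed.

Lemma smooth_near_scale m n (a : V -> R) (f : V -> 'M[R]_(m, n)) x :
  smooth_near a x -> smooth_near f x -> smooth_near (fun y => a y *: f y) x.
Proof.
move=> Ha /smooth_near_mxP Hf; apply/smooth_near_mxP => i j.
by under eq_fun do rewrite mxE; exact: smooth_nearM.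
Qed.

Lemma smooth_near_tr m n (f : V -> 'M[R]_(m, n)) x :
  smooth_near f x -> smooth_near (fun y => (f y)^T) x.
Proof.
move=> /smooth_near_mxP Hf; apply/smooth_near_mxP => i j.
by under eq_fun do rewrite mxE; exact: Hf.
Qed.

Lemma smooth_near_bilin n (G : V -> 'M[R]_n) u v x :
  smooth_near G x -> smooth_near u x -> smooth_near v x ->
  smooth_near (fun y => bilin (G y) (u y) (v y)) x.
Proof.
move=> HG Hu Hv.
have : smooth_near (fun y => u y *m G y *m (v y)^T) x.
  by apply: smooth_near_mulmx; [exact: smooth_near_mulmx|exact: smooth_near_tr].
by move=> H; exact: ((smooth_near_mxP _ _).1 H 0 0).
Qed.

Lemma smooth_near_det n (G : V -> 'M[R]_n) x :
  smooth_near G x -> smooth_near (fun y => \det (G y)) x.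
Proof.
move=> /smooth_near_mxP HG; rewrite /determinant.
apply: smooth_near_sum => s _; apply: smooth_nearM; first exact: smooth_near_cst.
by apply: smooth_near_prod => i _.
Qed.

Lemma smooth_near_invmx n (G : V -> 'M[R]_n) x : G x \in unitmx ->
  smooth_near G x -> smooth_near (fun y => invmx (G y)) x.
Proof.
move=> Gu HG; have Hd := smooth_near_det HG.
have d0 : \det (G x) != 0 by rewrite -unitfE.
have nd : \forall y \near x, \det (G y) != 0.
  exact: continuous_near_neq0 (smooth_near_continuous Hd) d0.
apply: (@smooth_near_ext _ _ _ (fun y => (\det (G y))^-1 *: \adj (G y))).
  by apply: filterS nd => y dy; rewrite /invmx unitmxE unitfE dy.
apply: smooth_near_scale; first exact: smooth_nearV.
apply/smooth_near_mxP => i j; under eq_fun do rewrite mxE.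
apply: smooth_nearM; first exact: smooth_near_cst.
apply: smooth_near_det; apply/smooth_near_mxP => a b.
by under eq_fun do rewrite !mxE; move/smooth_near_mxP: HG; apply.
Qed.

End SmoothNearComp.

Section SmoothNearLinear.
Context {R : realType}.

Lemma smooth_near_coord m n (i : 'I_m) (j : 'I_n) (x : 'M[R]_(m, n)) :
  smooth_near (fun y : 'M[R]_(m, n) => y i j) x.
Proof.
exists setT; first by split=> //; exact: openT.
case=> [|k]; first by move=> y _; exact: coord_continuous.
split=> [y _|v]; first exact: differentiable_coord.
rewrite (_ : (fun y => _) = (fun=> v i j)); first exact: contDiff_cst.
apply/funext => y; rewrite (@derive_entry _ _ _ _ id)// derive_id //.
Qed.

Lemma smooth_near_idR (x : R) : smooth_near id x.
Proof.
exists setT; first by split=> //; exact: openT.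
case=> [|k]; first by move=> y _; exact: cvg_id.
split=> [y _|v]; first exact: ex_diff.
rewrite (_ : (fun y => _) = (fun=> v)); first exact: contDiff_cst.
by apply/funext => y; rewrite derive_id.
Qed.

End SmoothNearLinear.

(** * Bilinear forms and Christoffel symbols *)

Section Bilin.
Context {R : realType} {n : nat}.
Implicit Types (G : 'M[R]_n) (u v w : 'rV[R]_n).

Lemma bilinE G u v : bilin G u v = \sum_i \sum_j u 0 i * G i j * v 0 j.
Proof.
rewrite /bilin mxE exchange_big; apply: eq_bigr => j _ /=.
by rewrite !mxE mulr_suml.
Qed.

Lemma bilinDl G u v w : bilin G (u + v) w = bilin G u w + bilin G v w.
Proof. by rewrite /bilin !mulmxDl mxE. Qed.

Lemma bilinDr G u v w : bilin G u (v + w) = bilin G u v + bilin G u w.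
Proof. by rewrite /bilin linearD mulmxDr mxE. Qed.

Lemma bilinZl G a u v : bilin G (a *: u) v = a * bilin G u v.
Proof. by rewrite /bilin -!scalemxAl mxE. Qed.

Lemma bilinZr G a u v : bilin G u (a *: v) = a * bilin G u v.
Proof. by rewrite /bilin linearZ -scalemxAr mxE. Qed.

Lemma bilinNl G u v : bilin G (- u) v = - bilin G u v.
Proof. by rewrite -scaleN1r bilinZl mulN1r. Qed.

Lemma bilinNr G u v : bilin G u (- v) = - bilin G u v.
Proof. by rewrite -scaleN1r bilinZr mulN1r. Qed.

Lemma bilin0l G v : bilin G 0 v = 0.
Proof. by rewrite -(scale0r 0) bilinZl mul0r. Qed.

Lemma bilin0r G v : bilin G v 0 = 0.
Proof. by rewrite -(scale0r 0) bilinZr mul0r. Qed.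

Lemma bilin_suml G (I : finType) (u : I -> 'rV[R]_n) w :
  bilin G (\sum_i u i) w = \sum_i bilin G (u i) w.
Proof. by rewrite /bilin !mulmx_suml summxE. Qed.

Lemma bilin_sumr G (I : finType) (u : I -> 'rV[R]_n) w :
  bilin G w (\sum_i u i) = \sum_i bilin G w (u i).
Proof. by rewrite /bilin linear_sum mulmx_sumr summxE. Qed.

Lemma bilin_delta G i j : bilin G (delta_mx 0 i) (delta_mx 0 j) = G i j.
Proof. by rewrite /bilin trmx_delta -rowE -colE !mxE. Qed.

Lemma bilin_addm G G' u v : bilin (G + G') u v = bilin G u v + bilin G' u v.
Proof. by rewrite /bilin mulmxDr mulmxDl mxE. Qed.

Lemma bilin_summ (I : finType) (G : I -> 'M[R]_n) u v :
  bilin (\sum_i G i) u v = \sum_i bilin (G i) u v.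
Proof. by rewrite /bilin mulmx_sumr mulmx_suml summxE. Qed.

Lemma bilin_scalem a G u v : bilin (a *: G) u v = a * bilin G u v.
Proof. by rewrite /bilin -scalemxAr -scalemxAl mxE. Qed.

Lemma bilinC G u v : G^T = G -> bilin G u v = bilin G v u.
Proof.
move=> Gs; transitivity ((u *m G *m v^T)^T 0 0); first by rewrite mxE.
by rewrite !trmx_mul trmxK Gs mulmxA.
Qed.

Lemma bilin_pullback m (B : 'M[R]_(m, n)) G (u v : 'rV[R]_m) :
  bilin (B *m G *m B^T) u v = bilin G (u *m B) (v *m B).
Proof. by rewrite /bilin trmx_mul !mulmxA. Qed.

Lemma bilin_ext (G G' : 'M[R]_n) : (forall u v, bilin G u v = bilin G' u v) -> G = G'.
Proof.
by move=> H; apply/matrixP => i j; have := H (delta_mx 0 i) (delta_mx 0 j); rewrite !bilin_delta.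
Qed.

Lemma bilin_rowinv G (r : 'rV[R]_n) w : G \in unitmx ->
  bilin G (r *m invmx G) w = \sum_i r 0 i * w 0 i.
Proof.
by move=> Gu; rewrite /bilin mulmxKV// mxE; apply: eq_bigr => i _; rewrite mxE.
Qed.

Lemma bilin_nondeg G u : G \in unitmx -> (forall w, bilin G u w = 0) -> u = 0.
Proof.
move=> Gu H; rewrite -[u](mulmxK Gu); suff -> : u *m G = 0 by rewrite mul0mx.
apply/rowP => i; have := H (delta_mx 0 i).
by rewrite /bilin trmx_delta -colE !mxE.
Qed.

Lemma bilin_nondeg_eq G u v : G \in unitmx ->
  (forall w, bilin G u w = bilin G v w) -> u = v.
Proof.
move=> Gu H; apply/eqP; rewrite -subr_eq0; apply/eqP/(bilin_nondeg Gu) => w.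
by rewrite bilinDl bilinNl H subrr.
Qed.

End Bilin.

Section DeriveBilin.
Context {R : realType} {V : normedModType R} {n : nat}.

Lemma is_derive_bilin (G : V -> 'M[R]_n) (a b : V -> 'rV[R]_n) x v :
  differentiable G x -> differentiable a x -> differentiable b x ->
  is_derive x v (fun y => bilin (G y) (a y) (b y))
   (bilin ('D_v G x) (a x) (b x) + bilin (G x) ('D_v a x) (b x)
    + bilin (G x) (a x) ('D_v b x)).
Proof.
move=> dG da db.
have dGij i j := diff_derivable (v := v) ((differentiable_mxP G x).1 dG i j).
have dai i := diff_derivable (v := v) ((differentiable_mxP a x).1 da 0 i).
have dbi i := diff_derivable (v := v) ((differentiable_mxP b x).1 db 0 i).
pose h i j := (fun y => a y 0 i) * (fun y => G y i j) * (fun y => b y 0 j) : V -> R.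
have -> : (fun y => bilin (G y) (a y) (b y)) = \sum_i \sum_j h i j.
  apply/funext => y; rewrite bilinE fct_sumE; apply: eq_bigr => i _.
  by rewrite fct_sumE.
have E : bilin ('D_v G x) (a x) (b x) + bilin (G x) ('D_v a x) (b x)
    + bilin (G x) (a x) ('D_v b x) = \sum_i \sum_j
  ((a x 0 i * G x i j) *: ('D_v b x) 0 j + b x 0 j *: (a x 0 i *: ('D_v G x) i j + G x i j *: ('D_v a x) 0 i)).
  rewrite !bilinE -!big_split /=; apply: eq_bigr => i _.
  rewrite -!big_split /=; apply: eq_bigr => j _; rewrite /GRing.scale /=; ring.
rewrite E; apply: is_derive_sum => i; apply: is_derive_sum => j; rewrite /h.
rewrite -!derive_entry//.
apply: is_deriveM; last exact: derivableP.
by apply: is_deriveM; exact: derivableP.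
Qed.

Lemma derive_bilin (G : V -> 'M[R]_n) (a b : V -> 'rV[R]_n) x v :
  differentiable G x -> differentiable a x -> differentiable b x ->
  'D_v (fun y => bilin (G y) (a y) (b y)) x =
   bilin ('D_v G x) (a x) (b x) + bilin (G x) ('D_v a x) (b x)
    + bilin (G x) (a x) ('D_v b x).
Proof. by move=> dG da db; have [] := is_derive_bilin v dG da db. Qed.

Lemma derive_tr (G : V -> 'M[R]_n) x v : differentiable G x ->
  (\forall y \near x, (G y)^T = G y) -> ('D_v G x)^T = 'D_v G x.
Proof.
move=> dG nG; apply/matrixP => i j; rewrite mxE -!derive_entry//.
by apply: near_eq_derive; apply: filterS nG => y Gy; rewrite -[in LHS]Gy mxE.
Qed.

End DeriveBilin.

Section Christoffel.
Context {R : realType} {n : nat}.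
Implicit Types (G : 'rV[R]_n -> 'M[R]_n) (x u v w : 'rV[R]_n).

Let bilin_koszul (G A B : 'M[R]_n) (C : 'I_n -> 'M[R]_n) u v w : G \in unitmx ->
  bilin G ((\row_l (2^-1 * (bilin A v (delta_mx 0 l) + bilin B u (delta_mx 0 l)
                           - bilin (C l) u v))) *m invmx G) w =
  2^-1 * (bilin A v w + bilin B u w - bilin (\sum_l w 0 l *: C l) u v).
Proof.
move=> Gu; rewrite bilin_rowinv//.
have wE (D : 'M[R]_n) z : bilin D z w = \sum_i w 0 i * bilin D z (delta_mx 0 i).
  by rewrite {1}[w]row_sum_delta bilin_sumr; apply: eq_bigr => i _; rewrite bilinZr.
rewrite (wE A) (wE B) bilin_summ -sumrN -!big_split mulr_sumr /=.
by apply: eq_bigr => i _; rewrite mxE bilin_scalem; ring.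
Qed.

Lemma bilin_christoffel G x u v w : G x \in unitmx -> differentiable G x ->
  bilin (G x) (christoffel G x u v) w =
  2^-1 * (bilin ('D_u G x) v w + bilin ('D_v G x) u w - bilin ('D_w G x) u v).
Proof.
move=> Gu dG; rewrite /christoffel bilin_koszul//; congr (_ * (_ - bilin _ _ _)).
by rewrite -(diff_derive_sum _ _ dG) -row_sum_delta.
Qed.

Lemma christoffel_sym G x u v : differentiable G x ->
  (\forall y \near x, (G y)^T = G y) -> christoffel G x u v = christoffel G x v u.
Proof.
move=> dG nG; rewrite /christoffel; congr (_ *m _); apply/rowP => l; rewrite !mxE.
have := derive_tr (delta_mx 0 l) dG nG.
move: ('D_(delta_mx 0 l) G x) ('D_u G x) ('D_v G x) => C A B Cs.
by rewrite (bilinC u v Cs); congr (_ * (_ - _)); exact: addrC.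
Qed.

(** In the sum of the two Christoffel terms, the derivatives of G along a and b
    cancel and the two halves of its derivative along the velocity add up. *)
Lemma derive_bilin_christoffel {V : normedModType R} G (y a b : V -> 'rV[R]_n) (t v : V) :
  G (y t) \in unitmx -> differentiable G (y t) ->
  (\forall z \near y t, (G z)^T = G z) ->
  differentiable y t -> differentiable a t -> differentiable b t ->
  'D_v (fun s => bilin (G (y s)) (a s) (b s)) t =
   bilin (G (y t)) ('D_v a t + christoffel G (y t) ('D_v y t) (a t)) (b t)
   + bilin (G (y t)) (a t) ('D_v b t + christoffel G (y t) ('D_v y t) (b t)).
Proof.
move=> Gu dG nG dy da db.
have Gs := nbhs_singleton nG.
rewrite (@derive_bilin _ _ _ (G \o y))//; last exact: differentiable_comp.
rewrite (derive_comp v dy dG) bilinDl bilinDr (bilinC (a t) (christoffel _ _ _ _) Gs).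
rewrite !bilin_christoffel//=.
have := derive_tr ('D_v y t) dG nG.
move: ('D_('D_v y t) G (y t)) ('D_(a t) G (y t)) ('D_(b t) G (y t)) => A B C.
move: ('D_v y t) ('D_v a t) ('D_v b t) (a t) (b t) (G (y t)) => u da' db' p q g.
by move=> As; rewrite (bilinC q p As); lra.
Qed.

(** The Euler-Lagrange covector of the energy of G along z, evaluated on w: it is
    the acceleration lowered by G, in a form that does not involve the inverse of
    G. *)
Definition euler_lagrange G (z : R -> 'rV[R]_n) (t : R) w : R :=
  bilin (G (z t)) ('D_1 (fun s => 'D_1 z s) t) w + bilin ('D_('D_1 z t) G (z t)) ('D_1 z t) w
  - 2^-1 * bilin ('D_w G (z t)) ('D_1 z t) ('D_1 z t).

Lemma bilin_acceleration G z t w : G (z t) \in unitmx -> differentiable G (z t) ->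
  bilin (G (z t)) (acceleration G z t) w = euler_lagrange G z t w.
Proof.
move=> Gu dG; rewrite /acceleration bilinDl bilin_christoffel// /euler_lagrange.
move: ('D_1 (fun s => 'D_1 z s) t) ('D_('D_1 z t) G (z t)) ('D_w G (z t)) => p A B.
by lra.
Qed.

End Christoffel.

(** * Naturality of the Euler-Lagrange covector *)

Section SecondDerivative.
Context {R : realType}.

Lemma derive_sum_scale (V : normedModType R) m n p (c : 'I_p -> V -> R)
    (f : 'I_p -> V -> 'M[R]_(m, n)) x v :
  (forall i, differentiable (c i) x) -> (forall i, differentiable (f i) x) ->
  differentiable (fun y => \sum_i c i y *: f i y) x /\
  'D_v (fun y => \sum_i c i y *: f i y) x =
    \sum_i ('D_v (c i) x *: f i x + c i x *: 'D_v (f i) x).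
Proof.
move=> dc df.
have dfe i a b := (differentiable_mxP (f i) x).1 (df i) a b.
have E a b : (fun y => (\sum_i c i y *: f i y) a b) =
    \sum_i (fun y => c i y) * (fun y => f i y a b).
  by apply/funext => y; rewrite summxE fct_sumE; apply: eq_bigr => i _; rewrite mxE.
have dM : differentiable (fun y => \sum_i c i y *: f i y) x.
  apply/differentiable_mxP => a b; rewrite E; apply: differentiable_sum => i.
  exact: differentiableM.
split => //; apply/matrixP => a b; rewrite -(derive_entry v a b dM) E.
rewrite derive_sum; last by move=> i; apply: diff_derivable; exact: differentiableM.
rewrite summxE; apply: eq_bigr => i _.
rewrite deriveM; [|exact: diff_derivable..].
rewrite !mxE -(derive_entry v a b (df i)) addrC.
by rewrite [f i x a b *: _]mulrC.
Qed.

Lemma derive_linear_combination (V : normedModType R) m n p (c : 'I_p -> R)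
    (f : 'I_p -> V -> 'M[R]_(m, n)) x v : (forall i, differentiable (f i) x) ->
  'D_v (fun y => \sum_i c i *: f i y) x = \sum_i c i *: 'D_v (f i) x.
Proof.
move=> df; have [] := @derive_sum_scale _ _ _ _ (fun i _ => c i) f x v.
- by move=> i; exact: differentiable_cst.
- exact: df.
move=> _ ->; apply: eq_bigr => i _.
have -> : 'D_v (fun _ : V => c i) x = 0 by exact: derive_cst.
by rewrite scale0r add0r.
Qed.

Lemma derive2_comp m n (F : 'rV[R]_m -> 'rV[R]_n) (z : R -> 'rV[R]_m) t :
  smooth_near z t -> smooth_near F (z t) ->
  'D_1 (fun s => 'D_1 (F \o z) s) t =
    'D_('D_1 (fun s => 'D_1 z s) t) F (z t)
    + 'D_('D_1 z t) (fun x => 'D_('D_1 z t) F x) (z t).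
Proof.
move=> Hz HF; have dz := smooth_near_diff Hz.
have nz := smooth_near_nbhs Hz.
have nF : \forall s \near t, smooth_near F (z s).
  have cz := differentiable_continuous dz.
  have nFz : \forall x \near z t, smooth_near F x by exact: smooth_near_nbhs.
  exact: (cz _ nFz).
have E1 : \forall s \near t, 'D_1 (F \o z) s =
    \sum_i ('D_1 z s) 0 i *: 'D_(delta_mx 0 i) F (z s).
  apply: filter_app nF; apply: filterS nz => s zs Fs.
  rewrite (derive_comp (1 : R) (smooth_near_diff zs) (smooth_near_diff Fs)).
  by rewrite {1}[ 'D_1 z s]row_sum_delta diff_derive_sum//; exact: smooth_near_diff.
rewrite (near_eq_derive _ E1).
have dz2 := smooth_near_diff (smooth_near_derive (1 : R) Hz).
have dDF v := smooth_near_diff (smooth_near_derive v HF).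
have := (@derive_sum_scale _ _ _ _ (fun i s => ('D_1 z s) 0 i)
  (fun i s => 'D_(delta_mx 0 i) F (z s)) t 1 _ _).2.
move=> ->; first last.
- by move=> i; exact: (differentiable_comp dz (dDF _)).
- by move=> i; exact: (differentiable_mxP _ _).1 dz2 0 i.
rewrite big_split /=; congr (_ + _).
  rewrite [X in 'D_X F _]row_sum_delta diff_derive_sum; last exact: smooth_near_diff.
  by apply: eq_bigr => i _; congr (_ *: _); exact: derive_entry.
have E2 : \forall x \near z t, 'D_('D_1 z t) F x =
    \sum_i ('D_1 z t) 0 i *: 'D_(delta_mx 0 i) F x.
  apply: filterS (smooth_near_nbhs HF) => x Fx.
  by rewrite {1}[ 'D_1 z t]row_sum_delta diff_derive_sum//; exact: smooth_near_diff.
rewrite [RHS](near_eq_derive _ E2).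
rewrite derive_linear_combination; last by move=> i; exact: dDF.
apply: eq_bigr => i _.
by rewrite -(@derive_comp _ _ _ _ (fun x => 'D_(delta_mx 0 i) F x) z t 1 dz (dDF _)).
Qed.

End SecondDerivative.

Section Naturality.
Context {R : realType} {m n : nat}.

Lemma derive_bilin_cst (V : normedModType R) (G : V -> 'M[R]_m) a b x v :
  differentiable G x -> 'D_v (fun y => bilin (G y) a b) x = bilin ('D_v G x) a b.
Proof.
move=> dG; rewrite (derive_bilin v dG (differentiable_cst a x) (differentiable_cst b x)).
by rewrite !derive_cst bilin0l bilin0r !addr0.
Qed.

Lemma derive_pullback (g : 'rV[R]_n -> 'M[R]_n) (G : 'rV[R]_m -> 'M[R]_m)
    (F : 'rV[R]_m -> 'rV[R]_n) x a b v :
  smooth_near F x -> differentiable g (F x) -> differentiable G x ->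
  (\forall y \near x, forall a b,
    bilin (G y) a b = bilin (g (F y)) ('D_a F y) ('D_b F y)) ->
  bilin ('D_v G x) a b = bilin ('D_('D_v F x) g (F x)) ('D_a F x) ('D_b F x)
    + bilin (g (F x)) ('D_v (fun y => 'D_a F y) x) ('D_b F x)
    + bilin (g (F x)) ('D_a F x) ('D_v (fun y => 'D_b F y) x).
Proof.
move=> HF dg dG nG; rewrite -derive_bilin_cst//.
have E : \forall y \near x, bilin (G y) a b = bilin (g (F y)) ('D_a F y) ('D_b F y).
  by apply: filterS nG => y; apply.
rewrite (near_eq_derive _ E).
have dF := smooth_near_diff HF.
have dDF w := smooth_near_diff (smooth_near_derive w HF).
have dgF : differentiable (g \o F) x by exact: differentiable_comp.
have DE := derive_bilin v dgF (dDF a) (dDF b).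
by rewrite (derive_comp v dF dg) in DE.
Qed.

(** The second derivatives of F along the velocity and along w appear twice, with
    opposite signs once they are exchanged: what remains is the covector of g. *)
Lemma euler_lagrange_pullback (g : 'rV[R]_n -> 'M[R]_n) (G : 'rV[R]_m -> 'M[R]_m)
    (F : 'rV[R]_m -> 'rV[R]_n) (z : R -> 'rV[R]_m) t w :
  smooth_near z t -> smooth_near F (z t) ->
  differentiable g (F (z t)) -> differentiable G (z t) -> (g (F (z t)))^T = g (F (z t)) ->
  (\forall y \near z t, forall a b,
    bilin (G y) a b = bilin (g (F y)) ('D_a F y) ('D_b F y)) ->
  euler_lagrange G z t w = euler_lagrange g (F \o z) t ('D_w F (z t)).
Proof.
move=> Hz HF dg dG gs nG; have := nbhs_singleton nG => GE.
have dz := smooth_near_diff Hz; have dF := smooth_near_diff HF.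
rewrite /euler_lagrange GE !(derive_pullback _ _ _ HF dg dG nG) derive2_comp//.
rewrite (derive_comp (1 : R) dz dF) /comp.
rewrite (smooth_near_schwarz ('D_1 z t) w HF).
move: ('D_1 (fun s => 'D_1 z s) t) ('D_1 z t) => z2 u.
move: ('D_('D_u F (z t)) g (F (z t))) ('D_('D_w F (z t)) g (F (z t))) => A B.
move: ('D_u (fun y => 'D_u F y) (z t)) ('D_w (fun y => 'D_u F y) (z t)) => p q.
move: ('D_u F (z t)) ('D_w F (z t)) ('D_z2 F (z t)) (g (F (z t))) gs => a b c G0 gs.
by rewrite bilinDl (bilinC q a gs); lra.
Qed.

End Naturality.

(** * The cross product of a scalar product on R^3 *)

Section PositiveDefinite.
Context {R : realType} {n : nat}.
Implicit Types (G : 'M[R]_n).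

Definition posdef G := forall v : 'rV[R]_n, v != 0 -> 0 < bilin G v v.

Lemma posdef_unit G : posdef G -> G \in unitmx.
Proof.
move=> Gp; rewrite -row_free_unit -kermx_eq0; apply/rowV0P => v /sub_kermxP vG.
apply/eqP/negPn/negP => v0; have := Gp v v0.
by rewrite /bilin vG mul0mx mxE ltxx.
Qed.

Lemma posdef_ge0 G v : posdef G -> 0 <= bilin G v v.
Proof.
by move=> Gp; have [->|/Gp/ltW//] := eqVneq v 0; rewrite bilin0l.
Qed.

(** The segment from the identity to G stays among invertible matrices. *)
Lemma posdef_det_gt0 G : posdef G -> 0 < \det G.
Proof.
move=> Gp; pose M (t : R) := t *: G + (1 - t) *: 1%:M.
have Mp t : 0 <= t <= 1 -> \det (M t) != 0.
  move=> /andP[t0 t1]; rewrite -unitfE -unitmxE; apply: posdef_unit => v v0.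
  have vv : 0 < bilin 1%:M v v.
    rewrite /bilin mulmx1 mxE; under eq_bigr do rewrite mxE -expr2.
    rewrite lt_def sumr_ge0 ?andbT; last by move=> i _; exact: sqr_ge0.
    rewrite psumr_eq0; last by move=> i _; exact: sqr_ge0.
    apply: contra v0 => /allP h; apply/eqP/rowP => i; rewrite mxE.
    by apply/eqP; rewrite -sqrf_eq0; apply: h; rewrite mem_index_enum.
  rewrite bilin_addm !bilin_scalem; have := Gp v v0.
  have [->|tn0] := eqVneq t 0; first by rewrite mul0r subr0 mul1r add0r.
  move=> Gv; rewrite ltr_pwDl//; first by rewrite mulr_gt0// lt_neqAle eq_sym tn0.
  by rewrite mulr_ge0 ?subr_ge0// ltW.
have cM t : {for t, continuous (fun s => \det (M s))}.
  apply: smooth_near_continuous; apply: smooth_near_det; apply: smooth_nearD.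
    apply: smooth_near_scale; first exact: smooth_near_idR.
    exact: smooth_near_cst.
  apply: smooth_near_scale; last exact: smooth_near_cst.
  by apply: smooth_nearB; [exact: smooth_near_cst|exact: smooth_near_idR].
have M1 : M 1 = G by rewrite /M subrr scale0r addr0 scale1r.
have M0 : M 0 = 1%:M by rewrite /M subr0 scale0r add0r scale1r.
rewrite -M1 ltNge; apply/negP => le0.
have [||t] := @IVT R (fun s => \det (M s)) 0 1 0 ler01.
- by apply: continuous_subspaceT => t; exact: cM.
- by rewrite ge_min le_max le0 orbT M0 det1 ler01.
by rewrite in_itv/= => /Mp/eqP.
Qed.

End PositiveDefinite.

Section Det3.
Context {R : comNzRingType}.

Definition det3 (a b c : R * R * R) : R :=
  a.1.1 * (b.1.2 * c.2 - b.2 * c.1.2) - a.1.2 * (b.1.1 * c.2 - b.2 * c.1.1)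
  + a.2 * (b.1.1 * c.1.2 - b.1.2 * c.1.1).

Lemma det_mx22 (B : 'M[R]_2) : \det B = B 0 0 * B 1 1 - B 0 1 * B 1 0.
Proof.
rewrite (expand_det_row _ 0) !big_ord_recl big_ord0 /cofactor !det_mx11 !mxE /=.
have e0 : lift 0 0 = 1 :> 'I_2 by apply: val_inj.
have e1 : lift 1 0 = 0 :> 'I_2 by apply: val_inj.
by rewrite ?e0 ?e1 /bump /=; ring.
Qed.

Lemma det_mx33 (A : 'M[R]_3) : \det A =
  det3 (A 0 0, A 0 1, A 0 2%:R) (A 1 0, A 1 1, A 1 2%:R) (A 2%:R 0, A 2%:R 1, A 2%:R 2%:R).
Proof.
rewrite (expand_det_row _ 0) !big_ord_recl big_ord0 /cofactor !det_mx22 !mxE /det3 /=.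
have e1 : lift 0 0 = 1 :> 'I_3 by apply: val_inj.
have e2 : lift 0 1 = 2%:R :> 'I_3 by apply: val_inj.
have e3 : lift 0 (lift 0 0) = 2%:R :> 'I_3 by apply: val_inj.
have e4 : lift (1 : 'I_3) 0 = 0 by apply: val_inj.
have e5 : lift (1 : 'I_3) 1 = 2%:R by apply: val_inj.
have e6 : lift (2%:R : 'I_3) 0 = 0 :> 'I_3 by apply: val_inj.
have e7 : lift (2%:R : 'I_3) 1 = 1 :> 'I_3 by apply: val_inj.
rewrite ?e3 ?e1 ?e2 ?e4 ?e5 ?e6 ?e7 /=.
have -> : ord0 = 0 :> 'I_3 by [].
by rewrite /bump /= !addn0 !add0n; ring.
Qed.

Lemma det_rows3 (u v w : 'rV[R]_3) : \det (\matrix_(i < 3) [:: u; v; w]`_i) =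
  det3 (u 0 0, u 0 1, u 0 2%:R) (v 0 0, v 0 1, v 0 2%:R) (w 0 0, w 0 1, w 0 2%:R).
Proof. by rewrite det_mx33 !mxE. Qed.

End Det3.

Lemma big_ord3 (R : nmodType) (F : 'I_3 -> R) : \sum_i F i = F 0 + F 1 + F 2%:R.
Proof.
rewrite !big_ord_recl big_ord0 addr0 addrA.
by congr (F _ + F _ + F _); apply: val_inj.
Qed.

Section Cross.
Context {R : realType}.
Implicit Types (G : 'M[R]_3) (u v w : 'rV[R]_3).

(** [volume] and [cross] with the metric as a parameter, so that they can be moved
    from one chart to another. *)
Definition vol_of G u v w : R :=
  Num.sqrt (\det G) * \det (\matrix_(i < 3) [:: u; v; w]`_i).

Definition cross_of G u v : 'rV[R]_3 :=
  (\row_l vol_of G u v (delta_mx 0 l)) *m invmx G.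

Variable G : 'M[R]_3.
Hypotheses (Gs : G^T = G) (Gp : posdef G).

Let Gu := posdef_unit Gp.
Local Notation dot := (bilin G).
Local Notation cr := (cross_of G).
Local Notation vol := (vol_of G).

Let dotC u v : dot u v = dot v u.
Proof. exact: bilinC. Qed.

Lemma cross_dot u v w : dot (cr u v) w = vol u v w.
Proof.
rewrite /cross_of bilin_rowinv// big_ord3 !mxE /vol_of !det_rows3 !mxE /=.
by rewrite /det3 /=; ring.
Qed.

Lemma vol_cycle u v w : vol u v w = vol v w u.
Proof. by rewrite /vol_of !det_rows3 /det3 /=; ring. Qed.

Lemma vol_swap u v w : vol u v w = - vol v u w.
Proof. by rewrite /vol_of !det_rows3 /det3 /=; ring. Qed.

Lemma vol_eq0 u v : vol u u v = 0.
Proof. by rewrite /vol_of !det_rows3 /det3 /=; ring. Qed.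

(** Both sides are the determinant of M G M'^T, where the rows of M and M' are the
    two triples of vectors. *)
Lemma vol_vol u v w a b c : vol u v w * vol a b c =
  det3 (dot u a, dot u b, dot u c) (dot v a, dot v b, dot v c)
       (dot w a, dot w b, dot w c).
Proof.
set M := \matrix_(i < 3) [:: u; v; w]`_i; set M' := \matrix_(i < 3) [:: a; b; c]`_i.
have -> : vol u v w * vol a b c = \det (M *m G *m M'^T).
  rewrite !det_mulmx det_tr /vol_of -/M -/M' -[in RHS](sqr_sqrtr (ltW (posdef_det_gt0 Gp))).
  ring.
have E i j : (M *m G *m M'^T) i j = dot (row i M) (row j M').
  by rewrite /bilin tr_row -!row_mul !mxE; apply: eq_bigr => k _; rewrite !mxE.
by rewrite det_mx33 !E !rowK.
Qed.

Let trace_dot x y : \sum_l dot x (delta_mx 0 l) * dot y (delta_mx 0 l *m invmx G) = dot x y.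
Proof.
rewrite [in RHS](row_sum_delta y) bilin_sumr; apply: eq_bigr => l _.
rewrite bilinZr mulrC; congr (_ * _).
by rewrite dotC bilin_rowinv// (bigD1 l)//= big1 ?mxE ?eqxx ?mul1r ?addr0//;
  move=> i /negbTE il; rewrite mxE il andbF mul0r.
Qed.

Let trace_dim : \sum_l dot (delta_mx 0 l) (delta_mx 0 l *m invmx G) = 3.
Proof.
transitivity (\sum_(l < 3) (1 : R)); last by rewrite sumr_const card_ord.
apply: eq_bigr => l _; rewrite dotC bilin_rowinv// (bigD1 l)//= big1 ?addr0.
  by rewrite !mxE !eqxx mulr1.
by move=> i /negbTE il; rewrite !mxE il andbF mul0r.
Qed.

(** In the product of two volumes, the third vectors of the two triples are taken
    in a basis and in its dual basis, and summed: the traces contribute the factor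
    3 - 1 - 1 = 1. *)
Lemma dot_cross_cross u v a b :
  dot (cr u v) (cr a b) = dot u a * dot v b - dot u b * dot v a.
Proof.
rewrite -trace_dot.
transitivity (\sum_l ((dot u a * dot v b - dot u b * dot v a)
    * dot (delta_mx 0 l) (delta_mx 0 l *m invmx G)
  - dot u a * (dot b (delta_mx 0 l) * dot v (delta_mx 0 l *m invmx G))
  + dot u b * (dot a (delta_mx 0 l) * dot v (delta_mx 0 l *m invmx G))
  + dot v a * (dot b (delta_mx 0 l) * dot u (delta_mx 0 l *m invmx G))
  - dot v b * (dot a (delta_mx 0 l) * dot u (delta_mx 0 l *m invmx G)))).
  apply: eq_bigr => l _; rewrite !cross_dot vol_vol /det3 /=.
  by rewrite [dot (delta_mx 0 l) a]dotC [dot (delta_mx 0 l) b]dotC; ring.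
rewrite !big_split /= !sumrN -!mulr_sumr !trace_dot trace_dim.
by rewrite [dot b v]dotC [dot a u]dotC [dot a v]dotC [dot b u]dotC; ring.
Qed.

Let dot_inj u v : (forall w, dot u w = dot v w) -> u = v.
Proof. exact: bilin_nondeg_eq. Qed.

Lemma cross_cross u v w : cr (cr u v) w = dot u w *: v - dot v w *: u.
Proof.
apply: dot_inj => z; rewrite cross_dot vol_cycle -cross_dot dot_cross_cross.
by rewrite bilinDl bilinNl !bilinZl (dotC w u) (dotC z v) (dotC w v) (dotC z u).
Qed.

Lemma crossC u v : cr u v = - cr v u.
Proof. by apply: dot_inj => z; rewrite bilinNl !cross_dot vol_swap. Qed.

Lemma crossZr a u v : cr u (a *: v) = a *: cr u v.
Proof.
apply: dot_inj => z; rewrite bilinZl !cross_dot /vol_of !det_rows3 !mxE /det3 /=.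
by ring.
Qed.

Lemma crossDr u v w : cr u (v + w) = cr u v + cr u w.
Proof.
apply: dot_inj => z; rewrite bilinDl !cross_dot /vol_of !det_rows3 !mxE /det3 /=.
by ring.
Qed.

Lemma crossZl a u v : cr (a *: u) v = a *: cr u v.
Proof. by rewrite crossC crossZr -scalerN -crossC. Qed.

Lemma crossDl u v w : cr (u + v) w = cr u w + cr v w.
Proof. by rewrite crossC crossDr opprD -!crossC. Qed.

Lemma cross_self u : cr u u = 0.
Proof. by apply: dot_inj => z; rewrite bilin0l cross_dot vol_eq0. Qed.

(** The double cross product with W = x x y is minus the projection orthogonal to
    W; each of the two products is given by the triple product formula. *)
Lemma orthonormal_expansion x y z :
  dot x x = 1 -> dot y y = 1 -> dot x y = 0 ->
  z = dot z (cr x y) *: cr x y + dot z x *: x + dot z y *: y.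
Proof.
move=> xx yy xy; have yx : dot y x = 0 by rewrite dotC.
have WW : dot (cr x y) (cr x y) = 1 by rewrite dot_cross_cross xx yy xy yx; ring.
have xW : cr x (cr x y) = - y.
  by rewrite crossC cross_cross xx yx scale1r scale0r subr0.
have yW : cr y (cr x y) = x.
  by rewrite crossC cross_cross yy xy scale1r scale0r sub0r opprK.
have := cross_cross z (cr x y) (cr x y).
have -> : cr z (cr x y) = dot z y *: x - dot z x *: y.
  by rewrite [LHS]crossC cross_cross opprB (dotC y z) (dotC x z).
rewrite crossDl -scaleN1r !crossZl xW yW WW => /rowP H; apply/rowP => i.
by have := H i; rewrite !mxE; lra.
Qed.

End Cross.

Section CrossTransform.
Context {R : realType}.

Lemma posdef_pullback n (B G : 'M[R]_n) : B \in unitmx -> posdef G -> posdef (B *m G *m B^T).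
Proof.
move=> Bu Gp v v0; rewrite bilin_pullback; apply: Gp.
by apply: contra v0 => /eqP vB; rewrite -[v](mulmxK Bu) vB mul0mx.
Qed.

(** Orientation enters here: for det B < 0 the volume form would change sign. *)
Lemma vol_of_pullback (B G : 'M[R]_3) u v w : 0 < \det B ->
  vol_of (B *m G *m B^T) u v w = vol_of G (u *m B) (v *m B) (w *m B).
Proof.
move=> B0; rewrite /vol_of.
have -> : \matrix_(i < 3) [:: u *m B; v *m B; w *m B]`_i = (\matrix_(i < 3) [:: u; v; w]`_i) *m B.
  by apply/row_matrixP; case=> [[|[|[|]]]] // lt3; rewrite row_mul !rowK.
rewrite !det_mulmx det_tr mulrAC -expr2 sqrtrM ?sqr_ge0// sqrtr_sqr gtr0_norm//.
ring.
Qed.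

Lemma cross_of_pullback (B G : 'M[R]_3) u v : 0 < \det B -> G^T = G -> posdef G ->
  cross_of (B *m G *m B^T) u v *m B = cross_of G (u *m B) (v *m B).
Proof.
move=> B0 Gs Gp; have Bu : B \in unitmx by rewrite unitmxE unitfE gt_eqF.
have G's : (B *m G *m B^T)^T = B *m G *m B^T by rewrite !trmx_mul trmxK Gs mulmxA.
apply: (bilin_nondeg_eq (posdef_unit Gp)) => w.
rewrite -[w](mulmxKV Bu) -bilin_pullback !cross_dot//; last exact: posdef_pullback.
by rewrite vol_of_pullback.
Qed.

End CrossTransform.

(** * Charts, tangent vectors and smooth maps *)

Section Near.
Context {R : realType}.

Lemma continuous_near (T T' : topologicalType) (F : T -> T') x (P : set T') :
  {for x, continuous F} -> (\forall z \near F x, P z) -> \forall y \near x, P (F y).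
Proof. by move=> cF nP; exact: (cF _ nP). Qed.

Lemma open_near (T : topologicalType) (U : set T) x : open U -> U x -> \forall y \near x, U y.
Proof. by move=> oU Ux; exact: open_nbhs_nbhs. Qed.

End Near.

Section Charts.
Context {R : realType} {n : nat} {M : manifold R n}.
Implicit Types (k : chart R M n) (q : M).

Lemma near_dom k q : dom k q -> \forall p \near q, dom k p.
Proof. by move=> dq; apply: open_near dq; exact: dom_open. Qed.

Lemma near_cod k x : cod k x -> \forall y \near x, cod k y.
Proof. by move=> cx; apply: open_near cx; exact: cod_open. Qed.

Lemma smooth_transition k k' x : atlas k -> atlas k' -> cod k x -> dom k' (bwd k x) ->
  smooth_near (fwd k' \o bwd k) x.
Proof.
move=> ak ak' cx dx; apply: (smooth_on_near _ _ (transition_smooth ak ak')); last by split.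
rewrite openE => y [cy dy]; apply: filterI; first exact: near_cod cy.
by apply: continuous_near (bwd_continuous cy) _; exact: near_dom.
Qed.

Lemma chart_at_cod q : cod (chart_at q) (fwd (chart_at q) q).
Proof. by apply: fwd_cod; exact: chart_at_dom. Qed.

Lemma chart_atK q : bwd (chart_at q) (fwd (chart_at q) q) = q.
Proof. by apply: fwdK; exact: chart_at_dom. Qed.

Lemma smooth_transition_at k q : atlas k -> dom k q ->
  smooth_near (fwd k \o bwd (chart_at q)) (fwd (chart_at q) q).
Proof.
move=> ak dq; apply: smooth_transition => //; first exact: chart_at_atlas.
  exact: chart_at_cod.
by rewrite chart_atK.
Qed.

Definition chart_jacobian k q : 'M[R]_n :=
  jacobian (fwd k \o bwd (chart_at q)) (fwd (chart_at q) q).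

Lemma in_chartE k q v : atlas k -> dom k q -> in_chart k q v = v *m chart_jacobian k q.
Proof.
by move=> ak dq; apply: deriveEjacobian; exact: smooth_near_diff (smooth_transition_at ak dq).
Qed.

Lemma in_chart_id q v : in_chart (chart_at q) q v = v.
Proof.
rewrite /in_chart (_ : 'D_v _ _ = 'D_v id (fwd (chart_at q) q)); first exact: derive_id.
apply: near_eq_derive.
apply: filterS (near_cod (chart_at_cod q)) => x cx; exact: bwdK.
Qed.

End Charts.

Lemma push_bwdK (R : realType) n (M : manifold R n) (k : chart R M n) q u : atlas k -> dom k q ->
  push (bwd k) (fwd k q) (in_chart k q u) = u.
Proof.
move=> ak dq; rewrite /push fwdK//; set k' := chart_at q.
have dk' : dom k' q by exact: chart_at_dom.
have ak' : atlas k' by exact: chart_at_atlas.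
have E : (fwd k \o bwd k') (fwd k' q) = fwd k q by rewrite /= fwdK.
have d1 := smooth_near_diff (smooth_transition_at ak dq).
have d2 : differentiable (fwd k' \o bwd k) ((fwd k \o bwd k') (fwd k' q)).
  by rewrite E; apply/smooth_near_diff/smooth_transition; rewrite ?fwdK//; exact: fwd_cod.
rewrite /in_chart -/k' -E -(derive_comp u d1 d2).
rewrite -[RHS](derive_id (fwd k' q) u); apply: near_eq_derive.
have nd : \forall x \near fwd k' q, dom k (bwd k' x).
  apply: continuous_near; first by apply: bwd_continuous; exact: fwd_cod.
  by rewrite fwdK//; exact: near_dom.
apply: filter_app nd; apply: filterS (near_cod (fwd_cod dk')) => x cx dx /=.
by rewrite fwdK// bwdK.
Qed.


Section SmoothInto.
Context {R : realType} {V : normedModType R} {n : nat} {M : manifold R n}.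
Implicit Types (F : V -> M) (x : V) (k : chart R M n).

Definition smooth_into_near F x := exists2 U : set V, open U /\ U x & smooth_into U F.

Lemma smooth_into_near_nbhs F x : smooth_into_near F x ->
  \forall y \near x, smooth_into_near F y.
Proof. by move=> [U [oU Ux] FU]; apply: filterS (open_near oU Ux) => y Uy; exists U. Qed.

Lemma smooth_into_near_continuous F x : smooth_into_near F x -> {for x, continuous F}.
Proof. by move=> [U [oU Ux] [FU _]]; exact: FU. Qed.

Lemma smooth_into_near_dom F x k : smooth_into_near F x -> dom k (F x) ->
  \forall y \near x, dom k (F y).
Proof.
move=> HF dF; apply: continuous_near (smooth_into_near_continuous HF) _.
exact: near_dom dF.
Qed.

Lemma smooth_into_near_chart F x k : smooth_into_near F x -> atlas k -> dom k (F x) ->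
  smooth_near (fwd k \o F) x.
Proof.
move=> [U [oU Ux] [cU sU]] ak dF; apply: (smooth_on_near _ _ (sU k ak)); last by split.
rewrite openE => y [Uy dy]; apply: filterI; first exact: open_near oU Uy.
by apply: continuous_near (cU y Uy) _; exact: near_dom.
Qed.

Lemma smooth_into_nearP F x (U : set V) : open U -> U x ->
  (forall y, U y -> {for y, continuous F} /\
     exists k, [/\ atlas k, dom k (F y) & smooth_near (fwd k \o F) y]) ->
  smooth_into_near F x.
Proof.
move=> oU Ux HU; exists U => //; split=> [y Uy|k ak]; first exact: (HU y Uy).1.
apply: smooth_near_on => y [Uy dy]; have [cF [k' [ak' dk' sk']]] := HU y Uy.
apply: (@smooth_near_ext _ _ _ ((fwd k \o bwd k') \o (fwd k' \o F))).
  have : \forall z \near y, dom k' (F z).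
    by apply: continuous_near cF _; exact: near_dom dk'.
  by apply: filterS => z dz /=; rewrite fwdK.
apply: (@smooth_near_comp _ _ _ _ _ (fwd k' \o F) (fwd k \o bwd k')) => //.
by apply: smooth_transition; rewrite //= ?fwdK//; exact: fwd_cod.
Qed.

(** [push] reads vectors in the preferred chart at the moving point F x; calculus
    needs them in one chart, in which they become plain derivatives. *)
Lemma in_chart_push F x k v : smooth_into_near F x -> atlas k -> dom k (F x) ->
  in_chart k (F x) (push F x v) = 'D_v (fwd k \o F) x.
Proof.
move=> HF ak dF; set k' := chart_at (F x).
have dk' : dom k' (F x) by exact: chart_at_dom.
have ak' : atlas k' by exact: chart_at_atlas.
rewrite /in_chart /push -/k'.
have dT := smooth_near_diff (smooth_transition_at ak dF).
have dF' := smooth_near_diff (smooth_into_near_chart HF ak' dk').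
rewrite -(@derive_comp _ _ _ _ (fwd k \o bwd k') (fwd k' \o F) x v dF' dT).
apply: near_eq_derive.
by apply: filterS (smooth_into_near_dom HF dk') => y dy /=; rewrite fwdK.
Qed.

End SmoothInto.

Section SmoothMaps.
Context {R : realType} {V : normedModType R} {m n : nat}.
Context {S : manifold R m} {M : manifold R n}.
Implicit Types (f : S -> M) (F : V -> S).

Lemma smooth_map_bwd f k x : smooth_map f -> atlas k -> cod k x ->
  smooth_into_near (f \o bwd k) x.
Proof. by move=> Hf ak cx; exists (cod k); [split=> //; exact: cod_open|exact: Hf]. Qed.

Lemma smooth_bwd (k : chart R S m) x : atlas k -> cod k x -> smooth_into_near (bwd k) x.
Proof.
move=> ak cx; exists (cod k); first by split=> //; exact: cod_open.
split=> [y cy|k' ak']; first exact: bwd_continuous.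
exact: transition_smooth.
Qed.

Lemma smooth_map_comp f F x : smooth_map f -> smooth_into_near F x ->
  smooth_into_near (f \o F) x.
Proof.
move=> Hf [U [oU Ux] FU]; apply: (@smooth_into_nearP _ _ _ _ (f \o F) x U) => //.
move=> y Uy; have HF : smooth_into_near F y by exists U.
pose j := chart_at (F y); have aj : atlas j by exact: chart_at_atlas.
have dj : dom j (F y) by exact: chart_at_dom.
have cj : cod j (fwd j (F y)) by exact: fwd_cod.
have Hb := smooth_map_bwd Hf aj cj.
have njF : \forall z \near y, (f \o bwd j) (fwd j (F z)) = (f \o F) z.
  by apply: filterS (smooth_into_near_dom HF dj) => z dz /=; rewrite fwdK.
have E := nbhs_singleton njF.
have sj := smooth_into_near_chart HF aj dj.
split.
  rewrite /prop_for /continuous_at -E.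
  have c1 := smooth_into_near_continuous Hb.
  have c2 := smooth_near_continuous sj.
  have c := continuous_comp c2 c1.
  apply: cvg_trans c; apply: near_eq_cvg; apply: filterS njF => z Ez.
  by rewrite -Ez.
exists (chart_at ((f \o F) y)); split; [exact: chart_at_atlas|exact: chart_at_dom|].
set k := chart_at _.
apply: (@smooth_near_ext _ _ _ ((fwd k \o (f \o bwd j)) \o (fwd j \o F))).
  by apply: filterS njF => z Ez; rewrite /= -[f (F z)]Ez.
apply: (@smooth_near_comp _ _ _ _ _ (fwd j \o F) (fwd k \o (f \o bwd j)) y sj).
apply: smooth_into_near_chart Hb _ _; first exact: chart_at_atlas.
by rewrite E; exact: chart_at_dom.
Qed.

Lemma push_comp f F x v : smooth_map f -> smooth_into_near F x ->
  push (f \o F) x v = tmap f (F x) (push F x v).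
Proof.
move=> Hf HF; rewrite /tmap; set j := chart_at (F x).
have aj : atlas j by exact: chart_at_atlas.
have dj : dom j (F x) by exact: chart_at_dom.
have Hb := smooth_map_bwd Hf aj (fwd_cod dj).
rewrite /push /=; have E : bwd j (fwd j (F x)) = F x by exact: fwdK.
rewrite -/j E; set k := chart_at (f (F x)).
have sj := smooth_near_diff (smooth_into_near_chart HF aj dj).
have sk : differentiable (fwd k \o (f \o bwd j)) ((fwd j \o F) x).
  apply: smooth_near_diff; apply: smooth_into_near_chart Hb _ _; first exact: chart_at_atlas.
  by rewrite /= E; exact: chart_at_dom.
rewrite -(derive_comp v sj sk).
apply: near_eq_derive.
by apply: filterS (smooth_into_near_dom HF dj) => z dz /=; rewrite fwdK.
Qed.

End SmoothMaps.

(** * The Levi-Civita derivative of fields along maps *)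

Section MetricInCharts.
Context {R : realType} {n : nat} {M : riemannian R n}.
Implicit Types (k : chart R M n) (p q : M).

Lemma metric_posdef q : posdef (metric q).
Proof. by move=> v; exact: metric_pos. Qed.

Lemma bilin_pullbackE m (F : 'rV[R]_m -> M) x a b :
  differentiable (fwd (chart_at (F x)) \o F) x ->
  bilin (pullback (@metric R n M) F x) a b = inner (F x) (push F x a) (push F x b).
Proof.
move=> dF; have pushE v : push F x v = \sum_i v 0 i *: push F x (delta_mx 0 i).
  by rewrite {1}(row_sum_delta v) /push (diff_derive_sum _ _ dF).
rewrite /inner (pushE a) (pushE b) bilin_suml bilinE; apply: eq_bigr => i _.
rewrite bilin_sumr; apply: eq_bigr => j _; rewrite bilinZl bilinZr mxE.
ring.
Qed.

Lemma pullback_sym m (F : 'rV[R]_m -> M) x :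
  (pullback (@metric R n M) F x)^T = pullback (@metric R n M) F x.
Proof.
apply/matrixP => i j; rewrite mxE [LHS]mxE [RHS]mxE; apply: bilinC.
exact: Defs.metric_sym.
Qed.

(** Tangent vectors at distinct points are written in distinct preferred charts;
    near a given point, the metric can be differentiated once all of them are
    brought into a single chart. *)
Lemma inner_in_chart k q u v : atlas k -> dom k q ->
  inner q u v = bilin (pullback (@metric R n M) (bwd k) (fwd k q))
                  (in_chart k q u) (in_chart k q v).
Proof.
move=> ak dq; rewrite bilin_pullbackE ?push_bwdK ?fwdK//.
apply/smooth_near_diff/smooth_transition; rewrite ?fwdK//.
- exact: chart_at_atlas.
- exact: fwd_cod.
- exact: chart_at_dom.
Qed.

Lemma metric_in_chart k q : atlas k -> dom k q ->
  metric q = chart_jacobian k q *m pullback (@metric R n M) (bwd k) (fwd k q)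
             *m (chart_jacobian k q)^T.
Proof.
move=> ak dq; apply: bilin_ext => u v.
by rewrite bilin_pullback -!in_chartE// -inner_in_chart.
Qed.

Lemma chart_posdef k x : atlas k -> cod k x ->
  posdef (pullback (@metric R n M) (bwd k) x).
Proof.
move=> ak cx v v0; have Hb := smooth_bwd ak cx; have db := bwd_dom cx.
rewrite bilin_pullbackE; last first.
  apply/smooth_near_diff/(smooth_into_near_chart Hb); first exact: chart_at_atlas.
  exact: chart_at_dom.
apply: metric_pos; apply: contra v0 => /eqP pv.
have := in_chart_push v Hb ak db; rewrite pv in_chartE// mul0mx => /esym.
have -> : 'D_v (fwd k \o bwd k) x = 'D_v id x.
  by apply: near_eq_derive; apply: filterS (near_cod cx) => y cy /=; exact: bwdK.
by rewrite derive_id => ->.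
Qed.

Lemma chart_metric_smooth k x : atlas k -> cod k x ->
  smooth_near (pullback (@metric R n M) (bwd k)) x.
Proof.
by move=> ak cx; apply: smooth_on_near cx (metric_smooth ak); exact: cod_open.
Qed.

Lemma chart_metric_at q : chart_metric q (fwd (chart_at q) q) = metric q.
Proof.
have ak := chart_at_atlas q; have dk := chart_at_dom q.
apply: bilin_ext => u v; have E := inner_in_chart u v ak dk.
by rewrite !in_chart_id in E; exact: esym E.
Qed.

Lemma chart_metric_diff q : differentiable (chart_metric q) (fwd (chart_at q) q).
Proof.
apply/smooth_near_diff/chart_metric_smooth; [exact: chart_at_atlas|exact: chart_at_cod].
Qed.

Lemma chart_metric_sym q x : (chart_metric q x)^T = chart_metric q x.
Proof. exact: pullback_sym. Qed.

Lemma chart_metric_near_sym q : \forall x \near fwd (chart_at q) q,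
  (chart_metric q x)^T = chart_metric q x.
Proof.
by apply: filterS (near_cod (chart_at_cod q)) => x _; exact: chart_metric_sym.
Qed.

Lemma chart_metric_unit q : chart_metric q (fwd (chart_at q) q) \in unitmx.
Proof. by rewrite chart_metric_at; apply: posdef_unit; exact: metric_posdef. Qed.

End MetricInCharts.

Section FieldsAlong.
Context {R : realType} {V : normedModType R} {n : nat} {M : riemannian R n}.
Implicit Types (F : V -> M) (A B : V -> 'rV[R]_n) (x v : V).

(** The chart is the one preferred at F x and stays fixed while y varies, as in
    the definition of [cov_along]. *)
Definition field_in_chart F A x (y : V) := in_chart (chart_at (F x)) (F y) (A y).

Definition smooth_field F A x := smooth_near (field_in_chart F A x) x.

Lemma smooth_field_diff F A x : smooth_field F A x -> differentiable (field_in_chart F A x) x.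
Proof. exact: smooth_near_diff. Qed.

Lemma field_in_chart_at F A x : field_in_chart F A x x = A x.
Proof. exact: in_chart_id. Qed.

Lemma near_inner F A B x : smooth_into_near F x ->
  \forall y \near x, inner (F y) (A y) (B y) =
    bilin (chart_metric (F x) ((fwd (chart_at (F x)) \o F) y))
      (field_in_chart F A x y) (field_in_chart F B x y).
Proof.
move=> HF; have dk := chart_at_dom (F x).
apply: filterS (smooth_into_near_dom HF dk) => y dy.
by apply: inner_in_chart => //; exact: chart_at_atlas.
Qed.

Lemma smooth_into_near_chart_at F x : smooth_into_near F x ->
  smooth_near (fwd (chart_at (F x)) \o F) x.
Proof.
move=> HF; apply: smooth_into_near_chart => //; [exact: chart_at_atlas|exact: chart_at_dom].
Qed.

Lemma smooth_near_inner F A B x : smooth_into_near F x ->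
  smooth_field F A x -> smooth_field F B x ->
  smooth_near (fun y => inner (F y) (A y) (B y)) x.
Proof.
move=> HF HA HB; have HF' := smooth_into_near_chart_at HF.
have := near_inner A B HF => nE.
apply: (@smooth_near_ext _ _ _ (fun y => bilin (chart_metric (F x)
   ((fwd (chart_at (F x)) \o F) y)) (field_in_chart F A x y) (field_in_chart F B x y))).
  by apply: filterS nE => y ->.
have HG : smooth_near (chart_metric (F x)) ((fwd (chart_at (F x)) \o F) x).
  by apply: chart_metric_smooth; [exact: chart_at_atlas|exact: chart_at_cod].
exact: smooth_near_bilin (smooth_near_comp HF' HG) HA HB.
Qed.

(** The product rule by which every scalar identity along a curve or a surface is
    differentiated; it is [derive_bilin_christoffel] read in one chart. *)
Lemma derive_inner F A B x v : smooth_into_near F x ->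
  smooth_field F A x -> smooth_field F B x ->
  'D_v (fun y => inner (F y) (A y) (B y)) x =
    inner (F x) (cov_along F A x v) (B x) + inner (F x) (A x) (cov_along F B x v).
Proof.
move=> HF HA HB; rewrite (near_eq_derive _ (near_inner A B HF)).
have dF := smooth_near_diff (smooth_into_near_chart_at HF).
have dA := smooth_field_diff HA; have dB := smooth_field_diff HB.
have nG : \forall z \near (fwd (chart_at (F x)) \o F) x,
    (chart_metric (F x) z)^T = chart_metric (F x) z.
  exact: chart_metric_near_sym.
have := derive_bilin_christoffel v (chart_metric_unit (F x)) (chart_metric_diff (F x)) nG dF dA dB.
move=> ->; rewrite !field_in_chart_at [X in bilin X _ _ + _]chart_metric_at.
by rewrite [X in _ + bilin X _ _]chart_metric_at.
Qed.

Lemma field_push F x u : smooth_into_near F x ->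
  \forall y \near x, field_in_chart F (fun y => push F y u) x y =
    'D_u (fwd (chart_at (F x)) \o F) y.
Proof.
move=> HF; have nd := smooth_into_near_dom HF (chart_at_dom (F x)).
apply: filter_app nd; apply: filterS (smooth_into_near_nbhs HF) => y Hy dy.
by apply: in_chart_push => //; exact: chart_at_atlas.
Qed.

Lemma smooth_field_push F x u : smooth_into_near F x ->
  smooth_field F (fun y => push F y u) x.
Proof.
move=> HF; have HF' := smooth_near_derive u (smooth_into_near_chart_at HF).
by apply: smooth_near_ext HF'; apply: filterS (field_push u HF) => y ->.
Qed.

Lemma cov_push F x u v : smooth_into_near F x ->
  cov_along F (fun y => push F y u) x v =
    'D_v (fun y => 'D_u (fwd (chart_at (F x)) \o F) y) x
    + christoffel (chart_metric (F x)) (fwd (chart_at (F x)) (F x)) (push F x v) (push F x u).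
Proof.
move=> HF.
have E := near_eq_derive v (field_push u HF).
rewrite /cov_along.
rewrite /field_in_chart in E.
rewrite E.
by [].
Qed.

(** Torsion-freeness: second derivatives commute and the Christoffel symbols are
    symmetric. *)
Lemma cov_push_sym F x u v : smooth_into_near F x ->
  cov_along F (fun y => push F y u) x v = cov_along F (fun y => push F y v) x u.
Proof.
move=> HF; rewrite (cov_push u v HF) (cov_push v u HF).
apply: (f_equal2 +%R (smooth_near_schwarz v u (smooth_into_near_chart_at HF))).
apply: christoffel_sym; first exact: chart_metric_diff.
exact: chart_metric_near_sym.
Qed.

Lemma smooth_field_ext F F' A A' x :
  (\forall y \near x, F y = F' y) -> (\forall y \near x, A y = A' y) ->
  smooth_field F A x -> smooth_field F' A' x.
Proof.
move=> FF' AA'; apply: smooth_near_ext; rewrite /field_in_chart (nbhs_singleton FF').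
by apply: filter_app AA'; apply: filterS FF' => y -> ->.
Qed.

Lemma cov_along_ext F F' A A' x v :
  (\forall y \near x, F y = F' y) -> (\forall y \near x, A y = A' y) ->
  cov_along F A x v = cov_along F' A' x v.
Proof.
move=> FF' AA'; have E := nbhs_singleton FF'; have E' := nbhs_singleton AA'.
rewrite /cov_along /push E E'; apply: (f_equal2 +%R).
  by apply: near_eq_derive; apply: filter_app AA'; apply: filterS FF' => y -> ->.
apply: (f_equal2 (christoffel _ _)) => //.
by apply: near_eq_derive; apply: filterS FF' => y /= ->.
Qed.

End FieldsAlong.

Lemma cov_velocity (R : realType) (n : nat) (M : riemannian R n) (c : R -> M) t :
  smooth_into_near c t ->
  cov_along c (velocity c) t 1 =
    acceleration (chart_metric (c t)) (fwd (chart_at (c t)) \o c) t.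
Proof. by move=> Hc; rewrite /velocity (cov_push (1 : R) (1 : R) Hc). Qed.

Section Composition.
Context {R : realType} {V : normedModType R} {m n : nat} {M : riemannian R n}.
Implicit Types (F : 'rV[R]_m -> M) (A : 'rV[R]_m -> 'rV[R]_n) (g : V -> 'rV[R]_m).

Lemma smooth_field_comp F A g x : smooth_near g x -> smooth_field F A (g x) ->
  smooth_field (F \o g) (A \o g) x.
Proof. by move=> Hg HA; apply: (smooth_near_comp Hg HA). Qed.

Lemma cov_along_comp F A g x v : smooth_near g x -> smooth_into_near F (g x) ->
  smooth_field F A (g x) ->
  cov_along (F \o g) (A \o g) x v = cov_along F A (g x) ('D_v g x).
Proof.
move=> Hg HF HA; have dg := smooth_near_diff Hg.
have dF := smooth_near_diff (smooth_into_near_chart_at HF).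
apply: (f_equal2 +%R (derive_comp v dg (smooth_field_diff HA))).
exact: (f_equal2 (christoffel _ _) (derive_comp v dg dF) erefl).
Qed.

End Composition.

Section VectorFields.
Context {R : realType} {V : normedModType R} {m n : nat}.
Context {S : manifold R m} {M : riemannian R n}.
Implicit Types (f : S -> M) (F : V -> S) (N : S -> 'rV[R]_n).

Let field_bwd f N (k : chart R S m) x : atlas k -> cod k x ->
  smooth_map f -> smooth_along (cod k) (f \o bwd k) (N \o bwd k) ->
  smooth_field (f \o bwd k) (N \o bwd k) x.
Proof.
move=> ak cx Hf HN; set k' := chart_at (f (bwd k x)).
have sN := HN k' (chart_at_atlas _).
apply: (smooth_on_near _ _ sN); last by split=> //; exact: chart_at_dom.
rewrite openE => y [cy dy]; apply: filterI; first exact: near_cod.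
apply: (@continuous_near _ _ (f \o bwd k)); last exact: near_dom.
exact: smooth_into_near_continuous (smooth_map_bwd Hf ak cy).
Qed.

Lemma smooth_field_along f N F x : smooth_map f ->
  (forall k, atlas k -> smooth_along (cod k) (f \o bwd k) (N \o bwd k)) ->
  smooth_into_near F x -> smooth_field (f \o F) (N \o F) x.
Proof.
move=> Hf HN HF; pose j := chart_at (F x).
have aj : atlas j by exact: chart_at_atlas.
have dj : dom j (F x) by exact: chart_at_dom.
have HA := field_bwd aj (fwd_cod dj) Hf (HN j aj).
have Hj := smooth_into_near_chart HF aj dj.
have nF := smooth_into_near_dom HF dj.
apply: smooth_field_ext (smooth_field_comp Hj HA).
  by apply: filterS nF => y dy /=; rewrite fwdK.
by apply: filterS nF => y dy /=; rewrite fwdK.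
Qed.

(** Brings the derivative of the normal along a curve back to [cov_normal], and that
    of xi along any map back to [cov]. *)
Lemma cov_along_map f N F x v : smooth_map f ->
  (forall k, atlas k -> smooth_along (cod k) (f \o bwd k) (N \o bwd k)) ->
  smooth_into_near F x ->
  cov_along (f \o F) (N \o F) x v =
    cov_along (f \o bwd (chart_at (F x))) (N \o bwd (chart_at (F x)))
      (fwd (chart_at (F x)) (F x)) (push F x v).
Proof.
move=> Hf HN HF; set j := chart_at (F x).
have aj : atlas j by exact: chart_at_atlas.
have dj : dom j (F x) by exact: chart_at_dom.
have HA := field_bwd aj (fwd_cod dj) Hf (HN j aj).
have Hj := smooth_into_near_chart HF aj dj.
have nF := smooth_into_near_dom HF dj.
have Hb := smooth_map_bwd Hf aj (fwd_cod dj).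
rewrite -(cov_along_comp v Hj Hb HA); apply: cov_along_ext.
  by apply: filterS nF => y dy /=; rewrite fwdK.
by apply: filterS nF => y dy /=; rewrite fwdK.
Qed.

End VectorFields.

(** * Accelerations and isometric immersions *)

Lemma smooth_into_near_precomp (R : realType) (V : normedModType R) m n
    (M : manifold R n) (F : 'rV[R]_m -> M) (g : V -> 'rV[R]_m) x :
  smooth_near g x -> smooth_into_near F (g x) -> smooth_into_near (F \o g) x.
Proof.
move=> Hg HF; pose U := [set y | smooth_near g y /\ smooth_into_near F (g y)].
apply: (@smooth_into_nearP _ _ _ _ (F \o g) x (U^°)).
- exact: open_interior.
- have n1 := continuous_near (smooth_near_continuous Hg) (smooth_into_near_nbhs HF).
  by apply: filter_app n1; apply: filterS (smooth_near_nbhs Hg) => y ? ?; split.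
move=> y /nbhs_singleton[gy Fy]; split.
  apply: continuous_comp; first exact: smooth_near_continuous.
  exact: smooth_into_near_continuous.
exists (chart_at (F (g y))); split; [exact: chart_at_atlas|exact: chart_at_dom|].
exact: (smooth_near_comp gy (smooth_into_near_chart Fy (chart_at_atlas _) (chart_at_dom _))).
Qed.

Lemma push_ext (R : realType) (V : normedModType R) n (M : manifold R n)
    (F F' : V -> M) (x v : V) : (\forall y \near x, F y = F' y) -> push F x v = push F' x v.
Proof.
move=> FF'; have E := nbhs_singleton FF'.
rewrite /push E; apply: near_eq_derive.
by apply: filterS FF' => y /= ->.
Qed.

Lemma near_push_ext (R : realType) (V : normedModType R) n (M : manifold R n)
    (F F' : V -> M) (x v : V) : (\forall y \near x, F y = F' y) ->
  \forall y \near x, push F y v = push F' y v.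
Proof.
move=> FF'; have H : \forall y \near x, \forall z \near (y : V), F z = F' z.
  exact: nbhs_interior.
by apply: filterS H => y; exact: push_ext.
Qed.

Section PullbackAcceleration.
Context {R : realType} {m n : nat} {M : riemannian R n}.
Implicit Types (F : 'rV[R]_m -> M) (z : R -> 'rV[R]_m).

Lemma near_pullback F x : smooth_into_near F x ->
  \forall y \near x, forall a b,
    bilin (pullback (@metric R n M) F y) a b = inner (F y) (push F y a) (push F y b).
Proof.
move=> HF; apply: filterS (smooth_into_near_nbhs HF) => y Hy a b.
apply: bilin_pullbackE; exact/smooth_near_diff/smooth_into_near_chart_at.
Qed.

Lemma smooth_pullback F x : smooth_into_near F x ->
  smooth_near (pullback (@metric R n M) F) x.
Proof.
move=> HF; apply/smooth_near_mxP => i j.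
apply: (@smooth_near_ext _ _ _ (fun y =>
  inner (F y) (push F y (delta_mx 0 i)) (push F y (delta_mx 0 j)))).
  by apply: filterS (near_pullback HF) => y H; rewrite -H bilin_delta.
by apply: smooth_near_inner => //; exact: smooth_field_push.
Qed.

(** The metric of M in a chart and its pullback by F have the same Euler-Lagrange
    covector, and in M this covector is the acceleration. *)
Lemma pullback_euler_lagrange F z t w : smooth_near z t -> smooth_into_near F (z t) ->
  euler_lagrange (pullback (@metric R n M) F) z t w =
  inner (F (z t)) (cov_along (F \o z) (velocity (F \o z)) t 1) (push F (z t) w).
Proof.
move=> Hz HF; have HFc := smooth_into_near_chart_at HF.
set k := chart_at (F (z t)) in HFc.
have nG : \forall y \near z t, forall a b,
    bilin (pullback (@metric R n M) F y) a b =
    bilin (chart_metric (F (z t)) ((fwd k \o F) y)) ('D_a (fwd k \o F) y) ('D_b (fwd k \o F) y).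
  have ak : atlas k by exact: chart_at_atlas.
  have nd := smooth_into_near_dom HF (chart_at_dom (F (z t))).
  apply: filter_app nd; apply: filter_app (smooth_into_near_nbhs HF).
  apply: filterS (near_pullback HF) => y E Hy dy a b.
  by rewrite E (inner_in_chart _ _ ak dy) !(in_chart_push _ Hy ak dy).
have dG := smooth_near_diff (smooth_pullback HF).
have dg : differentiable (chart_metric (F (z t))) ((fwd k \o F) (z t)).
  exact: chart_metric_diff.
have gs := chart_metric_sym (F (z t)) ((fwd k \o F) (z t)).
rewrite (euler_lagrange_pullback w Hz HFc dg dG gs nG).
have gu : chart_metric (F (z t)) (((fwd k \o F) \o z) t) \in unitmx.
  exact: chart_metric_unit.
rewrite -(bilin_acceleration _ gu dg).
have HFz := smooth_into_near_precomp Hz HF.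
rewrite (cov_velocity HFz) /inner.
have := chart_metric_at (F (z t)) => E; rewrite [X in bilin X _ _]E.
by [].
Qed.

End PullbackAcceleration.

Section Isometric.
Context {R : realType} {m n : nat} {S : riemannian R m} {M : riemannian R n}.
Implicit Types (f : S -> M) (c : R -> S).

Lemma near_euler_lagrange k (G G' : 'rV[R]_k -> 'M[R]_k) z t w :
  (\forall y \near z t, G y = G' y) -> euler_lagrange G z t w = euler_lagrange G' z t w.
Proof.
move=> GG'; rewrite /euler_lagrange (nbhs_singleton GG').
by rewrite (near_eq_derive w GG') (near_eq_derive ('D_1 z t) GG').
Qed.

(** Near c t, the metric of M pulled back by f and the metric of S are the same
    metric in the chart of S: both sides are its Euler-Lagrange covector. *)
Lemma isometric_acceleration f c t w : smooth_map f ->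
  (forall p u v, inner (f p) (tmap f p u) (tmap f p v) = inner p u v) ->
  smooth_into_near c t ->
  inner (f (c t)) (cov_along (f \o c) (velocity (f \o c)) t 1) (tmap f (c t) w) =
  inner (c t) (cov_along c (velocity c) t 1) w.
Proof.
move=> Hf fiso Hc; set k := chart_at (c t).
have ak : atlas k by exact: chart_at_atlas.
have dk : dom k (c t) by exact: chart_at_dom.
have ck := fwd_cod dk; set z := fwd k \o c.
have Hz : smooth_near z t by exact: smooth_into_near_chart.
have HB : smooth_into_near (bwd k) (z t) by exact: smooth_bwd.
have HF : smooth_into_near (f \o bwd k) (z t) by exact: smooth_map_bwd.
have nc : \forall s \near t, (bwd k \o z) s = c s.
  by apply: filterS (smooth_into_near_dom Hc dk) => s ds /=; rewrite fwdK.
have nfc : \forall s \near t, ((f \o bwd k) \o z) s = (f \o c) s.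
  by apply: filterS nc => s /= ->.
have GG : \forall y \near z t, pullback (@metric R n M) (f \o bwd k) y =
    pullback (@metric R m S) (bwd k) y.
  apply: filterS (near_cod ck) => y cy; have Hy := smooth_bwd ak cy.
  apply/matrixP => i j; rewrite [LHS]mxE [RHS]mxE.
  by rewrite !(push_comp _ Hf Hy) [LHS]fiso.
have E1 := pullback_euler_lagrange w Hz HF; have E2 := pullback_euler_lagrange w Hz HB.
rewrite (near_euler_lagrange w GG) E2 in E1.
rewrite (cov_along_ext (1 : R) nfc (near_push_ext (1 : R) nfc)) in E1.
rewrite (cov_along_ext (1 : R) nc (near_push_ext (1 : R) nc)) in E1.
have E : bwd k (z t) = c t by exact: nbhs_singleton nc.
have pw : push (bwd k) (z t) w = w by have := push_bwdK w ak dk; rewrite in_chart_id.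
rewrite pw E in E1; have E' : (f \o bwd k) (z t) = f (c t) by rewrite /= E.
by rewrite E' in E1; exact: esym E1.
Qed.

End Isometric.

(** * The cross product and the Killing field along maps *)

Section OrientedCharts.
Context {R : realType} {M : riemannian R 3}.
Hypothesis M_oriented : oriented M.

Lemma chart_jacobian_gt0 (k : chart R M 3) q : atlas k -> dom k q ->
  0 < \det (chart_jacobian k q).
Proof.
move=> ak dq; apply: M_oriented => //; first exact: chart_at_atlas.
  exact: chart_at_cod.
by rewrite chart_atK.
Qed.

Lemma cross_in_chart (k : chart R M 3) (q : M) u v : atlas k -> dom k q ->
  in_chart k q (cross q u v) =
  cross_of (pullback (@metric R 3 M) (bwd k) (fwd k q)) (in_chart k q u) (in_chart k q v).
Proof.
move=> ak dq; rewrite !in_chartE// -[cross q u v]/(cross_of (metric q) u v).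
rewrite (metric_in_chart ak dq); apply: cross_of_pullback.
- exact: chart_jacobian_gt0.
- exact: pullback_sym.
- by apply: chart_posdef => //; exact: fwd_cod.
Qed.

Lemma smooth_near_cross_of (V : normedModType R) (G : V -> 'M[R]_3) u v x :
  smooth_near G x -> posdef (G x) -> smooth_near u x -> smooth_near v x ->
  smooth_near (fun y => cross_of (G y) (u y) (v y)) x.
Proof.
move=> HG Gp Hu Hv; apply: smooth_near_mulmx; last first.
  by apply: smooth_near_invmx => //; exact: posdef_unit.
apply/smooth_near_mxP => i l; under eq_fun do rewrite mxE.
apply: smooth_nearM.
  by apply: smooth_near_sqrt; [exact: smooth_near_det|exact: posdef_det_gt0].
apply: smooth_near_det; apply/smooth_near_mxP => a b.
under eq_fun do rewrite mxE.
case: a => [[|[|[|]]]] //= _.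
- by move/smooth_near_mxP: Hu; apply.
- by move/smooth_near_mxP: Hv; apply.
- exact: smooth_near_cst.
Qed.

Lemma smooth_field_cross (V : normedModType R) (F : V -> M) A B x :
  smooth_into_near F x -> smooth_field F A x -> smooth_field F B x ->
  smooth_field F (fun y => cross (F y) (A y) (B y)) x.
Proof.
move=> HF HA HB; have ak := chart_at_atlas (F x).
have HG : smooth_near (chart_metric (F x)) ((fwd (chart_at (F x)) \o F) x).
  by apply: chart_metric_smooth => //; exact: chart_at_cod.
have Gp : posdef (chart_metric (F x) ((fwd (chart_at (F x)) \o F) x)).
  by apply: chart_posdef => //; exact: chart_at_cod.
have H := smooth_near_cross_of (smooth_near_comp (smooth_into_near_chart_at HF) HG) Gp HA HB.
apply: smooth_near_ext H.
apply: filterS (smooth_into_near_dom HF (chart_at_dom (F x))) => y dy.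
by rewrite /field_in_chart cross_in_chart.
Qed.

End OrientedCharts.

Section EktFields.
Context {R : realType} {kappa tau : R} {E : Ekt kappa tau}.
Context {V : normedModType R}.
Implicit Types (F : V -> E) (x v : V).

Lemma smooth_map_id n (M : manifold R n) : smooth_map (id : M -> M).
Proof.
move=> k ak; split=> [x cx|k' ak']; first exact: bwd_continuous.
exact: transition_smooth.
Qed.

Lemma smooth_field_xi F x : smooth_into_near F x -> smooth_field F (xi \o F) x.
Proof.
move=> HF; apply: (@smooth_field_along _ _ _ _ _ E id xi F x _ _ HF).
  exact: smooth_map_id.
by move=> k ak; exact: xi_smooth.
Qed.

Lemma cov_xi F x v : smooth_into_near F x ->
  cov_along F (xi \o F) x v = tau *: cross (F x) (push F x v) (xi (F x)).
Proof.
move=> HF; rewrite -bundle_curvature.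
apply: (@cov_along_map _ _ _ _ _ E id xi F x v _ _ HF).
  exact: smooth_map_id.
by move=> k ak; exact: xi_smooth.
Qed.

End EktFields.

(** * The normal along a horizontal geodesic *)

Section Segment.
Context {R : realType}.

(** At an end point, the derivative is read off from one side. *)
Lemma derive_zero_on_segment (d : R -> R) (l t : R) : 0 < l -> 0 <= t <= l ->
  differentiable d t -> (forall s, 0 <= s <= l -> d s = 0) -> 'D_1 d t = 0.
Proof.
move=> l0 /andP[t0 tl] dd d0.
have dt0 : d t = 0 by apply: d0; rewrite t0.
have dc : cvg ((fun h : R => h^-1 *: ((d \o shift t) (h *: 1) - d t)) @ 0^').
  exact: diff_derivable.
rewrite /derive; have [tl'|tl'] := ltP t l.
  rewrite cvg_at_rightE//; apply: cvg_lim => //; apply: cvg_near_cst.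
  near=> h.
  have hl : h < l - t by near: h; apply: nbhs_right_lt; rewrite subr_gt0.
  have h0 : 0 < h by near: h; exact: nbhs_right_gt.
  have -> : (d \o shift t) (h *: 1) = 0.
    apply: d0; rewrite /= [h%:A]mulr1; apply/andP; split; first by apply: addr_ge0 => //; exact: ltW.
    by rewrite -lerBrDr; exact: ltW.
  by rewrite dt0 subr0 scaler0.
have t_gt0 : 0 < t by apply: lt_le_trans tl'.
rewrite cvg_at_leftE//; apply: cvg_lim => //; apply: cvg_near_cst.
near=> h.
have hl : - t < h by near: h; apply: nbhs_left_gt; rewrite oppr_lt0.
have h0 : h < 0 by near: h; exact: nbhs_left_lt.
have -> : (d \o shift t) (h *: 1) = 0.
  apply: d0; rewrite /= [h%:A]mulr1; apply/andP; split.
    by rewrite -lerBlDr sub0r; exact: ltW.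
  by rewrite -[leRHS]add0r; apply: lerD => //; exact: ltW.
by rewrite dt0 subr0 scaler0.
Unshelve. all: by end_near. Qed.

Lemma derive_eq_segment (u v : R -> R) (l t : R) : 0 < l -> 0 <= t <= l ->
  differentiable u t -> differentiable v t ->
  (forall s, 0 <= s <= l -> u s = v s) -> 'D_1 u t = 'D_1 v t.
Proof.
move=> l0 tl du dv uv; apply/eqP; rewrite -subr_eq0; apply/eqP.
rewrite -(@deriveB _ _ _ u v); [|exact: diff_derivable..].
apply: (derive_zero_on_segment l0 tl); first exact: differentiableB.
by move=> s sl; rewrite !fctE uv// subrr.
Qed.

Lemma derive_cst_on_segment (u : R -> R) (a l t : R) : 0 < l -> 0 <= t <= l ->
  differentiable u t -> (forall s, 0 <= s <= l -> u s = a) -> 'D_1 u t = 0.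
Proof.
move=> l0 tl du ua; rewrite (derive_eq_segment l0 tl du (differentiable_cst a t) ua).
exact: derive_cst.
Qed.

End Segment.

Section Pointwise.
Context {R : realType} {E : riemannian R 3} (p : E).
Implicit Types u v w a b : 'rV[R]_3.

Let Gs := Defs.metric_sym p.
Let Gp := metric_posdef p.

Lemma innerC u v : inner p u v = inner p v u.
Proof. exact: bilinC. Qed.

Lemma innerDl u v w : inner p (u + v) w = inner p u w + inner p v w.
Proof. exact: bilinDl. Qed.

Lemma innerDr u v w : inner p w (u + v) = inner p w u + inner p w v.
Proof. exact: bilinDr. Qed.

Lemma innerZl k u v : inner p (k *: u) v = k * inner p u v.
Proof. exact: bilinZl. Qed.

Lemma innerZr k u v : inner p u (k *: v) = k * inner p u v.
Proof. exact: bilinZr. Qed.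

Lemma innerNl u v : inner p (- u) v = - inner p u v.
Proof. exact: bilinNl. Qed.

Lemma innerNr u v : inner p u (- v) = - inner p u v.
Proof. exact: bilinNr. Qed.

Lemma inner_cross_cross u v a b : inner p (cross p u v) (cross p a b) =
  inner p u a * inner p v b - inner p u b * inner p v a.
Proof. exact: dot_cross_cross. Qed.

Lemma cross_crossE u v w :
  cross p (cross p u v) w = inner p u w *: v - inner p v w *: u.
Proof. exact: cross_cross. Qed.

Lemma cross_anti u v : cross p u v = - cross p v u.
Proof. exact: crossC. Qed.

Lemma inner_cross_cycle u v w : inner p (cross p u v) w = inner p (cross p v w) u.
Proof. by rewrite /inner [LHS]cross_dot// [RHS]cross_dot//; exact: vol_cycle. Qed.

Lemma inner_cross_swap u v w : inner p (cross p u v) w = - inner p (cross p u w) v.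
Proof. by rewrite inner_cross_cycle cross_anti innerNl inner_cross_cycle inner_cross_cycle. Qed.

Lemma inner_cross_l u v : inner p (cross p u v) u = 0.
Proof. by rewrite inner_cross_swap /inner [X in bilin _ X _](cross_self Gp) bilin0l oppr0. Qed.

Lemma inner_cross_r u v : inner p (cross p u v) v = 0.
Proof. by rewrite cross_anti innerNl inner_cross_l oppr0. Qed.

Lemma crossDlE u v w : cross p (u + v) w = cross p u w + cross p v w.
Proof. exact: crossDl. Qed.

Lemma crossZlE k u v : cross p (k *: u) v = k *: cross p u v.
Proof. exact: crossZl. Qed.

End Pointwise.

(** Along a horizontal geodesic q, the field xi turns with the bundle curvature;
    hence so does a unit normal field, on top of its own rotation angle. *)
Section NormalAlongGeodesic.
Context {R : realType} {kappa tau l : R} {E : Ekt kappa tau}.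
Variables (q : R -> E) (N : R -> 'rV[R]_3) (vt : R -> R) (t : R).

Hypotheses (l_gt0 : 0 < l) (t_in : 0 <= t <= l).
Hypotheses (q_smooth : smooth_into_near q t) (N_smooth : smooth_field q N t)
  (vt_diff : differentiable vt t).
Hypothesis q_geodesic : cov_along q (velocity q) t 1 = 0.
Hypothesis q_unit : forall s, 0 <= s <= l -> inner (q s) (velocity q s) (velocity q s) = 1.
Hypothesis q_horizontal : forall s, 0 <= s <= l -> inner (q s) (velocity q s) (xi (q s)) = 0.
Let W s := cross (q s) (xi (q s)) (velocity q s).
Hypothesis N_angle : forall s, 0 <= s <= l ->
  N s = cos (vt s) *: W s + sin (vt s) *: xi (q s).

Let NN := cov_along q N t 1.

Let WW (s : R) : 0 <= s <= l -> inner (q s) (W s) (W s) = 1.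
Proof.
move=> sl; rewrite inner_cross_cross xi_unit q_unit// q_horizontal//.
by rewrite mulr1 mulr0 subr0.
Qed.

Let Wxi s : inner (q s) (W s) (xi (q s)) = 0. Proof. exact: inner_cross_l. Qed.

Let Wv s : inner (q s) (W s) (velocity q s) = 0. Proof. exact: inner_cross_r. Qed.

Let NW (s : R) : 0 <= s <= l -> inner (q s) (N s) (W s) = cos (vt s).
Proof.
by move=> sl; rewrite N_angle// innerDl !innerZl WW// (innerC _ (xi _)) Wxi mulr0 addr0 mulr1.
Qed.

Let Nxi (s : R) : 0 <= s <= l -> inner (q s) (N s) (xi (q s)) = sin (vt s).
Proof. by move=> sl; rewrite N_angle// innerDl !innerZl Wxi xi_unit mulr0 add0r mulr1. Qed.

Let Nv (s : R) : 0 <= s <= l -> inner (q s) (N s) (velocity q s) = 0.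
Proof.
by move=> sl; rewrite N_angle// innerDl !innerZl Wv (innerC _ (xi _)) q_horizontal// !mulr0 addr0.
Qed.

Let NZ Z : inner (q t) (N t) Z =
  cos (vt t) * inner (q t) (W t) Z + sin (vt t) * inner (q t) (xi (q t)) Z.
Proof. by rewrite N_angle// innerDl !innerZl. Qed.

Let v_smooth : smooth_field q (velocity q) t.
Proof. exact: smooth_field_push. Qed.

Let xi_smooth' : smooth_field q (xi \o q) t.
Proof. exact: smooth_field_xi. Qed.

Let W_smooth : smooth_field q W t.
Proof. apply: smooth_field_cross => //; exact: Ekt_oriented. Qed.

Let cov_xi_q : cov_along q (xi \o q) t 1 = - (tau *: W t).
Proof. by rewrite cov_xi// cross_anti scalerN. Qed.

Let diff_inner A B : smooth_field q A t -> smooth_field q B t ->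
  differentiable (fun s => inner (q s) (A s) (B s)) t.
Proof. by move=> HA HB; apply: smooth_near_diff; exact: smooth_near_inner. Qed.

Lemma cov_normal_velocity : inner (q t) NN (velocity q t) = 0.
Proof.
have := derive_cst_on_segment l_gt0 t_in (diff_inner N_smooth v_smooth) Nv.
rewrite derive_inner// q_geodesic => <-.
by rewrite -/NN [X in _ = _ + X]/inner bilin0r addr0.
Qed.

Lemma cov_normal_xi : inner (q t) NN (xi (q t)) = ('D_1 vt t + tau) * cos (vt t).
Proof.
have dsin : differentiable (fun s => sin (vt s)) t.
  apply: (differentiable_comp vt_diff); apply/derivable1_diffP.
  by have [] := is_derive_sin (vt t).
have := derive_eq_segment l_gt0 t_in (diff_inner N_smooth xi_smooth') dsin Nxi.
rewrite derive_inner// cov_xi_q -/NN innerNr innerZr NW//.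
rewrite derive_comp_real//; last by apply/derivable1_diffP; have [] := is_derive_sin (vt t).
have [_ ->] := is_derive_sin (vt t).
move: ('D_1 vt t) (inner _ NN _) (cos _) => a b e H.
by rewrite mulrDl -H; ring.
Qed.

(** Differentiating the scalar products of N, xi and W = xi x q' suffices: the
    derivative of W enters only through its products with W and xi, which the
    constancy of <W, W> and <W, xi> determines. *)
Lemma cov_normal_cross : inner (q t) NN (W t) = - (('D_1 vt t + tau) * sin (vt t)).
Proof.
have dcos : differentiable (fun s => cos (vt s)) t.
  apply: (differentiable_comp vt_diff); apply/derivable1_diffP.
  by have [] := is_derive_cos (vt t).
have := derive_eq_segment l_gt0 t_in (diff_inner N_smooth W_smooth) dcos NW.
have E1 := derive_cst_on_segment l_gt0 t_in (diff_inner W_smooth W_smooth) WW.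
have E2 : 'D_1 (fun s => inner (q s) (W s) ((xi \o q) s)) t = 0.
  apply: (derive_cst_on_segment l_gt0 t_in (diff_inner W_smooth xi_smooth')) => s _.
  exact: Wxi.
rewrite derive_inner// in E1; rewrite derive_inner// cov_xi_q innerNr innerZr WW// in E2.
rewrite derive_inner// -/NN NZ.
rewrite derive_comp_real//; last by apply/derivable1_diffP; have [] := is_derive_cos (vt t).
have [_ ->] := is_derive_cos (vt t).
have {}E1 : inner (q t) (W t) (cov_along q W t 1) = 0.
  by rewrite (innerC _ (cov_along q W t 1)) in E1; move: (inner _ _ _) E1 => x; lra.
have {}E2 : inner (q t) (xi (q t)) (cov_along q W t 1) = tau.
  by rewrite innerC; move: (inner _ _ _) E2 => x; lra.
rewrite E1 E2; move: ('D_1 vt t) (inner _ NN _) (cos _) (sin _) => a b e f.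
by lra.
Qed.

End NormalAlongGeodesic.

(** * Daniel's correspondence at a point *)

Section TangentMap.
Context {R : realType} {m n : nat} {S : manifold R m} {M : manifold R n}.

Lemma tmap_diff (f : S -> M) p : smooth_map f ->
  differentiable (fwd (chart_at (f p)) \o (f \o bwd (chart_at p))) (fwd (chart_at p) p).
Proof.
move=> Hf; have Hb := smooth_map_bwd Hf (chart_at_atlas p) (chart_at_cod p).
apply: smooth_near_diff; apply: smooth_into_near_chart Hb (chart_at_atlas _) _.
by rewrite /= chart_atK; exact: chart_at_dom.
Qed.

Lemma tmapE (f : S -> M) p v :
  tmap f p v = 'D_v (fwd (chart_at (f p)) \o (f \o bwd (chart_at p))) (fwd (chart_at p) p).
Proof. by rewrite /tmap /push /= chart_atK. Qed.

Lemma tmapD (f : S -> M) p u v : smooth_map f -> tmap f p (u + v) = tmap f p u + tmap f p v.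
Proof. by move=> Hf; rewrite !tmapE; exact: diff_deriveD (tmap_diff _ Hf). Qed.

Lemma tmapZ (f : S -> M) p a v : smooth_map f -> tmap f p (a *: v) = a *: tmap f p v.
Proof. by move=> Hf; rewrite !tmapE; exact: diff_deriveZ (tmap_diff _ Hf). Qed.

End TangentMap.

(** Pointwise consequences of Daniel's correspondence: the tangent vector w is a
    unit horizontal vector of the minimal surface, and the three scalars giving
    the derivative of its normal come from the horizontal geodesic. *)
Section SisterPoint.
Context {R : realType} {kappa tau H kappat taut theta : R}.
Context {E : Ekt kappa tau} {Et : Ekt kappat taut} {S : riemannian R 2}.
Variables (ft : S -> Et) (Nt : S -> 'rV[R]_3) (dt : fund_data S).
Variables (f : S -> E) (N : S -> 'rV[R]_3) (d : fund_data S).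
Hypotheses (ft_minimal : H_immersion ft Nt dt 0) (f_H : H_immersion f N d H).
Hypothesis parameters : sister_parameters kappa tau H kappat taut 0 theta.
Hypothesis sisters : sister_data d dt H 0 theta.
Variables (p : S) (w : 'rV[R]_2) (a b : R).
Let g := tmap ft p w.
Let X := xi (ft p).
Let W := cross (ft p) X g.
Hypotheses (g_unit : inner (ft p) g g = 1) (g_horizontal : inner (ft p) g X = 0).
Hypothesis Nt_angle : Nt p = cos a *: W + sin a *: X.
Let NN := cov_normal ft Nt p w.
Hypotheses (NN_g : inner (ft p) NN g = 0)
  (NN_xi : inner (ft p) NN X = (b + taut) * cos a)
  (NN_W : inner (ft p) NN W = - ((b + taut) * sin a)).

Let ft_iso : forall u v, inner (ft p) (tmap ft p u) (tmap ft p v) = inner p u v.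
Proof. by case: ft_minimal => -[_ h] _ _ _; exact: h. Qed.
Let f_iso : forall u v, inner (f p) (tmap f p u) (tmap f p v) = inner p u v.
Proof. by case: f_H => -[_ h] _ _ _; exact: h. Qed.
Let Nt_unit : inner (ft p) (Nt p) (Nt p) = 1.
Proof. by case: ft_minimal => _ [_ h _ _] _ _; exact: h. Qed.
Let Nt_normal v : inner (ft p) (tmap ft p v) (Nt p) = 0.
Proof. by case: ft_minimal => _ [_ _ h _] _ _; exact: h. Qed.
Let N_normal v : inner (f p) (tmap f p v) (N p) = 0.
Proof. by case: f_H => _ [_ _ h _] _ _; exact: h. Qed.
Let A_t v : tmap ft p (v *m dA dt p) = - cov_normal ft Nt p v.
Proof. by case: ft_minimal => _ _ h _; have [+ _ _ _] := h p. Qed.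
Let T_t : tmap ft p (dT dt p) = X - dnu dt p *: Nt p.
Proof. by case: ft_minimal => _ _ h _; have [_ _ + _] := h p. Qed.
Let J_t v : tmap ft p (v *m dJ dt p) = cross (ft p) (Nt p) (tmap ft p v).
Proof. by case: ft_minimal => _ _ h _; have [_ _ _ +] := h p. Qed.
Let nu_t : dnu dt p = inner (ft p) (Nt p) X.
Proof. by case: ft_minimal => _ _ h _; have [_ + _ _] := h p. Qed.
Let T_f : tmap f p (dT d p) = xi (f p) - dnu d p *: N p.
Proof. by case: f_H => _ _ h _; have [_ _ + _] := h p. Qed.
Let J_f v : tmap f p (v *m dJ d p) = cross (f p) (N p) (tmap f p v).
Proof. by case: f_H => _ _ h _; have [_ _ _ +] := h p. Qed.

Let WX : inner (ft p) W X = 0. Proof. exact: inner_cross_l. Qed.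
Let WW : inner (ft p) W W = 1.
Proof. by rewrite inner_cross_cross xi_unit g_unit g_horizontal mulr1 mulr0 subr0. Qed.

Let cross_W_g : cross (ft p) W g = - X.
Proof.
by rewrite cross_crossE g_unit [inner _ X g]innerC g_horizontal scale0r scale1r sub0r.
Qed.

Let Jg : cross (ft p) (Nt p) g = - cos a *: X + sin a *: W.
Proof. by rewrite Nt_angle crossDlE !crossZlE cross_W_g scalerN scaleNr. Qed.

Let Jg_xi : inner (ft p) (cross (ft p) (Nt p) g) X = - cos a.
Proof. by rewrite Jg innerDl !innerZl WX xi_unit mulr0 addr0 mulr1. Qed.

Lemma sister_angle : dnu d p = sin a.
Proof.
have [_ _ _ ->] := sisters p; rewrite nu_t Nt_angle innerDl !innerZl WX xi_unit.
by rewrite mulr0 add0r mulr1.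
Qed.

Let dotJ u v : inner p u (v *m dJ dt p) = - inner p (u *m dJ dt p) v.
Proof.
rewrite -(ft_iso u) -(ft_iso (u *m dJ dt p)) (J_t u) (J_t v) innerC.
exact: inner_cross_swap.
Qed.

Let S_inner k u v r : inner p r (k *: u + v) = k * inner p r u + inner p r v.
Proof. by rewrite /inner bilinDr bilinZr. Qed.

Let w_T : inner p w (dT dt p) = 0.
Proof.
rewrite -ft_iso T_t innerDr innerNr innerZr -/g g_horizontal.
by rewrite [inner _ g (Nt p)]Nt_normal mulr0 subr0.
Qed.

Let wJ_T : inner p (w *m dJ dt p) (dT dt p) = - cos a.
Proof.
rewrite -ft_iso T_t J_t innerDr innerNr innerZr Jg_xi.
by rewrite inner_cross_l mulr0 subr0.
Qed.

Let wJ_TJ : inner p (w *m dJ dt p) (dT dt p *m dJ dt p) = 0.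
Proof.
rewrite -ft_iso (J_t w) (J_t (dT dt p)) inner_cross_cross Nt_unit ft_iso w_T.
by rewrite [X in _ - _ * X]Nt_normal !mulr0 subr0.
Qed.

Let T_rot : dT d p = cos theta *: dT dt p + sin theta *: (dT dt p *m dJ dt p).
Proof.
have [_ -> _ _] := sisters p.
by rewrite /Defs.rot mulmxDr mul_mx_scalar -scalemxAr.
Qed.

Let dJ_eq : dJ d p = dJ dt p. Proof. by have [_ _ ->] := sisters p. Qed.

Let tangent_xi v : inner (f p) (tmap f p v) (xi (f p)) = inner p v (dT d p).
Proof.
rewrite -f_iso T_f innerDr innerNr innerZr [inner _ (tmap f p v) (N p)]N_normal.
by rewrite mulr0 subr0.
Qed.

Lemma sister_velocity_xi : inner (f p) (tmap f p w) (xi (f p)) = sin theta * cos a.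
Proof.
rewrite tangent_xi T_rot S_inner w_T mulr0 add0r.
have := S_inner (sin theta) (dT dt p *m dJ dt p) 0 w; rewrite addr0 => ->.
by rewrite dotJ wJ_T opprK [inner p w 0]bilin0r addr0.
Qed.

Lemma sister_rotated_xi :
  inner (f p) (cross (f p) (N p) (tmap f p w)) (xi (f p)) = - (cos theta * cos a).
Proof.
rewrite -J_f tangent_xi T_rot dJ_eq S_inner wJ_T.
have := S_inner (sin theta) (dT dt p *m dJ dt p) 0 (w *m dJ dt p); rewrite addr0 => ->.
by rewrite wJ_TJ [inner p _ 0]bilin0r mulr0 !addr0 mulrN.
Qed.

Let w_A : inner p w (w *m dA dt p) = 0.
Proof. by rewrite -ft_iso A_t innerNr innerC -/NN -/g NN_g oppr0. Qed.

Let wJ_A : inner p (w *m dJ dt p) (w *m dA dt p) = b + taut.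
Proof.
rewrite -ft_iso A_t J_t -/g -/NN Jg innerNr innerDl !innerZl ![inner _ _ NN]innerC.
rewrite NN_xi NN_W -[RHS]mulr1 -[in RHS](cos2Dsin2 a).
move: (cos a) (sin a) => x y; ring.
Qed.

Lemma sister_shape : inner p w (w *m dA d p) = - b * sin theta.
Proof.
have w_unit : inner p w w = 1 by rewrite -ft_iso.
have [-> _ _ _] := sisters p.
have -> : w *m ((dA dt p - 0%:M) *m Defs.rot theta (dJ dt p) + H%:M) =
    cos theta *: (w *m dA dt p) + (sin theta *: (w *m dA dt p *m dJ dt p) + H *: w).
  rewrite /Defs.rot raddf0 subr0 !mulmxDr mul_mx_scalar mul_mx_scalar -!scalemxAr addrA.
  by rewrite mulmxA.
rewrite !S_inner w_A mulr0 add0r dotJ wJ_A.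
have := S_inner H w 0 w; rewrite addr0 => ->.
have [_ _ HE] := parameters; rewrite [inner p w 0]bilin0r w_unit HE; ring.
Qed.

End SisterPoint.

(** * The acceleration of the conjugate curve *)

Section NormalAcceleration.
Context {R : realType} {kappa tau H : R} {E : Ekt kappa tau} {S : riemannian R 2}.
Variables (f : S -> E) (N : S -> 'rV[R]_3) (d : fund_data S) (c : R -> S) (t : R).
Hypotheses (f_H : H_immersion f N d H) (c_smooth : smooth_into_near c t).
Let w := velocity c t.
Hypothesis w_unit : inner (c t) w w = 1.
Hypothesis c_geodesic : forall v, inner (c t) (cov_along c (velocity c) t 1) v = 0.

Let f_smooth : smooth_map f. Proof. by case: f_H => -[]. Qed.
Let f_iso p u v : inner (f p) (tmap f p u) (tmap f p v) = inner p u v.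
Proof. by case: f_H => -[_ h] _ _ _; exact: h. Qed.
Let gamma_smooth : smooth_into_near (f \o c) t.
Proof. exact: smooth_map_comp. Qed.
Let N_field : smooth_field (f \o c) (N \o c) t.
Proof. by apply: smooth_field_along => //; case: f_H => _ []. Qed.

Let acc := cov_along (f \o c) (velocity (f \o c)) t 1.

(** A geodesic of the surface has no tangential acceleration; its normal
    acceleration comes from differentiating <gamma', N> = 0. *)
Lemma geodesic_acceleration_normal : acc = inner (c t) w (w *m dA d (c t)) *: N (c t).
Proof.
have [_ [_ N1 Nn _] /(_ (c t))[NA _ _ NJ] _] := f_H.
have vE s : smooth_into_near c s -> velocity (f \o c) s = tmap f (c s) (velocity c s).
  by move=> Hs; rewrite /velocity (push_comp (1 : R) f_smooth Hs).
have acc_t v : inner (f (c t)) acc (tmap f (c t) v) = 0.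
  by rewrite [LHS](isometric_acceleration v f_smooth f_iso c_smooth) c_geodesic.
have vN : \forall s \near t, inner ((f \o c) s) (velocity (f \o c) s) ((N \o c) s) = 0.
  by apply: filterS (smooth_into_near_nbhs c_smooth) => s Hs; rewrite vE//; exact: Nn.
have D0 : 'D_1 (fun s => inner ((f \o c) s) (velocity (f \o c) s) ((N \o c) s)) t = 0.
  by rewrite (near_eq_derive _ vN); exact: derive_cst.
have v_field : smooth_field (f \o c) (velocity (f \o c)) t by exact: smooth_field_push.
rewrite (derive_inner (1 : R) gamma_smooth v_field N_field) in D0.
have covN : cov_along (f \o c) (N \o c) t 1 = - tmap f (c t) (w *m dA d (c t)).
  rewrite NA opprK; apply: (cov_along_map (1 : R) f_smooth _ c_smooth).
  by case: f_H => _ [].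
rewrite covN -/acc innerNr vE// f_iso in D0.
have accN : inner (f (c t)) acc (N (c t)) = inner (c t) w (w *m dA d (c t)).
  by apply/eqP; rewrite -subr_eq0; apply/eqP.
have NN : inner (f (c t)) (N (c t)) (N (c t)) = 1 by exact: N1.
have ww : inner (f (c t)) (tmap f (c t) w) (tmap f (c t) w) = 1 by rewrite f_iso.
have Nw : inner (f (c t)) (N (c t)) (tmap f (c t) w) = 0 by rewrite innerC; exact: Nn.
have := orthonormal_expansion (Defs.metric_sym (f (c t))) (metric_posdef _) acc NN ww Nw.
rewrite -!/(inner _ _ _) -[cross_of _ _ _]/(cross (f (c t)) (N (c t)) (tmap f (c t) w)).
by rewrite -NJ !acc_t accN !scale0r add0r addr0.
Qed.

End NormalAcceleration.

(** * Curves projected to the base *)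

Section Flow.
Context {R : realType} {kappa tau : R} {E : Ekt kappa tau}.

Lemma smooth_flow_comp (V : normedModType R) (a : V -> R) (q : V -> E) x :
  smooth_near a x -> smooth_into_near q x ->
  smooth_into_near (fun y => flow (a y) (q y)) x.
Proof.
move=> Ha Hq; set k := chart_at (q x).
have ak : atlas k by exact: chart_at_atlas.
pose U := [set y | [/\ smooth_near a y, smooth_into_near q y & dom k (q y)]].
have nU : \forall y \near x, U y.
  have nd := smooth_into_near_dom Hq (chart_at_dom (q x)).
  apply: filter_app nd; apply: filter_app (smooth_into_near_nbhs Hq).
  by apply: filterS (smooth_near_nbhs Ha) => y ? ? ?; split.
apply: (@smooth_into_nearP _ _ _ _ _ _ (U^°)); [exact: open_interior|exact: nU|].
move=> y /nbhs_singleton[ay qy dy].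
pose Phi (sx : R * 'rV[R]_3) := flow sx.1 (bwd k sx.2).
have HPhi : smooth_into_near Phi (a y, fwd k (q y)).
  exists (setT `*` cod k); last exact: flow_smooth.
  split; last by split=> //; exact: fwd_cod.
  have -> : setT `*` cod k = (snd : R * 'rV[R]_3 -> 'rV[R]_3) @^-1` cod k.
    by apply/seteqP; split=> z /=; [case|split].
  by apply: open_comp; [move=> z _; exact: cvg_snd|exact: cod_open].
have sq := smooth_into_near_chart qy ak dy.
have nE : \forall z \near y, Phi (a z, fwd k (q z)) = flow (a z) (q z).
  by apply: filterS (smooth_into_near_dom qy dy) => z dz; rewrite /Phi /= fwdK.
have Ey := nbhs_singleton nE.
split.
  have c2 : {for y, continuous (fun z => (a z, fwd k (q z)))}.
    apply: (@cvg_pair _ _ _ _ (nbhs (a y)) (nbhs (fwd k (q y)))).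
      exact: smooth_near_continuous ay.
    exact: smooth_near_continuous sq.
  have c := continuous_comp c2 (smooth_into_near_continuous HPhi).
  rewrite /prop_for /continuous_at -Ey; apply: cvg_trans c; apply: near_eq_cvg.
  by apply: filterS nE => z Ez; rewrite /= Ez.
exists (chart_at (flow (a y) (q y))); split; [exact: chart_at_atlas|exact: chart_at_dom|].
rewrite -Ey; set k' := chart_at _.
(* R x R^3 is spanned by (1, 0) and the (0, e_j). *)
pose e (i : 'I_1 + 'I_3) : R * 'rV[R]_3 := if i is inr j then (0, delta_mx 0 j) else (1, 0).
pose cc (i : 'I_1 + 'I_3) z : R := if i is inr j then (fwd k (q z)) 0 j else a z.
have pE z : (a z, fwd k (q z)) = \sum_i cc i z *: e i.
  rewrite big_sumType big_ord1 /=.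
  have -> : \sum_(j < 3) fwd k (q z) 0 j *: (0, delta_mx 0 j) = (0, fwd k (q z)) :> R * 'rV[R]_3.
    rewrite [in RHS](row_sum_delta (fwd k (q z))).
    apply: (big_ind2 (fun (p1 : R * 'rV[R]_3) v => p1 = (0, v))) => //.
      by move=> _ v _ w -> ->; congr (_, _); rewrite /= addr0.
    by move=> j _; congr (_, _); rewrite /= scaler0.
  by congr (_, _) => /=; rewrite ?scaler0 ?add0r// addr0 [RHS]mulr1.
have H : smooth_near (fun z => (fwd k' \o Phi) (\sum_i cc i z *: e i)) y.
  apply: smooth_near_comp_family.
    by case=> [_|j] //=; exact: (smooth_near_mxP _ _).1 sq 0 j.
  rewrite -pE; exact: smooth_into_near_chart HPhi (chart_at_atlas _) (chart_at_dom _).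
by apply: smooth_near_ext H; apply: filterS nE => z Ez; rewrite -pE /comp Ez.
Qed.

End Flow.

Section CoordinateLines.
Context {R : realType} {n : nat}.
Local Notation e1 := (delta_mx 0 0 : 'rV[R]_2).
Local Notation e2 := (delta_mx 0 1 : 'rV[R]_2).

Lemma pt2E (s r : R) : pt2 s r = s *: e1 + r *: e2.
Proof.
apply/rowP => j; rewrite !mxE; case: j => [[|[|]]] //= _.
  by rewrite mulr1 mulr0 addr0.
by rewrite mulr0 mulr1 add0r.
Qed.

Lemma pt2_entries (y : 'rV[R]_2) : y = pt2 (y 0 0) (y 0 1).
Proof.
by apply/rowP => j; rewrite mxE; case: j => [[|[|]]] //= i; congr (y _ _); apply: val_inj.
Qed.

Lemma pt2_00 (s r : R) : (pt2 s r) 0 0 = s. Proof. by rewrite mxE. Qed.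

Lemma pt2_01 (s r : R) : (pt2 s r) 0 1 = r. Proof. by rewrite mxE. Qed.

Lemma push_line (V : normedModType R) (M : manifold R n) (F : V -> M) x u s :
  push (fun r : R => F (r *: u + x)) s 1 = push F (s *: u + x) u.
Proof. exact: (@derive_line _ _ _ (fwd (chart_at (F (s *: u + x))) \o F)). Qed.

Lemma push_first (M : manifold R n) (F : 'rV[R]_2 -> M) s r :
  push F (pt2 s r) e1 = velocity (fun s => F (pt2 s r)) s.
Proof.
rewrite (_ : (fun s => F (pt2 s r)) = (fun s => F (s *: e1 + r *: e2))); last first.
  by apply/funext => s'; rewrite pt2E.
by rewrite /velocity push_line pt2E.
Qed.

Lemma push_second (M : manifold R n) (F : 'rV[R]_2 -> M) s r :
  push F (pt2 s r) e2 = velocity (fun r => F (pt2 s r)) r.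
Proof.
rewrite (_ : (fun r => F (pt2 s r)) = (fun r => F (r *: e2 + s *: e1))); last first.
  by apply/funext => s'; rewrite pt2E addrC.
by rewrite /velocity push_line pt2E addrC.
Qed.

Lemma smooth_near_pt2 (V : normedModType R) (a b : V -> R) x :
  smooth_near a x -> smooth_near b x -> smooth_near (fun y => pt2 (a y) (b y)) x.
Proof.
move=> Ha Hb; apply/smooth_near_mxP => i j; under eq_fun do rewrite mxE.
by case: j => [[|[|]]].
Qed.

Lemma derive_first_line (s r : R) : 'D_1 (fun s => pt2 s r) s = e1.
Proof.
rewrite (_ : (fun s => pt2 s r) = (fun s : R => id (s *: e1 + r *: e2))); last first.
  by apply/funext => s'; rewrite pt2E.
by rewrite (@derive_line _ _ _ id) derive_id.
Qed.

Lemma cov_first_line (M : riemannian R n) (F : 'rV[R]_2 -> M) s r :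
  smooth_into_near F (pt2 s r) ->
  cov_along F (fun y => push F y e1) (pt2 s r) e1 =
  cov_along (fun s => F (pt2 s r)) (velocity (fun s => F (pt2 s r))) s 1.
Proof.
move=> HF; have Hg : smooth_near (fun s : R => pt2 s r) s.
  by apply: smooth_near_pt2; [exact: smooth_near_idR|exact: smooth_near_cst].
have EE := cov_along_comp (1 : R) Hg HF (smooth_field_push e1 HF).
rewrite derive_first_line in EE.
have A : velocity (fun s => F (pt2 s r)) = (fun y => push F y e1) \o (fun s => pt2 s r).
  by apply/funext => s' /=; rewrite push_first.
rewrite A; exact: esym EE.
Qed.

(** To differentiate velocities in a direction transverse to q one needs a surface
    through q: in a chart, the curve is translated along straight lines. *)
Lemma two_parameter_map (M : manifold R n) (q : R -> M) t (w : 'rV[R]_n) :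
  smooth_into_near q t -> exists F : 'rV[R]_2 -> M,
  [/\ smooth_into_near F (pt2 t 0), \forall s \near t, F (pt2 s 0) = q s &
      push F (pt2 t 0) e2 = w].
Proof.
move=> Hq; set k := chart_at (q t).
have ak : atlas k by exact: chart_at_atlas.
have dk : dom k (q t) by exact: chart_at_dom.
pose z := fwd k \o q; have Hz : smooth_near z t by exact: smooth_into_near_chart.
pose g (y : 'rV[R]_2) := z (y 0 0) + y 0 1 *: w.
have Hg : smooth_near g (pt2 t 0).
  apply: smooth_nearD.
    by apply: (@smooth_near_comp_time _ _ _ _ _ z); [exact: smooth_near_coord|rewrite pt2_00].
  by apply: smooth_near_scale; [exact: smooth_near_coord|exact: smooth_near_cst].
have g0 : g (pt2 t 0) = fwd k (q t) by rewrite /g pt2_00 pt2_01 scale0r addr0.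
have Hb : smooth_into_near (bwd k) (g (pt2 t 0)).
  by rewrite g0; apply: smooth_bwd => //; exact: fwd_cod.
exists (bwd k \o g); split.
- exact: smooth_into_near_precomp.
- apply: filterS (smooth_into_near_dom Hq dk) => s ds.
  by rewrite /= /g pt2_00 pt2_01 scale0r addr0 /z /= fwdK.
rewrite push_second (_ : (fun r => (bwd k \o g) (pt2 t r)) = (fun r => bwd k (r *: w + z t))).
  rewrite /velocity push_line scale0r add0r.
  by have E := push_bwdK w ak dk; rewrite in_chart_id in E; exact: E.
by apply/funext => r; rewrite /= /g pt2_00 pt2_01 addrC.
Qed.

End CoordinateLines.

Lemma eliminate_cross_terms (R : realType) (P Q A B C h k L : R) :
  P + Q = A + B - h * (C + k * L) ->
  Q + Q = B + B - (h * (C + k * - L) + h * (C + k * - L)) ->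
  P = A - 2 * k * h * L.
Proof. by move=> H1 H2; lra. Qed.

Lemma derive_sub_mul (R : realType) (V : normedModType R) (h a b c : V -> R) x z :
  (\forall y \near x, h y = a y - b y * c y) ->
  differentiable a x -> differentiable b x -> differentiable c x ->
  'D_z h x = 'D_z a x - (b x * 'D_z c x + c x * 'D_z b x).
Proof.
move=> hE da db dc; rewrite (near_eq_derive _ hE).
rewrite (@deriveB _ _ _ a (b * c)); [|exact: diff_derivable|exact/diff_derivable/differentiableM].
by rewrite deriveM//; exact: diff_derivable.
Qed.

Section Projection.
Context {R : realType} {kappa tau : R} {E : Ekt kappa tau}.
Local Notation e1 := (delta_mx 0 0 : 'rV[R]_2).
Local Notation e2 := (delta_mx 0 1 : 'rV[R]_2).
Local Notation proj := (Ekt_proj E).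

Lemma proj_smooth : smooth_map proj.
Proof. by case: (proj_submersion E). Qed.

Lemma smooth_into_near_cst (V : normedModType R) n (M : manifold R n) (p : M) (x : V) :
  smooth_into_near (fun=> p) x.
Proof.
apply: (@smooth_into_nearP _ _ _ _ _ x setT) => //; first exact: openT.
move=> y _; split; first exact: cvg_cst.
by exists (chart_at p); split; [exact: chart_at_atlas|exact: chart_at_dom|exact: smooth_near_cst].
Qed.

Lemma proj_flow s (p : E) : proj (flow s p) = proj p.
Proof.
have : range (flow^~ p) (flow s p) by exists s.
by rewrite -fibers.
Qed.

Lemma tmap_proj_xi (p : E) : tmap proj p (xi p) = 0.
Proof.
have Hq : smooth_into_near (fun s : R => flow s p) 0.
  by apply: smooth_flow_comp; [exact: smooth_near_idR|exact: smooth_into_near_cst].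
have := push_comp (1 : R) proj_smooth Hq.
have -> : push (fun s : R => flow s p) 0 (1 : R) = xi (flow 0 p) by exact: flow_xi.
rewrite flow0 => <-.
have nq : \forall s \near (0 : R), (proj \o (fun s : R => flow s p)) s = (fun=> proj p) s.
  by apply: filterE => s; rewrite /= proj_flow.
by rewrite (push_ext (1 : R) nq); exact: derive_cst.
Qed.

(** The differential is onto, hence has a line for kernel; this line contains xi,
    whose flow preserves the fibres. *)
Lemma tmap_proj_kernel (p : E) v : tmap proj p v = 0 -> exists a, v = a *: xi p.
Proof.
set L := jacobian (fwd (chart_at (proj p)) \o (proj \o bwd (chart_at p))) (fwd (chart_at p) p).
have tE u : tmap proj p u = u *m L.
  by rewrite tmapE; apply: deriveEjacobian; exact: tmap_diff proj_smooth.
have Lfull : row_full L.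
  have [_ _ surj _] := proj_submersion E.
  rewrite -sub1mx; apply/row_subP => i.
  have [u uE] := surj p (row i 1%:M); rewrite -uE tE; exact: submxMl.
have rk : \rank (kermx L) = 1%N.
  by rewrite mxrank_ker; move/eqP: Lfull => ->.
have xi0 : xi p != 0.
  apply/eqP => h; have := xi_unit p; rewrite h /inner bilin0l => /eqP.
  by rewrite eq_sym oner_eq0.
have xik : (xi p <= kermx L)%MS by apply/sub_kermxP; rewrite -tE tmap_proj_xi.
have kx : (kermx L <= xi p)%MS.
  by have [_ h] := mxrank_leqif_sup xik; rewrite -h rk rank_rV xi0.
by rewrite tE => /sub_kermxP vk; have /sub_rVP := submx_trans vk kx.
Qed.

(** Horizontal parts have the same image and are orthogonal to the kernel, where the
    submersion is isometric. *)
Lemma proj_metric (p : E) u v :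
  inner (proj p) (tmap proj p u) (tmap proj p v) =
    inner p u v - inner p u (xi p) * inner p v (xi p).
Proof.
have [_ _ _ iso] := proj_submersion E.
pose h u := u - inner p u (xi p) *: xi p.
have th w : tmap proj p (h w) = tmap proj p w.
  by rewrite /h -scaleNr tmapD ?tmapZ ?tmap_proj_xi ?scaler0 ?addr0//; exact: proj_smooth.
have hxi w : inner p (h w) (xi p) = 0.
  by rewrite /h innerDl innerNl innerZl xi_unit mulr1 subrr.
rewrite -(th u) -(th v) iso; last first.
  by move=> w /tmap_proj_kernel[a ->]; rewrite !innerZr !hxi mulr0.
rewrite {1}/h innerDl innerNl innerZl (innerC _ (xi p)) hxi mulr0 subr0.
by rewrite /h innerDr innerNr innerZr [_ * inner p u _]mulrC.
Qed.

(** On a surface F through q, the acceleration paired with w is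
    D_1 <F_1, F_2> - 1/2 D_2 <F_1, F_1>, upstairs as well as downstairs. The two
    metrics differ by the square of u |-> <u, xi>, and the exterior derivative of
    this 1-form is 2 tau <u x xi, w>: this is the additional term. *)
Lemma proj_acceleration (q : R -> E) t w : smooth_into_near q t ->
  inner (q t) w (xi (q t)) = 0 ->
  inner (proj (q t)) (cov_along (proj \o q) (velocity (proj \o q)) t 1) (tmap proj (q t) w) =
  inner (q t) (cov_along q (velocity q) t 1) w
  - 2 * tau * inner (q t) (velocity q t) (xi (q t))
    * inner (q t) (cross (q t) (velocity q t) (xi (q t))) w.
Proof.
move=> Hq w_hor; have [F [HF Fq Fw]] := two_parameter_map w Hq.
set x := pt2 t 0 in HF Fw.
have HpF : smooth_into_near (proj \o F) x by exact: smooth_map_comp proj_smooth HF.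
have Fx : F x = q t by exact: nbhs_singleton Fq.
have nE u v : \forall y \near x, inner ((proj \o F) y) (push (proj \o F) y u) (push (proj \o F) y v)
    = inner (F y) (push F y u) (push F y v)
      - inner (F y) (push F y u) ((xi \o F) y) * inner (F y) (push F y v) ((xi \o F) y).
  apply: filterS (smooth_into_near_nbhs HF) => y Hy.
  by rewrite !(push_comp _ proj_smooth Hy) [LHS]proj_metric.
have sp u := smooth_field_push u HF; have sx := smooth_field_xi HF.
have spp u := smooth_field_push u HpF.
have dS u v : differentiable (fun y => inner (F y) (push F y u) (push F y v)) x.
  exact: smooth_near_diff (smooth_near_inner HF (sp u) (sp v)).
have dX u : differentiable (fun y => inner (F y) (push F y u) ((xi \o F) y)) x.
  exact: smooth_near_diff (smooth_near_inner HF (sp u) sx).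
have I u v z := derive_inner z HF (sp u) (sp v).
have K u z := derive_inner z HF (sp u) sx.
have B u v z := derive_inner z HpF (spp u) (spp v).
have D u v z := derive_sub_mul z (nE u v) (dS u v) (dX u) (dX v).
have {I K B} DE u v z := etrans (esym (B u v z)) (etrans (D u v z)
  (congr2 (fun a b => a - b) (I u v z) (congr2 (fun a b => _ * a + _ * b) (K v z) (K u z)))).
have c1 : cov_along (proj \o F) (fun y => push (proj \o F) y e1) x e1 =
    cov_along (proj \o q) (velocity (proj \o q)) t 1.
  rewrite (cov_first_line HpF); have n1 : \forall s \near t, (proj \o F) (pt2 s 0) = (proj \o q) s.
    by apply: filterS Fq => s /= ->.
  exact: cov_along_ext n1 (near_push_ext (1 : R) n1).
have c2 : cov_along F (fun y => push F y e1) x e1 = cov_along q (velocity q) t 1.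
  rewrite (cov_first_line HF); exact: cov_along_ext Fq (near_push_ext (1 : R) Fq).
have v1 : push F x e1 = velocity q t.
  by rewrite /x push_first; exact: push_ext Fq.
have pw : push (proj \o F) x e2 = tmap proj (q t) w.
  by rewrite (push_comp e2 proj_smooth HF) Fw Fx.
have D11 := DE e1 e2 e1; have D12 := DE e1 e1 e2; clear DE.
rewrite (cov_push_sym e2 e1 HpF) (cov_push_sym e2 e1 HF) c1 c2 in D11.
have Fx' : (proj \o F) x = proj (q t) by rewrite /= Fx.
rewrite pw Fx' v1 Fw in D11.
have cx u : cov_along F (xi \o F) x u = tau *: cross (q t) (push F x u) (xi (q t)).
  by rewrite (cov_xi u HF) Fx.
have xF : (xi \o F) x = xi (q t) by rewrite /= Fx.
have s1 : inner (q t) w (cross (q t) (velocity q t) (xi (q t))) =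
    inner (q t) (cross (q t) (velocity q t) (xi (q t))) w by exact: innerC.
have s2 : inner (q t) (velocity q t) (cross (q t) w (xi (q t))) =
    - inner (q t) (cross (q t) (velocity q t) (xi (q t))) w.
  by rewrite innerC inner_cross_cycle cross_anti innerNl.
rewrite (cx e1) v1 Fx xF innerZr s1 w_hor mul0r addr0 in D11.
rewrite (cx e2) v1 Fx Fx' xF Fw innerZr s2 in D12.
have sB a b : inner (proj (q t)) a b = inner (proj (q t)) b a.
  by apply: bilinC; exact: Defs.metric_sym.
rewrite (sB (cov_along _ _ _ _)) (innerC _ (cov_along F _ _ _) (velocity q t)) in D12.
exact: (eliminate_cross_terms D11 D12).
Qed.

End Projection.

(** * The vertical cylinder *)

Lemma ord2_cases (i : 'I_2) : i = 0 \/ i = 1.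
Proof. by case: i => [[|[|]]] //= i; [left|right]; exact: val_inj. Qed.

Section FlatMetric.
Context {R : realType}.
Local Notation e1 := (delta_mx 0 0 : 'rV[R]_2).
Local Notation e2 := (delta_mx 0 1 : 'rV[R]_2).

Let bilin0m n (u v : 'rV[R]_n) : bilin 0 u v = 0.
Proof. by rewrite /bilin mulmx0 mul0mx mxE. Qed.

Lemma christoffel0r n (G : 'rV[R]_n -> 'M[R]_n) x u : christoffel G x u 0 = 0.
Proof.
rewrite /christoffel (_ : (\row_l _) = 0) ?mul0mx//; apply/rowP => l; rewrite !mxE.
by rewrite derive0 bilin0l bilin0r bilin0m subr0 addr0 mulr0.
Qed.

(** The Christoffel symbols with a lower index 2 vanish near x, and each term of the
    curvature contains one of them. *)
Lemma gauss_curvature_invariant (G : 'rV[R]_2 -> 'M[R]_2) x :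
  (\forall y \near x, [/\ differentiable G y, (G y)^T = G y, 'D_e2 G y = 0 &
    (G y) 1 1 = 1]) ->
  gauss_curvature G x = 0.
Proof.
move=> H; pose GoodG y := [/\ differentiable G y, 'D_e2 G y = 0, ('D_e1 G y)^T = 'D_e1 G y &
   ('D_e1 G y) 1 1 = 0].
have H2 : \forall y \near x, GoodG y.
  have HH : \forall y \near x, \forall z \near (y : 'rV[R]_2),
      [/\ differentiable G z, (G z)^T = G z, 'D_e2 G z = 0 & (G z) 1 1 = 1].
    exact: nbhs_interior.
  apply: filterS HH => y Hy; have [dG _ D2 _] := nbhs_singleton Hy; split=> //.
    by apply: derive_tr => //; apply: filterS Hy => z [].
  rewrite -derive_entry//.
  have n1 : \forall z \near y, (G z) 1 1 = (fun=> 1) z by apply: filterS Hy => z [].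
  by rewrite (near_eq_derive _ n1); exact: derive_cst.
have D0 y l : GoodG y -> l != 0 -> 'D_(delta_mx 0 l) G y = 0.
  case=> _ D2 _ _ l0; have -> : l = 1 by case: l l0 => [[|[|]]] //= i _; exact: val_inj.
  exact: D2.
have G22 y : GoodG y -> christoffel G y e2 e2 = 0.
  move=> Gy; have [_ D2 _ D11] := Gy; rewrite /christoffel (_ : (\row_l _) = 0) ?mul0mx//.
  apply/rowP => l; rewrite !mxE D2 !bilin0m; have [->|l0] := eqVneq l 0.
    by rewrite bilin_delta D11; ring.
  by rewrite (D0 y l Gy l0) bilin0m; ring.
have G12 y : GoodG y -> christoffel G y e1 e2 = 0.
  move=> Gy; have [_ D2 Ds D11] := Gy; rewrite /christoffel (_ : (\row_l _) = 0) ?mul0mx//.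
  apply/rowP => l; rewrite !mxE D2 !bilin0m; have [->|l0] := eqVneq l 0.
    by rewrite (bilinC _ _ Ds); move: (bilin _ _ _) => r; ring.
  have -> : l = 1 by case: l l0 => [[|[|]]] //= i _; exact: val_inj.
  by rewrite D2 bilin0m bilin_delta D11; ring.
have n22 : \forall y \near x, christoffel G y e2 e2 = (fun=> 0) y by apply: filterS H2.
have n12 : \forall y \near x, christoffel G y e1 e2 = (fun=> 0) y by apply: filterS H2.
rewrite /gauss_curvature /curvature (near_eq_derive _ n22) (near_eq_derive _ n12).
have d0 v : 'D_v (fun=> (0 : 'rV[R]_2)) x = 0 by exact: derive_cst.
rewrite !d0 (G22 _ (nbhs_singleton H2)) (G12 _ (nbhs_singleton H2)) !christoffel0r.
by rewrite subrr !addr0 subr0 bilin0l mul0r.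
Qed.

End FlatMetric.

Lemma smooth_into_near_precomp_time (R : realType) (V : normedModType R) n
    (M : manifold R n) (F : R -> M) (g : V -> R) x :
  smooth_near g x -> smooth_into_near F (g x) -> smooth_into_near (F \o g) x.
Proof.
move=> Hg HF; pose U := [set y | smooth_near g y /\ smooth_into_near F (g y)].
apply: (@smooth_into_nearP _ _ _ _ (F \o g) x (U^°)).
- exact: open_interior.
- have n1 := continuous_near (smooth_near_continuous Hg) (smooth_into_near_nbhs HF).
  by apply: filter_app n1; apply: filterS (smooth_near_nbhs Hg) => y ? ?; split.
move=> y /nbhs_singleton[gy Fy]; split.
  apply: continuous_comp; first exact: smooth_near_continuous.
  exact: smooth_into_near_continuous.
exists (chart_at (F (g y))); split; [exact: chart_at_atlas|exact: chart_at_dom|].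
exact: (smooth_near_comp_time gy (smooth_into_near_chart Fy (chart_at_atlas _) (chart_at_dom _))).
Qed.

Section Cylinder.
Context {R : realType} {kappa tau : R} {E : Ekt kappa tau}.
Variable gamma : R -> E.
Local Notation e1 := (delta_mx 0 0 : 'rV[R]_2).
Local Notation e2 := (delta_mx 0 1 : 'rV[R]_2).
Let P := vertical_cylinder gamma.
Let GP := pullback (@metric R 3 E) P.

Lemma smooth_cylinder t s : smooth_into_near gamma t -> smooth_into_near P (pt2 t s).
Proof.
move=> Hg; apply: smooth_flow_comp; first exact: smooth_near_coord.
apply: (@smooth_into_near_precomp_time _ _ _ _ gamma (fun y : 'rV[R]_2 => y 0 0)).
  exact: smooth_near_coord.
by rewrite pt2_00.
Qed.

Lemma cylinder_line t : (fun r => P (pt2 t r)) = flow^~ (gamma t).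
Proof. by apply/funext => r; rewrite /P /vertical_cylinder pt2_00 pt2_01. Qed.

Lemma cylinder_base : (fun s => P (pt2 s 0)) = gamma.
Proof. by apply/funext => s; rewrite /P /vertical_cylinder pt2_00 pt2_01 flow0. Qed.

Lemma push_cylinder_vertical : (fun y => push P y e2) = xi \o P.
Proof.
apply/funext => y; rewrite (pt2_entries y) push_second cylinder_line flow_xi.
by rewrite /= /P /vertical_cylinder pt2_00 pt2_01.
Qed.

Lemma push_cylinder_base t : push P (pt2 t 0) e1 = velocity gamma t.
Proof. by rewrite push_first cylinder_base. Qed.

Section AtTime.
Variable t : R.
Hypothesis gamma_smooth : smooth_into_near gamma t.

Let HP s := smooth_cylinder s gamma_smooth.

Let cov_first s : cov_along P (fun y => push P y e1) (pt2 t s) e2 =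
  tau *: cross (P (pt2 t s)) (push P (pt2 t s) e1) (xi (P (pt2 t s))).
Proof. by rewrite (cov_push_sym e1 e2 (HP s)) push_cylinder_vertical cov_xi. Qed.

Let push_vertical s : push P (pt2 t s) e2 = xi (P (pt2 t s)).
Proof. exact: (congr1 (fun f => f (pt2 t s)) push_cylinder_vertical). Qed.

Let constant_along (A : 'rV[R]_2 -> R) :
  (forall s, differentiable A (pt2 t s) /\ 'D_e2 A (pt2 t s) = 0) ->
  forall s, A (pt2 t s) = A (pt2 t 0).
Proof.
move=> HA s; apply: (@is_derive_0_is_cst _ (fun s => A (pt2 t s))) => r.
have E2 r' : pt2 t r' = r' *: e2 + t *: e1 by rewrite pt2E addrC.
have [dA D0] := HA r; rewrite E2 in dA D0.
rewrite (_ : (fun s => _) = (fun s => A (s *: e2 + t *: e1))); last first.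
  by apply/funext => r'; rewrite E2.
by rewrite -D0; exact: is_derive_line.
Qed.

(** The flow of xi is isometric: by torsion-freeness, the translated velocity v has
    derivative tau v x xi along the flow, which is orthogonal to v and to xi. *)
Lemma cylinder_metric_constant s : GP (pt2 t s) = GP (pt2 t 0).
Proof.
have s1 r := smooth_field_push e1 (HP r); have sx r := smooth_field_xi (HP r).
have A11 : inner (P (pt2 t s)) (push P (pt2 t s) e1) (push P (pt2 t s) e1) =
    inner (P (pt2 t 0)) (push P (pt2 t 0) e1) (push P (pt2 t 0) e1).
  apply: (@constant_along (fun y => inner (P y) (push P y e1) (push P y e1))) => r; split.
    exact: smooth_near_diff (smooth_near_inner (HP r) (s1 r) (s1 r)).
  rewrite (derive_inner e2 (HP r) (s1 r) (s1 r)) cov_first innerZl innerZr.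
  by rewrite inner_cross_l [inner _ _ (cross _ _ _)]innerC inner_cross_l !mulr0 addr0.
have A12 : inner (P (pt2 t s)) (push P (pt2 t s) e1) (xi (P (pt2 t s))) =
    inner (P (pt2 t 0)) (push P (pt2 t 0) e1) (xi (P (pt2 t 0))).
  apply: (@constant_along (fun y => inner (P y) (push P y e1) ((xi \o P) y))) => r; split.
    exact: smooth_near_diff (smooth_near_inner (HP r) (s1 r) (sx r)).
  rewrite (derive_inner e2 (HP r) (s1 r) (sx r)) cov_first cov_xi// innerZl innerZr.
  rewrite push_vertical inner_cross_r [inner _ _ (cross _ _ _)]innerC inner_cross_cycle.
  by rewrite inner_cross_l !mulr0 addr0.
have A21 : inner (P (pt2 t s)) (xi (P (pt2 t s))) (push P (pt2 t s) e1) =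
    inner (P (pt2 t 0)) (xi (P (pt2 t 0))) (push P (pt2 t 0) e1).
  by rewrite [LHS]innerC [RHS]innerC.
apply/matrixP => i j; rewrite /GP [LHS]mxE [RHS]mxE.
have [-> | ->] := ord2_cases i; have [-> | ->] := ord2_cases j; rewrite ?push_vertical.
- exact: A11.
- exact: A12.
- exact: A21.
- exact: etrans (xi_unit _) (esym (xi_unit _)).
Qed.

End AtTime.

Lemma cylinder_flat t s : smooth_into_near gamma t -> gauss_curvature GP (pt2 t s) = 0.
Proof.
move=> Hg; apply: gauss_curvature_invariant.
have n0 : \forall y \near pt2 t s, smooth_into_near gamma ((y : 'rV[R]_2) 0 0).
  have c0 := smooth_near_continuous (smooth_near_coord 0 0 (pt2 t s)).
  by apply: continuous_near c0 _; rewrite pt2_00; exact: smooth_into_near_nbhs.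
apply: filterS n0 => y Hy; rewrite (pt2_entries y); set a := y 0 0; set b := y 0 1.
have Ha : smooth_into_near gamma a by [].
split.
- exact: smooth_near_diff (smooth_pullback (smooth_cylinder b Ha)).
- exact: pullback_sym.
- rewrite pt2E addrC -derive_line.
  rewrite (_ : (fun r : R => GP (r *: e2 + a *: e1)) = (fun=> GP (pt2 a 0))).
    exact: derive_cst.
  by apply/funext => r; rewrite addrC -pt2E cylinder_metric_constant.
- rewrite mxE push_second cylinder_line flow_xi.
  by rewrite /P /vertical_cylinder pt2_00 pt2_01; exact: xi_unit.
Qed.

(** The cylinder induces its metric from E, so that its acceleration of the curve is
    the tangential part of the one in E. *)
Lemma cylinder_geodesic_curvature t : smooth_into_near gamma t ->
  let v := velocity gamma t in let X := cross (gamma t) (xi (gamma t)) v in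
  let unit := (vnorm (gamma t) X)^-1 *: cross (gamma t) v X in
  inner (gamma t) v v = 1 -> inner (gamma t) X X != 0 ->
  exists2 n, push P (pt2 t 0) n = unit &
    geodesic_curvature_is GP (fun u => pt2 u 0) t n
      (inner (gamma t) (cov_along gamma (velocity gamma) t 1) unit).
Proof.
move=> Hg v X unit v1 X0; set p := gamma t in v X unit v1 X0 *.
pose e := inner p v (xi p).
have HP := smooth_cylinder 0 Hg; set x := pt2 t 0 in HP *.
have Px : P x = p by rewrite /P /vertical_cylinder pt2_00 pt2_01 flow0.
have pe1 : push P x e1 = v by exact: push_cylinder_base.
have pe2 : push P x e2 = xi p.
  by have := congr1 (fun F => F x) push_cylinder_vertical; rewrite /= Px.
have XX : inner p X X = 1 - e ^+ 2.
  by rewrite inner_cross_cross xi_unit v1 (innerC _ (xi p)) -/e; ring.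
have XX_gt0 : 0 < inner p X X.
  by rewrite lt_def X0; exact: (posdef_ge0 X (metric_posdef p)).
have vX : cross p v X = xi p - e *: v.
  by rewrite cross_anti cross_crossE v1 (innerC _ (xi p)) -/e scale1r opprB.
pose r := (vnorm p X)^-1.
have r2 : r ^+ 2 * (1 - e ^+ 2) = 1.
  by rewrite -XX /r /vnorm exprVn sqr_sqrtr ?mulVf// ltW.
have dF : differentiable (fwd (chart_at (P x)) \o P) x.
  exact: smooth_near_diff (smooth_into_near_chart_at HP).
(* The unit normal is r (xi - e v), and e1, e2 are pushed to v and xi. *)
pose n := (- (r * e)) *: e1 + r *: e2.
have pn : push P x n = unit.
  rewrite /n /push (diff_deriveD _ _ dF) !(diff_deriveZ _ _ dF) -!/(push P x _) pe1 pe2.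
  by rewrite /unit -/r vX scalerBr addrC scaleNr scalerA.
have GE a b : bilin (GP x) a b = inner p (push P x a) (push P x b).
  by rewrite (nbhs_singleton (near_pullback HP)) Px.
have uu : inner p unit unit = 1.
  rewrite /unit -/r vX innerZl innerZr innerDl !innerDr !innerNl !innerNr !innerZl !innerZr.
  by rewrite xi_unit v1 (innerC _ (xi p)) -/e -[RHS]r2; ring.
have uv : inner p unit v = 0.
  by rewrite /unit -/r innerZl inner_cross_l mulr0.
have dz : 'D_1 (fun u : R => pt2 u 0) t = e1 by exact: derive_first_line.
have GPu : GP x \in unitmx.
  rewrite unitmxE unitfE det_mx22 -!bilin_delta !GE pe1 pe2 v1 xi_unit (innerC _ (xi p)) -/e.
  by rewrite mul1r -expr2 -XX.
have Hz : smooth_near (fun u : R => pt2 u 0) t.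
  by apply: smooth_near_pt2; [exact: smooth_near_idR|exact: smooth_near_cst].
have Q : bilin (GP x) e1 e1 = 1 by rewrite GE pe1.
have Pz : P \o (fun u => pt2 u 0) = gamma by exact: cylinder_base.
have E1 := etrans (bilin_acceleration (z := fun u => pt2 u 0) n GPu
  (smooth_near_diff (smooth_pullback HP))) (pullback_euler_lagrange n Hz HP).
rewrite Pz -/x Px pn in E1.
exists n; first exact: pn.
split.
- by rewrite dz; apply/eqP => /rowP/(_ 0); rewrite !mxE /= => /eqP; rewrite oner_eq0.
- by rewrite [LHS]GE pn uu.
- by rewrite dz [LHS]GE pn pe1 uv.
by rewrite dz -/x Q divr1 E1.
Qed.

End Cylinder.

(** * Lifting a curve of the unit circle to an angle *)

Section AngleLift.
Context {R : realType}.

Lemma primitive_exists (w : R -> R) (p u : R) : p < u ->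
  (forall x, p <= x <= u -> {for x, continuous w}) ->
  exists F : R -> R, forall x, p < x < u -> is_derive x 1 F (w x).
Proof.
move=> pu cw; pose F x := (\int[lebesgue_measure]_(t in [set` `[p, x]]) w t)%R.
exists F => x /andP[px xu].
have iw : lebesgue_measure.-integrable [set` `[p, u]] (EFin \o w).
  apply: continuous_compact_integrable; first exact: segment_compact.
  apply: continuous_in_subspaceT => y; rewrite inE /= in_itv /=.
  exact: cw.
have cx : {for x, continuous w} by apply: cw; rewrite !ltW.
have [dF DF] := continuous_FTC1_closed xu iw px cx.
by rewrite -DF derive1E; apply: DeriveDef.
Qed.

Lemma smooth_primitive (F w : R -> R) (I : set R) : open I ->
  (forall x, I x -> is_derive x 1 F (w x)) -> smooth_on I w -> smooth_on I F.
Proof.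
move=> oI dF sw.
have DF x : I x -> differentiable F x by move=> /dF [? _]; exact/derivable1_diffP.
case=> [|k]; first by move=> x Ix; apply: differentiable_continuous; exact: DF.
split=> // v; apply: (contDiff_ext oI _ (contDiffZ v oI (sw k))) => x Ix.
have [_ <-] := dF x Ix.
by rewrite -(diff_deriveZ v (1 : R) (DF x Ix)) [v *: 1]mulr1.
Qed.

Lemma angle_exists (x y : R) : x ^+ 2 + y ^+ 2 = 1 -> exists t, cos t = x /\ sin t = y.
Proof.
move=> xy; have x1 : -1 <= x <= 1.
  by rewrite -ler_norml -(@expr_le1 _ 2)// -normrX ger0_norm ?sqr_ge0// -xy lerDl sqr_ge0.
have x1' : x \in `[(-1), 1]%R by rewrite in_itv.
have s : sin (acos x) = `|y| by rewrite sin_acos// -xy addrAC subrr add0r sqrtr_sqr.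
have [y0|y0] := leP 0 y.
  by exists (acos x); rewrite acosK// s ger0_norm.
by exists (- acos x); rewrite cosN sinN acosK// s ltr0_norm// opprK.
Qed.

Lemma near_segment_interval (U : set R) (l : R) : 0 < l -> open U -> `[0, l]%classic `<=` U ->
  exists2 e : R, 0 < e & forall x, - e <= x <= l + e -> U x.
Proof.
move=> l0 oU lU.
have U0 : U 0 by apply: lU; rewrite /= in_itv/= lexx ltW.
have Ul : U l by apply: lU; rewrite /= in_itv/= lexx ltW.
have /nbhs_ballP[e0 /= e00 b0] := open_near oU U0.
have /nbhs_ballP[e1 /= e10 b1] := open_near oU Ul.
exists (Num.min e0 e1 / 2); first by rewrite divr_gt0// lt_min e00 e10.
have m0 : Num.min e0 e1 <= e0 by rewrite ge_min lexx.
have m1 : Num.min e0 e1 <= e1 by rewrite ge_min lexx orbT.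
move: (Num.min e0 e1) m0 m1 => m m0 m1 x /andP[xm xl].
have [x0|x0] := ltP x 0.
  by apply: b0; rewrite /ball /= sub0r normrN ltr0_norm//; lra.
have [lx|lx] := ltP l x.
  by apply: b1; rewrite /ball /= distrC ger0_norm ?subr_ge0 ?ltW//; lra.
by apply: lU; rewrite /= in_itv/= x0 lx.
Qed.

(** The angle is a primitive of the angular speed a b' - b a'; once it is right at 0,
    its difference with the angle of (a, b) stays zero. *)
Lemma angle_lift (a b : R -> R) (U : set R) (l : R) : 0 < l -> open U -> `[0, l]%classic `<=` U ->
  smooth_on U a -> smooth_on U b ->
  (forall s, 0 <= s <= l -> a s ^+ 2 + b s ^+ 2 = 1) ->
  exists2 vt, smooth_segment l vt &
    forall s, 0 <= s <= l -> a s = cos (vt s) /\ b s = sin (vt s).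
Proof.
move=> l0 oU lU sa sb ab1.
have na x : U x -> smooth_near a x by move=> Ux; exists U.
have nb x : U x -> smooth_near b x by move=> Ux; exists U.
pose w x := a x * 'D_1 b x - b x * 'D_1 a x.
have nw x : U x -> smooth_near w x.
  move=> Ux; apply: smooth_nearB; apply: smooth_nearM; try exact: na; try exact: nb.
    by apply: smooth_near_derive; exact: nb.
  by apply: smooth_near_derive; exact: na.
have [e e0 eU] := near_segment_interval l0 oU lU.
have [||F dF] := @primitive_exists w (- e) (l + e).
- by rewrite (@lt_trans _ _ 0)// ?oppr_lt0// addr_gt0.
- by move=> x /eU /nw; exact: smooth_near_continuous.
have [t0 [ct0 st0]] := angle_exists (ab1 0 ltac:(by rewrite lexx ltW)).
pose vt x := F x + (t0 - F 0).
pose I : set R := `](- e), (l + e)[%classic.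
have oI : open I by exact: interval_open.
have inI x : I x -> - e < x < l + e by rewrite /I /= in_itv.
have IU x : I x -> U x by move=> /inI /andP[h1 h2]; apply: eU; rewrite !ltW.
have lI x : 0 <= x <= l -> I x.
  by move=> /andP[x0 xl]; rewrite /I /= in_itv /=; apply/andP; split; lra.
have dvt x : I x -> is_derive x 1 vt (w x).
  move=> Ix; rewrite -[w x]addr0; apply: is_deriveD; first by apply: dF; exact: inI.
exists vt.
  exists I; first by split=> // x; rewrite /= in_itv/=; exact: lI.
  apply: (smooth_primitive oI dvt); apply: smooth_near_on => x Ix; exact/nw/IU.
have vt0 : vt 0 = t0 by rewrite /vt addrC subrK.
have da x : 0 <= x <= l -> differentiable a x by move=> h; exact/smooth_near_diff/na/IU/lI.
have db x : 0 <= x <= l -> differentiable b x by move=> h; exact/smooth_near_diff/nb/IU/lI.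
have dv x : 0 <= x <= l -> differentiable vt x.
  by move=> h; apply/derivable1_diffP; have [] := dvt x (lI x h).
have dcos x : differentiable (@cos R) x.
  by apply/derivable1_diffP; have [] := is_derive_cos x.
have dsin x : differentiable (@sin R) x.
  by apply/derivable1_diffP; have [] := is_derive_sin x.
have dc x : 0 <= x <= l -> differentiable (fun s => cos (vt s)) x.
  by move=> h; exact: (differentiable_comp (dv x h) (dcos _)).
have ds x : 0 <= x <= l -> differentiable (fun s => sin (vt s)) x.
  by move=> h; exact: (differentiable_comp (dv x h) (dsin _)).
have Dc x : 0 <= x <= l -> 'D_1 (fun s => cos (vt s)) x = w x * - sin (vt x).
  move=> h; rewrite (derive_comp_real (1 : R) (dv x h) (dcos _)).
  have [_ ->] := dvt x (lI x h); by have [_ ->] := is_derive_cos (vt x).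
have Ds x : 0 <= x <= l -> 'D_1 (fun s => sin (vt s)) x = w x * cos (vt x).
  move=> h; rewrite (derive_comp_real (1 : R) (dv x h) (dsin _)).
  have [_ ->] := dvt x (lI x h); by have [_ ->] := is_derive_sin (vt x).
have key x : 0 <= x <= l -> 'D_1 a x = - (b x * w x) /\ 'D_1 b x = a x * w x.
  move=> h; have := derive_cst_on_segment l0 h _ ab1.
  have dd : differentiable (a * a + b * b) x.
    by apply: differentiableD; apply: differentiableM; try exact: da; exact: db.
  have -> : (fun s => a s ^+ 2 + b s ^+ 2) = a * a + b * b.
    by apply/funext => s; rewrite !fctE !expr2.
  move=> /(_ dd); rewrite deriveD; [|apply: derivableM; exact/diff_derivable/da|apply: derivableM; exact/diff_derivable/db].
  rewrite !deriveM; [|exact/diff_derivable/db|exact/diff_derivable/db|exact/diff_derivable/da|exact/diff_derivable/da].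
  have := ab1 x h; rewrite /w /GRing.scale /=.
  move: ('D_1 a x) ('D_1 b x) (a x) (b x) => a' b' p q H1 H2.
  have H3 : p * a' + q * b' = 0 by lra.
  split.
    have -> : - (q * (p * b' - q * a')) = a' * (p ^+ 2 + q ^+ 2) - p * (p * a' + q * b') by ring.
    by rewrite H1 H3; ring.
  have -> : p * (p * b' - q * a') = b' * (p ^+ 2 + q ^+ 2) - q * (p * a' + q * b') by ring.
  by rewrite H1 H3; ring.
have cst (g : R -> R) : (forall x, 0 <= x <= l -> is_derive x 1 g 0) ->
    forall s, 0 <= s <= l -> g s = g 0.
  move=> dg s /andP[s0 sl]; have [->//|s_neq0] := eqVneq s 0.
  have [||c _ /eqP] := @MVT_open_closed _ g (fun=> 0) s.
  - by rewrite lt_neqAle eq_sym s_neq0.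
  - by move=> x /andP[x0 xs]; apply: dg; rewrite x0 (le_trans xs).
  by rewrite mul0r subr_eq0 => /eqP.
(* The cosine and the sine of the difference between the angle of (a, b) and vt. *)
pose g1 := a * (fun s => cos (vt s)) + b * (fun s => sin (vt s)).
pose g2 := b * (fun s => cos (vt s)) - a * (fun s => sin (vt s)).
have G1 : forall s, 0 <= s <= l -> g1 s = g1 0.
  apply: cst => x h; have [Ka Kb] := key x h.
  apply: (@is_derive_eq _ _ _ _ _ _ _ _ (is_deriveD (is_deriveM
    (derivableP (diff_derivable (da x h))) (derivableP (diff_derivable (dc x h))))
    (is_deriveM (derivableP (diff_derivable (db x h))) (derivableP (diff_derivable (ds x h)))))).
  rewrite (Dc x h) (Ds x h) Ka Kb /GRing.scale /=.
  by move: (cos _) (sin _) (w x) => ? ? ?; ring.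
have G2 : forall s, 0 <= s <= l -> g2 s = g2 0.
  apply: cst => x h; have [Ka Kb] := key x h.
  apply: (@is_derive_eq _ _ _ _ _ _ _ _ (is_deriveB (is_deriveM
    (derivableP (diff_derivable (db x h))) (derivableP (diff_derivable (dc x h))))
    (is_deriveM (derivableP (diff_derivable (da x h))) (derivableP (diff_derivable (ds x h)))))).
  rewrite (Dc x h) (Ds x h) Ka Kb /GRing.scale /=.
  by move: (cos _) (sin _) (w x) => ? ? ?; ring.
move=> s h; have := G1 s h; have := G2 s h; rewrite /g1 /g2 !fctE vt0 ct0 st0.
have := cos2Dsin2 (vt s); have := ab1 0 ltac:(by rewrite lexx ltW).
move: (a s) (b s) (a 0) (b 0) (cos _) (sin _) => p q p0 q0 x y H1 H2 H3 H4.
have H3' : q * x - p * y = 0 by rewrite H3; ring.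
have H4' : p * x + q * y = 1 by rewrite -H1 H4; ring.
split.
  have -> : p = x * (p * x + q * y) - y * (q * x - p * y) + p * (1 - (x ^+ 2 + y ^+ 2)) by ring.
  by rewrite H3' H4' H2; ring.
have -> : q = y * (p * x + q * y) + x * (q * x - p * y) + q * (1 - (x ^+ 2 + y ^+ 2)) by ring.
by rewrite H3' H4' H2; ring.
Qed.

End AngleLift.

(** * The conjugate curve *)

Section ProjectedCurve.
Context {R : realType} {kappa tau : R} {E : Ekt kappa tau}.
Variables (q : R -> E) (t : R).
Hypothesis q_smooth : smooth_into_near q t.
Let v := velocity q t.
Hypothesis v_unit : inner (q t) v v = 1.
Let X := cross (q t) (xi (q t)) v.
Let alpha := Ekt_proj E \o q.

Let alpha_smooth : smooth_into_near alpha t.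
Proof. exact: smooth_map_comp proj_smooth q_smooth. Qed.

Let velocity_alpha : velocity alpha t = tmap (Ekt_proj E) (q t) v.
Proof. exact: (push_comp (1 : R) proj_smooth q_smooth). Qed.

Lemma inner_xi_cross : inner (q t) X X = 1 - inner (q t) v (xi (q t)) ^+ 2.
Proof. by rewrite inner_cross_cross xi_unit v_unit (innerC _ (xi _)); ring. Qed.

Lemma projected_speed : inner (alpha t) (velocity alpha t) (velocity alpha t) = inner (q t) X X.
Proof. by rewrite velocity_alpha inner_xi_cross [LHS]proj_metric v_unit expr2. Qed.

Lemma projected_regular : velocity alpha t != 0 <-> inner (q t) X X != 0.
Proof.
rewrite -projected_speed; split; last first.
  by apply: contra => /eqP ->; rewrite /inner bilin0l.
by move=> /(metric_posdef (alpha t)) h; rewrite gt_eqF.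
Qed.

(** The normal of the projection is the image of the horizontal unit vector Z, so
    that [proj_acceleration] computes the acceleration of the projection along it. *)
Lemma projected_curvature : inner (q t) X X != 0 ->
  let Z := (vnorm (q t) X)^-1 *: X in
  curve_curvature_is alpha t (tmap (Ekt_proj E) (q t) Z)
    ((inner (q t) (cov_along q (velocity q) t 1) Z
      + 2 * tau * inner (q t) v (xi (q t)) * vnorm (q t) X) / inner (q t) X X).
Proof.
move=> X0 Z; have XX_gt0 : 0 < inner (q t) X X.
  by rewrite lt_def X0; exact: (posdef_ge0 X (metric_posdef (q t))).
have n0 : vnorm (q t) X != 0 by rewrite /vnorm gt_eqF// sqrtr_gt0.
have n2 : vnorm (q t) X ^+ 2 = inner (q t) X X by rewrite /vnorm sqr_sqrtr// ltW.
have Zxi : inner (q t) Z (xi (q t)) = 0 by rewrite /Z innerZl inner_cross_l mulr0.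
have Zv : inner (q t) Z v = 0 by rewrite /Z innerZl inner_cross_r mulr0.
have ZX : inner (q t) X Z = vnorm (q t) X.
  by rewrite /Z innerZr -n2; field.
have ZZ : inner (q t) Z Z = 1 by rewrite {1}/Z innerZl ZX mulVf.
have GE a b : bilin (chart_metric (alpha t) ((fwd (chart_at (alpha t)) \o alpha) t)) a b =
    inner (alpha t) a b.
  by have := chart_metric_at (alpha t) => h; rewrite [X in bilin X _ _]h.
have acc := proj_acceleration q_smooth Zxi.
split.
- exact: (projected_regular.2 X0).
- by rewrite [LHS]GE [LHS]proj_metric Zxi ZZ mul0r subr0.
- rewrite [LHS]GE; have := velocity_alpha; rewrite /velocity /push => ->.
  by rewrite [LHS]proj_metric Zxi Zv mul0r subr0.
have sp : bilin (chart_metric (alpha t) ((fwd (chart_at (alpha t)) \o alpha) t))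
    ('D_1 (fwd (chart_at (alpha t)) \o alpha) t) ('D_1 (fwd (chart_at (alpha t)) \o alpha) t)
    = inner (q t) X X by rewrite GE; exact: projected_speed.
rewrite sp GE; rewrite (cov_velocity alpha_smooth) in acc.
rewrite [X in _ = X / _]acc; congr (_ / _).
have -> : inner (q t) (cross (q t) (velocity q t) (xi (q t))) Z = - vnorm (q t) X.
  by rewrite cross_anti innerNl ZX.
by rewrite mulrN opprK.
Qed.

End ProjectedCurve.

Lemma powR_half (R : realType) (x : R) : 0 < x -> x `^ (1 / 2) = Num.sqrt x.
Proof. by move=> x0; rewrite div1r powR12_sqrt// ltW. Qed.

Lemma powR_three_halves (R : realType) (x : R) : 0 < x -> x `^ (3 / 2) = x * Num.sqrt x.
Proof.
move=> x0; have -> : 3 / 2 = 1 + 2^-1 :> R by field.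
by rewrite powRD ?gt_eqF ?implybT// powRr1 ?ltW// powR12_sqrt// ltW.
Qed.

Unset Implicit Arguments.
Set Strict Implicit.
Set Printing Implicit Defensive.

Theorem lemma5p2 (R : realType) (kappa tau H kappat taut theta l : R)
    (E : Ekt kappa tau) (Et : Ekt kappat taut) (S : riemannian R 2)
    (ft : S -> Et) (Nt : S -> 'rV[R]_3) (dt : fund_data S)
    (f : S -> E) (N : S -> 'rV[R]_3) (d : fund_data S)
    (c : R -> S)
    (theta_range : 0 <= theta < pi)
    (S_oriented : oriented S)
    (S_simply_conn : simply_conn R S)
    (ft_minimal : H_immersion ft Nt dt 0)
    (f_H : H_immersion f N d H)
    (parameters : sister_parameters kappa tau H kappat taut 0 theta)
    (sisters : sister_data d dt H 0 theta)
    (l_gt0 : 0 < l)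
    (c_smooth : smooth_curve_segment l c)
    (ft_c_geodesic : forall t : R, 0 <= t <= l -> geodesic_at (ft \o c) t)
    (ft_c_unit : forall t : R, 0 <= t <= l ->
      inner (ft (c t)) (velocity (ft \o c) t) (velocity (ft \o c) t) = 1)
    (ft_c_horizontal : forall t : R, 0 <= t <= l ->
      inner (ft (c t)) (velocity (ft \o c) t) (xi (ft (c t))) = 0) :
  let gammat := ft \o c in
  let gamma := f \o c in
  let alpha := Ekt_proj E \o gamma in
  let is_normal_angle (vt : R -> R) := forall t : R, 0 <= t <= l ->
    Nt (c t) =
      cos (vt t) *: cross (gammat t) (xi (gammat t)) (velocity gammat t)
      + sin (vt t) *: xi (gammat t) in
  let nu t := dnu d (c t) in
  let D t := cos theta ^+ 2 + nu t ^+ 2 * sin theta ^+ 2 in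
  let xixg t := cross (gamma t) (xi (gamma t)) (velocity gamma t) in
  let unit_xixg t := (vnorm (gamma t) (xixg t))^-1 *: xixg t in
  let P := vertical_cylinder gamma in
  let GP := pullback (@metric R 3 E) P in
  (exists2 vt, smooth_segment l vt & is_normal_angle vt) /\
  forall vt : R -> R, smooth_segment l vt -> is_normal_angle vt ->
  [/\ (* (a) *)
      forall t : R, 0 <= t <= l ->
        inner (gamma t) (velocity gamma t) (xi (gamma t))
        = sin theta * cos (vt t),
      (* (b) *)
      forall t : R, 0 <= t <= l ->
        (velocity alpha t != 0 <-> D t != 0) /\
        (D t != 0 ->
         curve_curvature_is alpha t
           (tmap (Ekt_proj E) (gamma t) (unit_xixg t))
           ((2 * tau * D t - 'D_1 vt t * cos theta) * sin theta * cos (vt t)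
            / D t `^ (3 / 2))) &
      (* (c) *)
      Ekt_proj E @^-1` (alpha @` `[0, l])
        = [set P (pt2 t s) | t in `[0, l] & s in setT] /\
      forall t : R, 0 <= t <= l -> velocity alpha t != 0 ->
        [/\ forall s : R, gauss_curvature GP (pt2 t s) = 0,
            exists2 n, push P (pt2 t 0) n
                = (vnorm (gamma t) (xixg t))^-1
                  *: cross (gamma t) (velocity gamma t) (xixg t) &
              geodesic_curvature_is GP (fun u => pt2 u 0) t n
                (- ('D_1 vt t * sin (vt t) * sin theta / D t `^ (1 / 2))) &
            inner (gamma t) (N (c t)) (unit_xixg t)
            = cos theta * cos (vt t) / D t `^ (1 / 2)]].
Proof.
move=> gammat gamma alpha is_normal_angle nu D xixg unit_xixg P GP.
have fS : smooth_map f by case: f_H => -[].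
have ftS : smooth_map ft by case: ft_minimal => -[].
have f_iso p u v : inner (f p) (tmap f p u) (tmap f p v) = inner p u v.
  by case: f_H => -[_ h] _ _ _; exact: h.
have ft_iso p u v : inner (ft p) (tmap ft p u) (tmap ft p v) = inner p u v.
  by case: ft_minimal => -[_ h] _ _ _; exact: h.
have [U [oU lU] cU] := c_smooth.
have inU t : 0 <= t <= l -> U t by move=> h; apply: lU; rewrite /= in_itv.
have cS t : U t -> smooth_into_near c t by move=> Ut; exists U.
have gS t : U t -> smooth_into_near gammat t by move=> /cS; exact: smooth_map_comp.
have NS t : U t -> smooth_field gammat (Nt \o c) t.
  move=> /cS Hc; apply: smooth_field_along => //.
  by case: ft_minimal => _ [].
have vt_c t : U t -> velocity gammat t = tmap ft (c t) (velocity c t).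
  by move=> /cS Hc; exact: (push_comp (1 : R) ftS Hc).
have Nt1 p : inner (ft p) (Nt p) (Nt p) = 1 by case: ft_minimal => _ [].
have Ntv p v : inner (ft p) (tmap ft p v) (Nt p) = 0 by case: ft_minimal => _ [].
(* W and xi span the normal plane of the horizontal geodesic. *)
pose W t := cross (gammat t) (xi (gammat t)) (velocity gammat t).
split.
  pose a t := inner (gammat t) ((Nt \o c) t) (W t).
  pose b t := inner (gammat t) ((Nt \o c) t) ((xi \o gammat) t).
  have sW t : U t -> smooth_field gammat W t.
    move=> Ut; apply: smooth_field_cross; first exact: Ekt_oriented.
    - exact: gS.
    - exact: smooth_field_xi (gS t Ut).
    - exact: smooth_field_push (gS t Ut).
  have sa : smooth_on U a.
    by apply: smooth_near_on => t Ut; exact: smooth_near_inner (gS t Ut) (NS t Ut) (sW t Ut).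
  have sb : smooth_on U b.
    apply: smooth_near_on => t Ut.
    exact: smooth_near_inner (gS t Ut) (NS t Ut) (smooth_field_xi (gS t Ut)).
  have N_exp t : 0 <= t <= l -> Nt (c t) = a t *: W t + b t *: xi (gammat t).
    move=> h; have xv : inner (gammat t) (xi (gammat t)) (velocity gammat t) = 0.
      by rewrite innerC; exact: ft_c_horizontal.
    have := orthonormal_expansion (Defs.metric_sym (gammat t)) (metric_posdef (gammat t))
      (Nt (c t)) (xi_unit (gammat t)) (ft_c_unit t h) xv.
    rewrite [X in _ + X *: velocity _ _](_ : _ = 0); last first.
      by rewrite bilinC ?Defs.metric_sym// (vt_c t (inU t h)); exact: Ntv.
    by rewrite scale0r addr0.
  have ab1 t : 0 <= t <= l -> a t ^+ 2 + b t ^+ 2 = 1.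
    move=> h.
    have NN : inner (gammat t) (a t *: W t + b t *: xi (gammat t)) (Nt (c t)) = 1.
      by rewrite -(N_exp t h); exact: Nt1.
    rewrite innerDl !innerZl in NN; rewrite -NN !expr2.
    have aE : inner (gammat t) (W t) (Nt (c t)) = a t by exact: innerC.
    have bE : inner (gammat t) (xi (gammat t)) (Nt (c t)) = b t by exact: innerC.
    by rewrite aE bE.
  have [vt svt vtE] := angle_lift l_gt0 oU lU sa sb ab1.
  exists vt => // t h; have [<- <-] := vtE t h; exact: N_exp.
move=> vt [I [oI lI] sI] vt_angle.
have vtd t : 0 <= t <= l -> differentiable vt t.
  by move=> h; apply: (sI 1%N).1; apply: lI; rewrite /= in_itv.
have gH t : U t -> smooth_into_near gamma t by move=> /cS; exact: smooth_map_comp.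
have v_c t : U t -> velocity gamma t = tmap f (c t) (velocity c t).
  by move=> /cS Hc; exact: (push_comp (1 : R) fS Hc).
have w1 t : 0 <= t <= l -> inner (c t) (velocity c t) (velocity c t) = 1.
  move=> h; rewrite -ft_iso -(vt_c t (inU t h)); exact: ft_c_unit.
have geot t : 0 <= t <= l -> cov_along gammat (velocity gammat) t 1 = 0.
  by move=> h; rewrite (cov_velocity (gS t (inU t h))); exact: ft_c_geodesic.
(* Being a geodesic of the surface is an intrinsic property, hence common to both
   immersions. *)
have geoS t : 0 <= t <= l -> forall v, inner (c t) (cov_along c (velocity c) t 1) v = 0.
  move=> h v; rewrite -(isometric_acceleration v ftS ft_iso (cS t (inU t h))).
  by rewrite [cov_along _ _ _ _](geot t h) /inner bilin0l.
have covN t : 0 <= t <= l ->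
    cov_along gammat (Nt \o c) t 1 = cov_normal ft Nt (c t) (velocity c t).
  move=> h; apply: (cov_along_map (1 : R) ftS _ (cS t (inU t h))).
  by case: ft_minimal => _ [].
have angle t : 0 <= t <= l -> (Nt \o c) t = cos (vt t) *: W t + sin (vt t) *: xi (gammat t).
  exact: vt_angle.
have point t : 0 <= t <= l ->
    [/\ dnu d (c t) = sin (vt t),
        inner (gamma t) (velocity gamma t) (xi (gamma t)) = sin theta * cos (vt t),
        inner (gamma t) (cross (gamma t) (N (c t)) (velocity gamma t)) (xi (gamma t))
          = - (cos theta * cos (vt t)) &
        inner (c t) (velocity c t) (velocity c t *m dA d (c t)) = - 'D_1 vt t * sin theta].
  move=> h; have Ut := inU t h.
  have K1 := cov_normal_velocity l_gt0 h (gS t Ut) (NS t Ut) (geot t h) ft_c_horizontal angle.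
  have K2 := cov_normal_xi l_gt0 h (gS t Ut) (NS t Ut) (vtd t h) ft_c_unit ft_c_horizontal angle.
  have K3 := cov_normal_cross l_gt0 h (gS t Ut) (NS t Ut) (vtd t h) ft_c_unit ft_c_horizontal angle.
  rewrite (covN t h) in K1 K2 K3; rewrite (v_c t Ut).
  have u1 := ft_c_unit t h; have u2 := ft_c_horizontal t h; have u3 := vt_angle t h.
  rewrite (vt_c t Ut) in K1 K2 K3 u1 u2 u3.
  split.
  - exact: (sister_angle ft_minimal sisters u3).
  - exact: (sister_velocity_xi ft_minimal f_H sisters u1 u2 u3).
  - exact: (sister_rotated_xi ft_minimal f_H sisters u1 u2 u3).
  - exact: (sister_shape ft_minimal parameters sisters u1 u2 u3 K1 K2 K3).
have v1 t : 0 <= t <= l -> inner (gamma t) (velocity gamma t) (velocity gamma t) = 1.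
  by move=> h; rewrite (v_c t (inU t h)) f_iso w1.
have acc t : 0 <= t <= l -> cov_along gamma (velocity gamma) t 1 =
    (- 'D_1 vt t * sin theta) *: N (c t).
  move=> h; have [_ _ _ <-] := point t h.
  exact: (geodesic_acceleration_normal f_H (cS t (inU t h)) (w1 t h) (geoS t h)).
have XX t : 0 <= t <= l -> inner (gamma t) (xixg t) (xixg t) = D t.
  move=> h; rewrite (inner_xi_cross (v1 t h)); have [nuE -> _ _] := point t h.
  rewrite /D /nu nuE -(cos2Dsin2 theta) -[sin theta ^+ 2 in LHS]mulr1 -(cos2Dsin2 (vt t)).
  move: (sin theta) (cos (vt t)) (sin (vt t)) (cos theta) => s1 c1 s2 c2.
  by ring.
have vnormE t : 0 <= t <= l -> vnorm (gamma t) (xixg t) = Num.sqrt (D t).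
  by move=> h; rewrite /vnorm XX.
have D_ge0 t : 0 <= D t by apply: addr_ge0; [exact: sqr_ge0|apply: mulr_ge0; exact: sqr_ge0].
have D_gt0 t : D t != 0 -> 0 < D t by move=> D0; rewrite lt_def D0 D_ge0.
have NX t : 0 <= t <= l -> inner (gamma t) (N (c t)) (xixg t) = cos theta * cos (vt t).
  move=> h; have [_ _ H3 _] := point t h.
  by rewrite innerC inner_cross_cycle cross_anti innerNl H3 opprK.
have regular t : 0 <= t <= l -> velocity alpha t != 0 <-> D t != 0.
  by move=> h; rewrite -(XX t h); exact: (projected_regular (gH t (inU t h)) (v1 t h)).
have angleE t : 0 <= t <= l -> D t != 0 ->
    inner (gamma t) (N (c t)) (unit_xixg t) = cos theta * cos (vt t) / D t `^ (1 / 2).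
  move=> h D0; rewrite /unit_xixg innerZr NX// vnormE// powR_half ?D_gt0//.
  by rewrite mulrC.
split.
- by move=> t h; have [] := point t h.
- move=> t h; split; first exact: regular.
  move=> D0; have Dt := D_gt0 t D0; have sq : Num.sqrt (D t) != 0 by rewrite gt_eqF// sqrtr_gt0.
  have X0 : inner (gamma t) (xixg t) (xixg t) != 0 by rewrite XX.
  have := projected_curvature (gH t (inU t h)) (v1 t h) X0.
  have [_ vxi _ _] := point t h.
  cbv zeta; rewrite -/(xixg t) -/(unit_xixg t) (acc t h) innerZl (angleE t h D0) vxi (vnormE t h) (XX t h).
  rewrite powR_half// powR_three_halves//.
  set k := (X in curve_curvature_is _ _ _ X -> _); set k' := (X in _ -> curve_curvature_is _ _ _ X).
  suff -> : k = k' by [].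
  have DD : D t = Num.sqrt (D t) ^+ 2 by rewrite sqr_sqrtr ?ltW.
  rewrite /k /k'; move: sq DD; move: (Num.sqrt (D t)) => r; move: (D t) => dd r0 ->.
  by move: ('D_1 vt t) (sin theta) (cos theta) (cos (vt t)) => b x y z; field.
split.
  apply/seteqP; split=> [p [t tl tE]|p [t tl [s _ <-]]].
    exists t => //; have : range (flow^~ (gamma t)) p by rewrite -fibers.
    by move=> [s _ sE]; exists s => //; rewrite /P /vertical_cylinder pt2_00 pt2_01.
  exists t => //; rewrite /P /vertical_cylinder pt2_00 pt2_01.
  by rewrite proj_flow.
move=> t h /(regular t h) D0; have Dt := D_gt0 t D0.
have X0 : inner (gamma t) (xixg t) (xixg t) != 0 by rewrite XX.
split; last exact: angleE.
  by move=> s; exact: cylinder_flat (gH t (inU t h)).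
have [n nE nk] := cylinder_geodesic_curvature (gH t (inU t h)) (v1 t h) X0.
exists n; first exact: nE.
have [nuE vxi _ _] := point t h.
have Nv : inner (gamma t) (N (c t)) (velocity gamma t) = 0.
  by rewrite innerC (v_c t (inU t h)); case: f_H => _ [_ _ Nn _] _ _; exact: Nn.
have Nxi : inner (gamma t) (N (c t)) (xi (gamma t)) = sin (vt t).
  by rewrite -nuE; case: f_H => _ _ /(_ (c t)) [_ -> _ _].
have cv : cross (gamma t) (velocity gamma t) (xixg t) =
    xi (gamma t) - inner (gamma t) (xi (gamma t)) (velocity gamma t) *: velocity gamma t.
  by rewrite cross_anti cross_crossE v1// scale1r opprB.
move: nk; cbv zeta; rewrite -/(xixg t) cv (acc t h) innerZl innerZr.
rewrite innerDr innerNr innerZr Nv Nxi (vnormE t h) powR_half//.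
set k := (X in geodesic_curvature_is _ _ _ _ X -> _).
set k' := (X in _ -> geodesic_curvature_is _ _ _ _ X).
suff -> : k = k' by [].
rewrite /k /k'; move: (Num.sqrt (D t)) ('D_1 vt t) (sin theta) (sin (vt t)) => r b x y.
by ring.
Qed.
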